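(* Let $V(x,y)=q_{\rm av}(x)+q(x,y)$ satisfy Hypotheses (V), with $q\not\equiv0$, and set $V_\epsilon(x)=q_{\rm av}(x)+q(x,x/\epsilon)$. The potential $q_{\rm av}$ is allowed to be either generic or non-generic. Then there exists $\epsilon_0>0$ such that for every $0<\epsilon<\epsilon_0$ the potential $V_\epsilon$ is generic.
   Context: Function spaces: for $\beta>0$, $L^\infty_\beta$ is the space of measurable $g:\mathbb{R}\to\mathbb{C}$ with $|g|_{L^\infty_\beta}=\operatorname{ess\,sup}_x e^{\beta|x|}|g(x)|<\infty$, and $|g|_{W^{n,\infty}_\beta}=\sum_{l=0}^n|\partial_x^l g|_{L^\infty_\beta}$. Hypotheses (V): $V(x,y)=q_{\rm av}(x)+q(x,y)$, $q(x,y)=\sum_{j\in\mathbb{Z}\setminus\{0\}}q_j(x)e^{2\pi i\lambda_jy}$, is real-valued with $q_{\rm av}$ real-valued, $\overline{q_j}=q_{-j}$, $\lambda_{-j}=-\lambda_j$; there are $\theta,\beta>0$ with $\inf_{j\ne k}|\lambda_j-\lambda_k|\ge\theta$ and $\inf_{j\neq 0}|\lambda_j|\ge\theta$ ($\lambda_j$ real); and $|q_{\rm av}|_{W^{1,\infty}_\beta}+\sum_{j\ne0}|q_j|_{W^{3,\infty}_\beta}<\infty$. Jost solutions and transmission coefficient: for real-valued $U\in L^\infty_\beta$ and $|\Im k|<\beta/2$, $f^U_\pm(x;k)$ are the solutions of $(-\partial_x^2+U-k^2)u=0$ given uniquely by $f^U_+(x;k)=e^{ikx}+\int_x^\infty\frac{\sin(k(y-x))}{k}U(y)f^U_+(y;k)\,dy$,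 $f^U_-(x;k)=e^{-ikx}-\int_{-\infty}^x\frac{\sin(k(y-x))}{k}U(y)f^U_-(y;k)\,dy$ (with $\sin(kz)/k=z$ at $k=0$). With $\mathcal{W}[h_1,h_2]=h_1h_2'-h_2h_1'$, $t^U$ is defined by $\mathcal{W}[f^U_+,f^U_-](k)=-2ik/t^U(k)$ (by continuity at $k=0$). Generic: a potential $U$ is generic if $t^U(0)=0$; equivalently $\mathcal{W}[f^U_+,f^U_-](0)\neq0$; equivalently $k/t^U(k)$ has a non-zero limit as $k\to0$. Otherwise it is non-generic. *)

(* Defs.v *)
From HB Require Import structures.
From mathcomp Require Import all_boot all_order all_algebra.
From mathcomp Require Import all_classical all_reals all_analysis ess_sup_inf.
From mathcomp Require Import complex.

Set Implicit Arguments.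
Unset Strict Implicit.
Unset Printing Implicit Defensive.

Import Order.TTheory GRing.Theory Num.Theory.
Import numFieldNormedType.Exports.

Local Open Scope classical_set_scope.
Local Open Scope ring_scope.
Local Open Scope complex_scope.

Section ComplexValued.
Context {R : realType}.
Implicit Types (D : set R) (f g h : R -> R[i]) (z k : R[i]).

Local Notation mu := (@lebesgue_measure R).

Definition cexp z : R[i] := (expR (complex.Re z))%:C * (cos (complex.Im z) +i* sin (complex.Im z)).

Definition csin z : R[i] := (cexp ('i * z) - cexp (- ('i * z))) / (2 * 'i).

Definition cintegrable D f : Prop :=
  mu.-integrable D (EFin \o (fun x => complex.Re (f x))) /\
  mu.-integrable D (EFin \o (fun x => complex.Im (f x))).

Definition cintegral D f : R[i] :=
  Rintegral mu D (fun x => complex.Re (f x)) +i* Rintegral mu D (fun x => complex.Im (f x)).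

Definition clocally_integrable f : Prop :=
  locally_integrable [set: R] (fun x => complex.Re (f x)) /\
  locally_integrable [set: R] (fun x => complex.Im (f x)).

Definition cderive f (x : R) : R[i] :=
  derive1 (fun y => complex.Re (f y)) x
  +i* derive1 (fun y => complex.Im (f y)) x.

Definition wronskian g h (x : R) : R[i] :=
  g x * cderive h x - h x * cderive g x.

End ComplexValued.

Section WeightedSobolev.
Context {R : realType}.
Implicit Types (phi : R -> R) (beta : R) (n : nat) (g h : R -> R[i]).

Local Notation mu := (@lebesgue_measure R).

Definition test_function phi : Prop :=
  [/\ forall x, derivable phi x 1,
      continuous (derive1 phi) &
      exists M : R, forall x, M < `|x| -> phi x = 0].

(* Real test functions suffice also for complex-valued g, and compactly
   supported C^1 ones give the same weak derivatives as smooth ones. *)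
Definition weak_derivative g h : Prop :=
  forall phi, test_function phi ->
    cintegral [set: R] (fun x => g x * (derive1 phi x)%:C) =
    - cintegral [set: R] (fun x => h x * (phi x)%:C).

Definition Linf_norm beta g : \bar R :=
  ess_sup mu (fun x => (expR (beta * `|x|) * Normc.normc (g x))%:E).

(* d l is the l-th weak derivative of g for l <= n (d l is irrelevant for
   l > n). *)
Definition weak_derivatives n g (d : nat -> R -> R[i]) : Prop :=
  [/\ d 0%N = g,
      forall l, (l <= n)%N -> clocally_integrable (d l) &
      forall l, (l < n)%N -> weak_derivative (d l) (d l.+1)].

(* Weak derivatives are unique almost everywhere, so the infimum ranges over
   at most one value; it is +oo if g is not n times weakly differentiable.
   Thus g belongs to the weighted Sobolev space iff Sobolev_norm is finite. *)
Definition Sobolev_norm n beta g : \bar R :=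
  ereal_inf [set (\sum_(l < n.+1) Linf_norm beta (d l))%E
            | d in [set d | weak_derivatives n g d]].

End WeightedSobolev.

Section Potential.
Context {R : realType}.

Definition fourier_mode (qc : int -> R -> R[i]) (lam : int -> R)
    (j : int) (x y : R) : R[i] :=
  qc j x * cexp ('i * (2 * pi * lam j * y)%:C).

(* The values of qc and lam at 0 play no role. The Fourier-type series is the
   limit of its symmetric partial sums; it converges absolutely for almost
   every x by hypV_norm. *)
Record hypV (theta beta : R) (qav : R -> R) (q : R -> R -> R)
    (qc : int -> R -> R[i]) (lam : int -> R) : Prop := HypV {
  hypV_theta : 0 < theta ;
  hypV_beta : 0 < beta ;
  hypV_series : forall x y,
    (fun N : nat => \sum_(1 <= n < N.+1)
       (fourier_mode qc lam n%:Z x y + fourier_mode qc lam (- n%:Z) x y) : R[i]^o)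
      @ \oo --> ((q x y)%:C : R[i]^o) ;
  hypV_conj : forall (j : int) (x : R), j != 0 -> (qc j x)^* = qc (- j) x ;
  hypV_odd : forall j : int, j != 0 -> lam (- j) = - lam j ;
  hypV_gap : forall j k : int, j != 0 -> k != 0 -> j != k ->
    theta <= `|lam j - lam k| ;
  hypV_gap0 : forall j : int, j != 0 -> theta <= `|lam j| ;
  hypV_norm : (Sobolev_norm 1 beta (fun x => (qav x)%:C)
     + esum [set j : int | j != 0%R] (fun j => Sobolev_norm 3 beta (qc j))
     < +oo)%E
}.

Definition potential_eps (qav : R -> R) (q : R -> R -> R) (eps x : R) : R :=
  qav x + q x (x / eps).

End Potential.

Section Scattering.
Context {R : realType}.
Implicit Types (U : R -> R) (k : R[i]) (f : R -> R[i]) (t : R[i] -> R[i]).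

Definition sinkz k (z : R) : R[i] :=
  if k == 0 then z%:C else csin (k * z%:C) / k.

Definition jost_plus U k f : Prop := forall x,
  cintegrable `[x, +oo[ (fun y => sinkz k (y - x) * (U y)%:C * f y) /\
  f x = cexp ('i * k * x%:C)
        + cintegral `[x, +oo[ (fun y => sinkz k (y - x) * (U y)%:C * f y).

Definition jost_minus U k f : Prop := forall x,
  cintegrable `]-oo, x] (fun y => sinkz k (y - x) * (U y)%:C * f y) /\
  f x = cexp (- ('i * k * x%:C))
        - cintegral `]-oo, x] (fun y => sinkz k (y - x) * (U y)%:C * f y).

(* The strip |Im k| < beta / 2 is a neighborhood of 0, and only k near
   0 matters for genericity, so t is left unconstrained elsewhere. For U
   measurable with ess sup e^(beta |x|) |U(x)| finite, the Volterra equations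
   with absolutely convergent integrals have unique solutions in that strip,
   and the Wronskian does not depend on x. t k != 0 rules out x / 0 = 0; the
   last clause is the extension of t to k = 0 by continuity. *)
Definition transmission_near0 U t : Prop :=
  (\forall k \near (0 : R[i]^o)^', exists fp fm : R -> R[i],
     [/\ jost_plus U k fp, jost_minus U k fm, t k != 0 &
         forall x, wronskian fp fm x = - (2 * 'i * k) / t k]) /\
  (t : R[i]^o -> R[i]^o) k @[k --> (0 : R[i]^o)^'] --> (t 0 : R[i]^o).

Definition generic U : Prop :=
  exists t, transmission_near0 U t /\ t 0 = 0.

End Scattering.

(* Main.v *)
(* Write q_eps(x) = q(x, x/eps). Let w be the zero-energy Jost solution of q_av from
   the right and u that of V_eps; let v and u~ be those of the reflected
   potentials, i.e. the Jost solutions from the left. As q_eps oscillates at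
   frequencies of order 1/eps, S(x) = - \int_x^oo q_eps is O(eps) and the primitive
   of S is O(eps^2). With p = u' - S u, both u - w and p - w' are O(eps^2) at 0,
   and since (w p - u w')' = - S (w u)',
     (w p - u w')(0) = \int_0^oo (2 S w w' + S^2 w^2) + O(eps^3).
   If the Wronskian of q_av is nonzero, so is that of V_eps for small eps.
   Otherwise v(x) = k w(-x). Integrating 2 S w w' by parts and adding the expansions
   on the two half-lines, the terms linear in S reduce to \int_R q_eps w^2, which
   three integrations by parts show to be O(eps^3), and the Wronskian of V_eps is,
   up to sign, k (\int_R S^2 w^2) + O(eps^3). The integral is at least c eps^2:
   some mode of q is nonzero at a point where w is, and testing S w^2 against this
   mode gives, by resonance, a quantity of exact order eps. So the Wronskian W(k)
   of the Jost solutions of V_eps is nonzero at k = 0, and by continuity of W the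
   transmission coefficient -2ik/W(k) tends to 0. *)
Require Import Defs.
From mathcomp Require Import all_boot all_order all_algebra.
From mathcomp Require Import all_classical all_reals all_analysis ess_sup_inf.
From mathcomp Require Import measurable_realfun complex.
From mathcomp Require Import ring lra.

Set Implicit Arguments.
Unset Strict Implicit.
Unset Printing Implicit Defensive.

Import Order.TTheory GRing.Theory Num.Theory.
Import numFieldNormedType.Exports.

Local Open Scope classical_set_scope.
Local Open Scope ring_scope.

(** * Antiderivatives of locally bounded functions *)

Section Primitive.
Context {R : realType}.
Implicit Types (F G f g : R -> R) (a b x y M : R).

Local Notation mu := (@lebesgue_measure R).

(** The highest derivatives in the hypotheses are only bounded and measurable, so differentiation is
    replaced throughout by the integral relation [prim]. Uniformity in epsilon comes from placing
    q_av and every V_epsilon in one class of potentials with a common exponential bound, over which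
    the estimates on Jost solutions are uniform. The obstacle is the non-generic case: the wanted
    term has order eps^2, so everything linear in q_eps has to be O(eps^3). On one half-line it is
    not, because integration by parts leaves boundary terms at 0 of order eps; in the Wronskian
    those of the two half-lines cancel identically. What is left is an integral over R, free of
    boundary terms, whose three integrations by parts use three derivatives of q_j and, through w'''
    = (q_av w)', one of q_av. Non-genericity of q_av is also what bounds w on both sides: in general
    it grows linearly at -oo. *)

Definition mlb f : Prop :=
  measurable_fun setT f /\
  forall r : R, exists M, forall x, `|x| <= r -> `|f x| <= M.

(* Antiderivatives in the integral sense: [f] need not be continuous. *)
Definition prim F f : Prop :=
  mlb f /\ forall a b, a <= b -> F b - F a = \int[mu]_(x in `[a, b]) f x.

Lemma mlb_bound f : mlb f -> forall a b, exists2 M, 0 <= M &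
  forall x, a <= x -> x <= b -> `|f x| <= M.
Proof.
move=> [_ fb] a b; have [M HM] := fb (`|a| + `|b|).
exists (Num.max 0 M); first by rewrite le_max lexx.
move=> x ax xb; rewrite le_max HM ?orbT//.
have := ler_norm b; have := ler_norm (- a); rewrite normrN => ? ?.
have := normr_ge0 a; have := normr_ge0 b => ? ?.
by rewrite ler_norml; apply/andP; split; lra.
Qed.

Lemma mlb_cst c : mlb (fun=> c).
Proof. by split => [|r]; [exact: measurable_cst|exists `|c|]. Qed.

Lemma mlbD f g : mlb f -> mlb g -> mlb (fun x => f x + g x).
Proof.
move=> [mf fb] [mg gb]; split; first exact: measurable_funD.
move=> r; have [M HM] := fb r; have [N HN] := gb r; exists (M + N) => x xr.
by rewrite (le_trans (ler_normD _ _))// lerD ?HM ?HN.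
Qed.

Lemma mlbM f g : mlb f -> mlb g -> mlb (fun x => f x * g x).
Proof.
move=> [mf fb] [mg gb]; split; first exact: measurable_funM.
move=> r; have [M HM] := fb r; have [N HN] := gb r; exists (M * N) => x xr.
by rewrite normrM ler_pM ?HM ?HN.
Qed.

Lemma mlbZ c f : mlb f -> mlb (fun x => c * f x).
Proof. by move=> mf; apply: mlbM => //; exact: mlb_cst. Qed.

Lemma mlbN f : mlb f -> mlb (fun x => - f x).
Proof.
by move=> mf; rewrite (_ : (fun _ => _) = (fun x => -1 * f x));
  [exact: mlbZ|apply/funext => x; rewrite mulN1r].
Qed.

Lemma mlbB f g : mlb f -> mlb g -> mlb (fun x => f x - g x).
Proof. by move=> mf mg; apply: mlbD => //; exact: mlbN. Qed.

Lemma mlb_oppx f : mlb f -> mlb (fun x => f (- x)).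
Proof.
move=> [mf fb]; split.
  by apply: (measurableT_comp mf); exact: oppr_measurable.
by move=> r; have [M HM] := fb r; exists M => x xr; rewrite HM ?normrN.
Qed.

Lemma mlb_continuous f : continuous f -> mlb f.
Proof.
move=> cf; split; first exact: continuous_measurable_fun.
move=> r.
have [/= M [_ HM]] : bounded_set (f @` `[- r, r]).
  apply: compact_bounded; apply: continuous_compact; last exact: segment_compact.
  exact: continuous_subspaceT.
exists (M + 1) => x xr; apply: (HM (M + 1)); first by rewrite ltrDl.
by exists x => //=; rewrite in_itv /= -ler_norml.
Qed.

Lemma mlb_integrable f a b : mlb f -> mu.-integrable `[a, b] (EFin \o f).
Proof.
move=> mf; have [M _ HM] := mlb_bound mf a b.
apply: measurable_bounded_integrable => //.
- by rewrite /= lebesgue_measure_itv /=; case: ifP => // _; rewrite -EFinD ltry.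
- by apply: measurable_funTS; case: mf.
- exists M; split; first exact: num_real.
  move=> N MN x /=; rewrite in_itv /= => /andP[ax xb].
  exact: (le_trans (HM _ ax xb) (ltW MN)).
Qed.

Lemma mlb_int_le f a b M : a <= b -> mlb f ->
  (forall x, a <= x -> x <= b -> `|f x| <= M) ->
  `|\int[mu]_(x in `[a, b]) f x| <= M * (b - a).
Proof.
move=> ab mf HM.
have fi := mlb_integrable a b mf.
apply: (le_trans (le_normr_Rintegral _ fi)) => //.
have -> : M * (b - a) = \int[mu]_(x in `[a, b]) (cst M x).
  rewrite Rintegral_cst//= lebesgue_measure_itv/=.
  case: ifPn => [//|]; rewrite lte_fin -leNgt => ba.
  by rewrite (_ : b = a) ?subrr//; apply/eqP; rewrite eq_le ab ba.
apply: le_Rintegral => //=; first exact: integrable_norm.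
- by have := mlb_integrable a b (mlb_cst M).
- by move=> x /=; rewrite in_itv /= => /andP[ax xb]; exact: HM.
Qed.

Lemma prim_mlb_d F f : prim F f -> mlb f. Proof. by case. Qed.

Lemma prim_lip F f a b : prim F f -> exists2 M, 0 <= M &
  forall x y, a <= x -> x <= y -> y <= b -> `|F y - F x| <= M * (y - x).
Proof.
move=> [mf Ff]; have [M M0 HM] := mlb_bound mf a b; exists M => // x y ax xy yb.
rewrite Ff//; apply: mlb_int_le => // z xz zy; apply: HM; lra.
Qed.

Lemma prim_continuous F f : prim F f -> continuous F.
Proof.
move=> pF x; have [M M0 HM] := prim_lip (x - 1) (x + 1) pF.
apply/(@cvgrPdist_le _ R^o) => e e0; near=> y.
have : `|x - y| <= Num.min 1 (e / (M + 1)).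
  near: y; apply: (@cvgr_dist_le _ R^o); first exact: cvg_id.
  by rewrite lt_min ltr01 divr_gt0// ltr_wpDl.
rewrite le_min => /andP[xy1 xye].
suff : `|F x - F y| <= M * `|x - y|.
  move=> /le_trans; apply; rewrite (@le_trans _ _ ((M + 1) * `|x - y|))//.
    by rewrite ler_wpM2r// lerDl.
  by rewrite mulrC -ler_pdivlMr// ltr_wpDl.
move: xy1; rewrite ler_norml => /andP[? ?].
have [xy|/ltW xy] := leP x y.
  rewrite distrC (distrC x) (ger0_norm (_ : 0 <= y - x)) ?subr_ge0//.
  by apply: HM; lra.
by rewrite (ger0_norm (_ : 0 <= x - y)) ?subr_ge0//; apply: HM; lra.
Unshelve. all: by end_near. Qed.

Lemma prim_mlb F f : prim F f -> mlb F.
Proof. by move=> /prim_continuous; exact: mlb_continuous. Qed.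

Lemma primD F G f g : prim F f -> prim G g ->
  prim (fun x => F x + G x) (fun x => f x + g x).
Proof.
move=> [mf Ff] [mg Gg]; split; first exact: mlbD.
move=> a b ab; rewrite RintegralD//; [|exact: mlb_integrable..].
by rewrite -Ff// -Gg//; ring.
Qed.

Lemma primZ c F f : prim F f -> prim (fun x => c * F x) (fun x => c * f x).
Proof.
move=> [mf Ff]; split; first exact: mlbZ.
move=> a b ab; rewrite RintegralZl//; last exact: mlb_integrable.
by rewrite -Ff//; ring.
Qed.

Lemma primN F f : prim F f -> prim (fun x => - F x) (fun x => - f x).
Proof.
move=> /(primZ (-1)).
by congr prim; apply/funext => x; rewrite mulN1r.
Qed.

Lemma primB F G f g : prim F f -> prim G g ->
  prim (fun x => F x - G x) (fun x => f x - g x).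
Proof. by move=> pF pG; apply: primD => //; exact: primN. Qed.

Lemma prim_cst c : prim (fun=> c) (fun=> 0).
Proof.
split; first exact: mlb_cst.
by move=> a b ab; rewrite subrr Rintegral_cst// mul0r.
Qed.

Lemma prim_id : prim (fun x => x) (fun=> 1).
Proof.
split; first exact: mlb_cst.
move=> a b ab; rewrite Rintegral_cst//= lebesgue_measure_itv/=.
case: ifPn => [|]; first by rewrite mul1r.
by rewrite lte_fin -leNgt => ba; rewrite mulr0; apply/eqP; rewrite subr_eq0 eq_le ab ba.
Qed.

Lemma prim0 F : prim F (fun=> 0) -> forall a b, F a = F b.
Proof.
move=> [_ F0].
suff H a b : a <= b -> F a = F b.
  by move=> a b; have [/H//|/ltW /H ->] := leP a b.
by move=> /F0; rewrite Rintegral_cst// mul0r => /eqP; rewrite subr_eq0 => /eqP ->.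
Qed.

Lemma eq_prim F f g : f =1 g -> prim F f -> prim F g.
Proof. by move=> /funext ->. Qed.

(** Bisecting n times leaves 2^n pieces whose errors add up to at most K (b - a)^2 2^-n. *)
Lemma additive_quadratic_eq0 (e : R -> R -> R) a b (K : R) : a <= b -> 0 <= K ->
  (forall x y z, a <= x -> x <= y -> y <= z -> z <= b -> e x z = e x y + e y z) ->
  (forall x y, a <= x -> x <= y -> y <= b -> `|e x y| <= K * (y - x) ^+ 2) ->
  e a b = 0.
Proof.
move=> ab K0 eD eK.
have H n x y : a <= x -> x <= y -> y <= b ->
    `|e x y| <= K * (y - x) ^+ 2 * 2^-1 ^+ n.
  elim: n x y => [|n IH] x y ax xy yb; first by rewrite expr0 mulr1 eK.
  pose m := (x + y) / 2.
  have xm : x <= m by rewrite /m; lra.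
  have my : m <= y by rewrite /m; lra.
  rewrite (eD x m y)//; apply: (le_trans (ler_normD _ _)).
  have := IH x m ax xm (le_trans my yb).
  have := IH m y (le_trans ax xm) my yb.
  have -> : m - x = (y - x) / 2 by rewrite /m; field.
  have -> : y - m = (y - x) / 2 by rewrite /m; field.
  move=> h1 h2; apply: (le_trans (lerD h2 h1)).
  by rewrite (exprS _ n); move: (2^-1 ^+ n) => t; rewrite le_eqVlt; apply/orP; left; apply/eqP; field.
apply/eqP; rewrite -normr_le0; apply/ler_addgt0Pl => d d0; rewrite addr0.
have [n Hn] : exists n, K * (b - a) ^+ 2 * 2^-1 ^+ n <= d.
  pose C := K * (b - a) ^+ 2.
  have C0 : 0 <= C by rewrite mulr_ge0// sqr_ge0.
  exists (Num.bound (C / d)).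
  have h : C / d <= 2 ^+ (Num.bound (C / d)).
    apply: (le_trans (ltW (archi_boundP _))); first by rewrite divr_ge0// ltW.
    by rewrite -natrX ler_nat ltnW// ltn_expl.
  by rewrite -/C exprVn ler_pdivrMr ?exprn_gt0// mulrC -ler_pdivrMr.
exact: le_trans (H n _ _ _ _ _) Hn.
Qed.

Lemma Rint_split f a b c : mlb f -> a <= b -> b <= c ->
  \int[mu]_(x in `[a, c]) f x =
  \int[mu]_(x in `[a, b]) f x + \int[mu]_(x in `[b, c]) f x.
Proof.
move=> mf ab bc.
have := @Rintegral_itvB R f (BLeft a) (BRight c) b (mlb_integrable a c mf).
rewrite !bnd_simp => /(_ ab bc) h.
rewrite -(@Rintegral_itv_obnd_cbnd _ b (BRight c)); first by rewrite -h; ring.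
by apply: integrableS (mlb_integrable b c mf) => //; apply: subset_itvr; rewrite bnd_simp.
Qed.

(** Product rule without pointwise derivatives: the defect of the formula is additive over adjacent
    intervals and, as F and G are Lipschitz on [a, b], quadratic in the length; hence it is zero. *)
Lemma primM F G f g : prim F f -> prim G g ->
  prim (fun x => F x * G x) (fun x => f x * G x + F x * g x).
Proof.
move=> pF pG.
have [mf Ff] := pF; have [mg Gg] := pG.
have mF := prim_mlb pF; have mG := prim_mlb pG.
have mD : mlb (fun x => f x * G x + F x * g x) by apply: mlbD; exact: mlbM.
split=> // a b ab.
pose e a b := F b * G b - F a * G a - \int[mu]_(x in `[a, b]) (f x * G x + F x * g x).
suff : e a b = 0 by rewrite /e => /eqP; rewrite subr_eq0 => /eqP.
have [M1 M10 HF] := prim_lip a b pF.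
have [M2 M20 HG] := prim_lip a b pG.
have [N1 N10 Hf] := mlb_bound mf a b.
have [N2 N20 Hg] := mlb_bound mg a b.
apply: (@additive_quadratic_eq0 e a b (N1 * M2 + M1 * N2)) => //.
- by rewrite addr_ge0// mulr_ge0.
- move=> x y z ax xy yz zb; rewrite /e (Rint_split mD xy yz); ring.
- move=> x y ax xy yb.
  have mD' : mlb (fun z => f z * (G y - G z) + (F x - F z) * g z).
    by apply: mlbD; apply: mlbM => //; apply: mlbB => //; exact: mlb_cst.
  have -> : e x y = \int[mu]_(z in `[x, y]) (f z * (G y - G z) + (F x - F z) * g z).
    rewrite /e.
    (* The increment is expanded with G frozen at y and F frozen at x, so that only increments of F
       and G over [x, y] remain in the defect. *)
    have -> : F y * G y - F x * G x =
        \int[mu]_(z in `[x, y]) (G y * f z + F x * g z).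
      rewrite RintegralD//; [|by apply: (@mlb_integrable (fun z => _ * _)); exact: mlbZ..].
      rewrite !RintegralZl//; [|exact: mlb_integrable..].
      by rewrite -Ff// -Gg//; ring.
    rewrite -RintegralB//; last first.
    + exact: (@mlb_integrable (fun z => _ + _)).
    + by apply: (@mlb_integrable (fun z => _ + _)); apply: mlbD; exact: mlbZ.
    by apply: eq_Rintegral => z _; ring.
  rewrite expr2 mulrA; apply: mlb_int_le => // z xz zy.
  apply: (le_trans (ler_normD _ _)); rewrite [leRHS]mulrDl lerD// normrM.
    rewrite -mulrA ler_pM ?Hf//; [lra|lra|].
    apply: (le_trans (HG z y _ _ _)); [lra|lra|lra|].
    by rewrite ler_wpM2l// lerB.
  rewrite distrC mulrAC ler_pM ?Hg//; [|lra|lra].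
  apply: (le_trans (HF x z _ _ _)); [lra|lra|lra|].
  by rewrite ler_wpM2l// lerB.
Qed.

Lemma prim_derive F f : prim F f -> continuous f ->
  forall x, derivable F x 1 /\ derive1 F x = f x.
Proof.
move=> [mf Ff] cf x.
pose a := x - 1.
have ax : a < x by rewrite /a; lra.
have [||d1 d2] := @continuous_FTC1_closed R f a x (x + 1) _ (mlb_integrable a (x + 1) mf) ax.
- by rewrite ltrDl.
- exact: cf.
pose H y := F a + \int[mu]_(t in `[a, y]) f t.
have dH : is_derive x 1 H (f x).
  rewrite /H; apply: is_derive_eq; last exact: add0r.
  apply: (@is_deriveD _ R^o R^o (cst (F a)) (fun y => \int[mu]_(t in `[a, y]) f t)).
  by apply: DeriveDef; [exact: d1|rewrite -derive1E; exact: d2].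
have nHF : {near x, H =1 F}.
  near=> y; rewrite /H -Ff; first by rewrite addrC subrK.
  by near: y; apply: lt_le_nbhsr.
have dF : is_derive x 1 F (f x) by apply: near_eq_is_derive dH; rewrite ?oner_eq0.
by split; [case: dF|rewrite derive1E; case: dF].
Unshelve. all: by end_near. Qed.

Lemma derive_prim F f : (forall x, is_derive x (1:R) F (f x)) -> continuous f -> prim F f.
Proof.
move=> dF cf; split; first exact: mlb_continuous.
move=> a b; rewrite le_eqVlt => /predU1P[->|ab].
  by rewrite subrr set_itv1 Rintegral_set1.
rewrite /Rintegral (@continuous_FTC2 _ _ F)//.
- exact: continuous_subspaceT.
- have cF : continuous F.
    by move=> x; apply: differentiable_continuous; apply/derivable1_diffP; case: (dF x).
  split => //.
  + by apply: cvg_at_right_filter; exact: cF.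
  + by apply: cvg_at_left_filter; exact: cF.
- by move=> x _; rewrite derive1E; case: (dF x).
Qed.

End Primitive.

(** * Tail integrals *)

Section Tail.
Context {R : realType}.
Implicit Types (F G f g h : R -> R) (a b x y M : R) (c : R).

Local Notation mu := (@lebesgue_measure R).

(** Change of variables x -> -x: Lebesgue measure is its own pushforward under negation. *)
Lemma integrable_opp f (D : set R) : measurable D -> measurable_fun setT f ->
  mu.-integrable (-%R @^-1` D) (fun x => (f (- x))%:E) -> mu.-integrable D (EFin \o f).
Proof.
move=> mD mf fi.
have mo : measurable_fun setT (-%R : measurableTypeR R -> measurableTypeR R) by exact: oppr_measurable.
have := @integrable_pushforward _ _ (measurableTypeR R) (measurableTypeR R) R _ mo mu D (EFin \o f) _ _ mD.
move=> /(_ _ fi)/integrableP[|mf' H]; first exact/measurable_EFinP.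
apply/integrableP; split => //.
by rewrite (eq_measure_integral (pushforward mu (-%R : R -> measurableTypeR R)))// => A mA _; first [exact: lebesgue_measureN|exact/esym/lebesgue_measureN].
Qed.

Lemma Rintegral_opp f (D : set R) : measurable D -> measurable_fun setT f ->
  mu.-integrable (-%R @^-1` D) (fun x => (f (- x))%:E) ->
  \int[mu]_(x in -%R @^-1` D) f (- x) = \int[mu]_(x in D) f x.
Proof.
move=> mD mf fi.
have mo : measurable_fun setT (-%R : measurableTypeR R -> measurableTypeR R) by exact: oppr_measurable.
rewrite /Rintegral; congr fine.
rewrite -[LHS](@integral_pushforward _ _ (measurableTypeR R) (measurableTypeR R) R _ mo mu D (EFin \o f))//; last exact/measurable_EFinP.
by apply: eq_measure_integral => // A mA _; first [exact: lebesgue_measureN|exact/esym/lebesgue_measureN].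
Qed.

Lemma prim_oppx F f : prim F f -> prim (fun x => F (- x)) (fun x => - f (- x)).
Proof.
move=> [mf Ff]; split; first exact/mlbN/mlb_oppx.
move=> a b ab.
have mfo := mlb_oppx mf.
have E : (-%R @^-1` `[- b, - a]) = `[a, b]%classic :> set R.
  by rewrite opp_preimage_itvbndbnd !opprK.
have := @Rintegral_opp f `[- b, - a] (measurable_itv _) mf.1.
rewrite E => /(_ (mlb_integrable a b mfo)) H.
rewrite (_ : (fun _ => - _) = (fun x => -1 * f (- x))); last by apply/funext => x; rewrite mulN1r.
rewrite RintegralZl//; last exact: (mlb_integrable a b mfo).
by rewrite H -Ff ?lerN2//; ring.
Qed.

(** Each half-line [x, +oo[ has its own M, so nothing is imposed at -oo, where Jost solutions from
    the right may grow. *)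
Definition tail c f : Prop := measurable_fun setT f /\
  forall x, exists M, forall y, x <= y -> `|f y| <= M * expR (- (c * y)).

Definition J f x : R := \int[mu]_(y in `[x, +oo[) f y.

Lemma is_derive_compM (f : R -> R) (c x d : R) : is_derive (c * x) (1:R) f d ->
  is_derive x (1:R) (fun y => f (c * y)) (c * d).
Proof.
move=> df; rewrite mulrC.
apply: (@is_derive1_comp R f (fun y => c * y)).
have := @is_deriveZ R R^o R^o (@id R) c x 1 1 (is_derive_id _ _).
by rewrite /GRing.scale /= mulr1.
Qed.

Lemma is_derive_expRM (c x : R) : is_derive x (1:R) (fun y => expR (c * y)) (c * expR (c * x)).
Proof. exact: is_derive_compM. Qed.

Lemma continuous_expRM (c : R) : continuous (fun y : R => expR (c * y)).
Proof.
move=> x; apply: differentiable_continuous; apply/derivable1_diffP.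
by case: (is_derive_expRM c x).
Qed.

Lemma prim_expRM (c : R) : prim (fun y => expR (c * y)) (fun y => c * expR (c * y)).
Proof.
apply: derive_prim => x; first exact: is_derive_expRM.
by apply: cvgM; [exact: cvg_cst|exact: continuous_expRM].
Qed.

Lemma expR_cvg0 c : 0 < c -> expR (- (c * x)) @[x --> +oo] --> (0:R).
Proof.
move=> c0; apply: (@cvg_comp _ _ _ (fun x : R => c * x) (fun x => expR (- x)) _ +oo).
  by apply: gt0_cvgMry => //; exact: cvg_id.
exact: cvgr_expR.
Qed.

Lemma int_expR c x : 0 < c ->
  mu.-integrable `[x, +oo[ (fun y => (expR (- (c * y)))%:E) /\
  J (fun y => expR (- (c * y))) x = expR (- (c * x)) / c.
Proof.
move=> c0.
have dF (y : R) : is_derive y (1:R) (fun y => - expR (- c * y) / c) (expR (- (c * y))).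
  have := is_derive_expRM (- c) y => d.
  have -> : (fun y : R => - expR (- c * y) / c) = (fun y => (- c^-1) *: (expR (- c * y) : R^o)).
    by apply/funext => z; rewrite /GRing.scale /= !mulNr mulrC.
  have := @is_deriveZ R R^o R^o (fun y => expR (- c * y)) (- c^-1) y 1 _ d.
  by rewrite /GRing.scale /= mulrA mulrNN mulVf ?gt_eqF// mul1r mulNr.
have cF : continuous (fun y : R => - expR (- c * y) / c).
  by move=> y; apply: differentiable_continuous; apply/derivable1_diffP; case: (dF y).
have H : (\int[mu]_(y in `[x, +oo[) (expR (- (c * y)))%:E = 0%:E - (- expR (- c * x) / c)%:E)%E.
  apply: (@ge0_continuous_FTC2y R _ (fun y => - expR (- c * y) / c)).
  - by move=> y _; exact: expR_ge0.
  - apply: continuous_subspaceT => y; under eq_fun do rewrite -mulNr; exact: continuous_expRM.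
  - rewrite (_ : 0 = - 0 / c); last by rewrite oppr0 mul0r.
    apply: cvgM; last exact: cvg_cst.
    apply: cvgN; under eq_fun do rewrite mulNr; exact: expR_cvg0.
  - by move=> y _; case: (dF y).
  - exact/cvg_at_right_filter/cF.
  - by move=> y _; rewrite derive1E; case: (dF y).
split; last by rewrite /J /Rintegral H /= sub0r -mulNr opprK mulNr.
apply/integrableP; split.
  apply/measurable_EFinP; apply: measurable_funTS; apply: continuous_measurable_fun => y.
  by under eq_fun do rewrite -mulNr; exact: continuous_expRM.
under eq_integral do rewrite /= ger0_norm ?expR_ge0//.
by rewrite H -EFinD ltry.
Qed.

Lemma integrable_expRZ c x (M : R) : 0 < c ->
  mu.-integrable `[x, +oo[ (fun y => (M * expR (- (c * y)))%:E).
Proof.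
move=> c0; have [ei _] := int_expR x c0.
have -> : (fun y => (M * expR (- (c * y)))%:E) = (fun y => M%:E * (expR (- (c * y)))%:E)%E.
  by apply/funext => y; rewrite EFinM.
exact: integrableZl.
Qed.

Lemma tail_bound c f x : 0 < c -> tail c f -> exists2 M, 0 <= M &
  forall y, x <= y -> `|f y| <= M * expR (- (c * y)).
Proof.
move=> c0 [_ /(_ x)[M HM]]; exists (Num.max 0 M); first by rewrite le_max lexx.
by move=> y /HM /le_trans; apply; rewrite ler_wpM2r ?expR_ge0// le_max lexx orbT.
Qed.

Lemma tail_mlb c f : 0 < c -> tail c f -> mlb f.
Proof.
move=> c0 tf; split; first by case: tf.
move=> r; have [M M0 HM] := tail_bound (- r) c0 tf.
exists (M * expR (c * r)) => x; rewrite ler_norml => /andP[rx xr].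
apply: (le_trans (HM x rx)); rewrite ler_wpM2l// ler_expR -mulrN ler_pM2l//; lra.
Qed.

Lemma dec_integrable c f x M : 0 < c -> measurable_fun setT f ->
  (forall y, x <= y -> `|f y| <= M * expR (- (c * y))) ->
  mu.-integrable `[x, +oo[ (EFin \o f).
Proof.
move=> c0 mf HM.
apply: (@le_integrable _ _ _ mu `[x, +oo[ _ _ (fun y => (M * expR (- (c * y)))%:E)) => //.
- by apply/measurable_EFinP; exact: (measurable_funTS mf).
- move=> y /=; rewrite in_itv /= andbT => xy.
  by rewrite lee_fin (le_trans (HM _ xy))// ler_norm.
- exact: integrable_expRZ.
Qed.

Lemma tail_integrable c f x : 0 < c -> tail c f -> mu.-integrable `[x, +oo[ (EFin \o f).
Proof.
move=> c0 tf; have [M _ HM] := tail_bound x c0 tf.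
by apply: dec_integrable c0 _ HM; case: tf.
Qed.

Lemma J_bound c f x M : 0 < c -> measurable_fun setT f ->
  (forall y, x <= y -> `|f y| <= M * expR (- (c * y))) ->
  `|J f x| <= M / c * expR (- (c * x)).
Proof.
move=> c0 mf HM; have fi := dec_integrable c0 mf HM.
rewrite /J; apply: (le_trans (le_normr_Rintegral _ fi)) => //.
have [ei eE] := int_expR x c0.
rewrite mulrAC -mulrA -eE /J -RintegralZl//.
apply: le_Rintegral => //.
- exact: integrable_norm.
- exact: integrable_expRZ.
- by move=> y /=; rewrite in_itv /= andbT; exact: HM.
Qed.

Lemma tailD c f g : tail c f -> tail c g -> tail c (fun x => f x + g x).
Proof.
move=> [mf tf] [mg tg]; split; first exact: measurable_funD.
move=> x; have [M HM] := tf x; have [N HN] := tg x; exists (M + N) => y xy.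
by rewrite mulrDl (le_trans (ler_normD _ _))// lerD ?HM ?HN.
Qed.

Lemma tailZ c k f : tail c f -> tail c (fun x => k * f x).
Proof.
move=> [mf tf]; split; first by apply: measurable_funM => //; exact: measurable_cst.
move=> x; have [M HM] := tf x; exists (`|k| * M) => y xy.
by rewrite normrM -mulrA ler_wpM2l// HM.
Qed.

Lemma tailN c f : tail c f -> tail c (fun x => - f x).
Proof. by move=> /(tailZ (-1)); congr tail; apply/funext => x; rewrite mulN1r. Qed.

Lemma tailB c f g : tail c f -> tail c g -> tail c (fun x => f x - g x).
Proof. by move=> tf tg; apply: tailD => //; exact: tailN. Qed.

Lemma tail_norm c f : tail c f -> tail c (fun x => `|f x|).
Proof.
move=> [mf tf]; split; first by apply: measurableT_comp => //; exact: normr_measurable.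
by move=> x; have [M HM] := tf x; exists M => y xy; rewrite normr_id HM.
Qed.

Lemma JD c f g x : 0 < c -> tail c f -> tail c g ->
  J (fun x => f x + g x) x = J f x + J g x.
Proof.
by move=> c0 tf tg; rewrite /J RintegralD//; exact: (tail_integrable x c0).
Qed.

Lemma JZ c k f x : 0 < c -> tail c f -> J (fun x => k * f x) x = k * J f x.
Proof.
by move=> c0 tf; rewrite /J RintegralZl//; exact: (tail_integrable x c0).
Qed.

Lemma JN c f x : 0 < c -> tail c f -> J (fun x => - f x) x = - J f x.
Proof.
move=> c0 /(JZ (-1) x c0); rewrite mulN1r => <-.
by congr J; apply/funext => y; rewrite mulN1r.
Qed.

Lemma JB c f g x : 0 < c -> tail c f -> tail c g ->
  J (fun x => f x - g x) x = J f x - J g x.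
Proof. by move=> c0 tf tg; rewrite (@JD c)// ?(@JN c)//; exact: tailN. Qed.

Lemma J0 x : J (fun=> 0) x = 0.
Proof. by rewrite /J Rintegral_cst// mul0r. Qed.

Lemma eq_J f g x : (forall y, x <= y -> f y = g y) -> J f x = J g x.
Proof.
move=> fg; apply: eq_Rintegral => y; rewrite inE /= in_itv /= andbT; exact: fg.
Qed.

Lemma le_J c f g x : 0 < c -> tail c f -> tail c g ->
  (forall y, x <= y -> f y <= g y) -> J f x <= J g x.
Proof.
move=> c0 tf tg fg; apply: le_Rintegral => //; try exact: (tail_integrable x c0).
by move=> y /=; rewrite in_itv /= andbT; exact: fg.
Qed.

Lemma normr_J_le c f g x : 0 < c -> tail c f -> tail c g ->
  (forall y, x <= y -> `|f y| <= g y) -> `|J f x| <= J g x.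
Proof.
move=> c0 tf tg fg; apply: (@le_trans _ _ (J (fun y => `|f y|) x)).
  by apply: le_normr_Rintegral => //; exact: (tail_integrable x c0).
by apply: (@le_J c) => //; exact: tail_norm.
Qed.

Lemma J_prim c f : 0 < c -> tail c f -> prim (J f) (fun x => - f x).
Proof.
move=> c0 tf; have mf := tail_mlb c0 tf; split; first exact: mlbN.
move=> a b ab.
rewrite (_ : (fun _ => _) = (fun x => -1 * f x)); last by apply/funext => x; rewrite mulN1r.
rewrite RintegralZl//; last exact: (mlb_integrable a b mf).
have := @Rintegral_itvB R f (BLeft a) (BInfty _ false) b (tail_integrable a c0 tf).
rewrite !bnd_simp => /(_ ab isT) h.
rewrite {1}/J -(@Rintegral_itv_obnd_cbnd _ b (BInfty _ false)); last first.
  by apply: integrableS (tail_integrable b c0 tf) => //; apply: subset_itvr; rewrite bnd_simp.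
by rewrite -h /J; ring.
Qed.

Lemma prim_exp_decay_eq0 F c K : 0 < c -> prim F (fun=> 0) ->
  forall x, (forall y, x <= y -> `|F y| <= K * expR (- (c * y))) -> F x = 0.
Proof.
move=> c0 /prim0 F0 x HK.
apply/eqP; rewrite -normr_le0.
have cv : K * expR (- (c * y)) @[y --> +oo] --> K * 0.
  by apply: cvgM; [exact: cvg_cst|exact: expR_cvg0].
rewrite mulr0 in cv.
apply: (ler_cvg_to (cvg_cst _) cv).
near=> y; rewrite (F0 x y); apply: HK.
by near: y; apply: nbhs_pinfty_ge; rewrite num_real.
Unshelve. all: by end_near. Qed.

(** F + J f has derivative zero and decays, so this constant vanishes. Every integration by parts on
    a half-line goes through this lemma, with F the boundary expression. *)
Lemma prim_J c F f x K : 0 < c -> tail c f -> prim F f ->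
  (forall y, x <= y -> `|F y| <= K * expR (- (c * y))) -> F x = - J f x.
Proof.
move=> c0 tf pF HK.
have H : prim (fun x => F x + J f x) (fun=> 0).
  by apply: eq_prim (primD pF (J_prim c0 tf)) => y; rewrite subrr.
have [M M0 HM] := tail_bound x c0 tf.
apply/eqP; rewrite -addr_eq0; apply/eqP.
apply: (@prim_exp_decay_eq0 _ c (K + M / c) c0 H) => y xy.
rewrite mulrDl (le_trans (ler_normD _ _))// lerD ?HK//.
apply: J_bound => //; first by case: tf.
by move=> z yz; apply: HM; exact: le_trans yz.
Qed.

Lemma J_cvg c (f_ : nat -> R -> R) f x M : 0 < c ->
  (forall n, measurable_fun setT (f_ n)) -> measurable_fun setT f ->
  (forall n y, x <= y -> `|f_ n y| <= M * expR (- (c * y))) ->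
  (forall y, x <= y -> (fun n => f_ n y) @ \oo --> f y) ->
  (fun n => J (f_ n) x) @ \oo --> J f x.
Proof.
move=> c0 mf_ mf HM cf.
have D := @dominated_convergence _ _ R mu `[x, +oo[ (measurable_itv _)
  (fun n y => (f_ n y)%:E) (EFin \o f) (fun y => (M * expR (- (c * y)))%:E).
have [|||||fi _ cJ] := D.
- by move=> n; apply/measurable_EFinP; exact: (measurable_funTS (mf_ n)).
- by apply/measurable_EFinP; exact: (measurable_funTS mf).
- apply: aeW => y /=; rewrite in_itv /= andbT => xy.
  by apply: cvg_EFin; [exact: nearW|exact: cf].
- exact: integrable_expRZ.
- by apply: aeW => y n /=; rewrite in_itv /= andbT lee_fin; exact: HM.
rewrite /J /Rintegral; apply: fine_cvg.
rewrite fineK; first exact: cJ.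
by apply: (@integrable_fin_num _ _ R mu `[x, +oo[).
Qed.

End Tail.

(** * Complex-valued integrals and kernels *)

Local Open Scope complex_scope.

Section ComplexPrimitive.
Context {R : realType}.
Implicit Types (F G f g h : R -> R[i]) (a b x y M : R) (z w k : R[i]).

(* Unlike the modulus, this norm splits over real and imaginary parts; it is
   submultiplicative and equivalent to the modulus. *)
Definition N z : R := `|complex.Re z| + `|complex.Im z|.

Lemma cReD z w : complex.Re (z + w) = complex.Re z + complex.Re w.
Proof. by case: z => a b; case: w. Qed.
Lemma cImD z w : complex.Im (z + w) = complex.Im z + complex.Im w.
Proof. by case: z => a b; case: w. Qed.
Lemma cReN z : complex.Re (- z) = - complex.Re z.
Proof. by case: z. Qed.
Lemma cImN z : complex.Im (- z) = - complex.Im z.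
Proof. by case: z. Qed.
Lemma cReM z w : complex.Re (z * w) =
  complex.Re z * complex.Re w - complex.Im z * complex.Im w.
Proof. by case: z => a b; case: w. Qed.
Lemma cImM z w : complex.Im (z * w) =
  complex.Re z * complex.Im w + complex.Im z * complex.Re w.
Proof. by case: z => a b; case: w. Qed.

Definition ReImE := (cReD, cImD, cReN, cImN, cReM, cImM).

Lemma eq_ReIm z w : complex.Re z = complex.Re w -> complex.Im z = complex.Im w -> z = w.
Proof. by case: z => a b; case: w => c d /= -> ->. Qed.

Lemma N_ge0 z : 0 <= N z. Proof. by rewrite /N addr_ge0. Qed.
Lemma N0 : N 0 = 0. Proof. by rewrite /N /= normr0 addr0. Qed.
Lemma N1 : N 1 = 1. Proof. by rewrite /N /= normr0 normr1 addr0. Qed.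
Lemma NC x : N x%:C = `|x|. Proof. by rewrite /N /= normr0 addr0. Qed.
Lemma NN z : N (- z) = N z. Proof. by rewrite /N cReN cImN !normrN. Qed.

Lemma ND z w : N (z + w) <= N z + N w.
Proof.
rewrite /N cReD cImD addrACA; apply: lerD; exact: ler_normD.
Qed.

Lemma NB z w : N (z - w) <= N z + N w.
Proof. by rewrite -(NN w) ND. Qed.

Lemma NM z w : N (z * w) <= N z * N w.
Proof.
rewrite /N cReM cImM.
have := ler_normB (complex.Re z * complex.Re w) (complex.Im z * complex.Im w).
have := ler_normD (complex.Re z * complex.Im w) (complex.Im z * complex.Re w).
by rewrite !normrM; lra.
Qed.

Lemma NM_le z w a b : N z <= a -> N w <= b -> N (z * w) <= a * b.
Proof. by move=> za wb; apply: (le_trans (NM z w)); apply: ler_pM => //; exact: N_ge0. Qed.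

Lemma ND_le z w a b : N z <= a -> N w <= b -> N (z + w) <= a + b.
Proof. by move=> za wb; apply: (le_trans (ND z w)); exact: lerD. Qed.

Lemma NB_le z w a b : N z <= a -> N w <= b -> N (z - w) <= a + b.
Proof. by move=> za wb; apply: (le_trans (NB z w)); exact: lerD. Qed.

Lemma N_eq0 z : N z <= 0 -> z = 0.
Proof.
rewrite /N => H; have := normr_ge0 (complex.Re z); have := normr_ge0 (complex.Im z) => h1 h2.
by apply: eq_ReIm => /=; apply/eqP; rewrite -normr_le0; lra.
Qed.

Lemma Re_le_N z : `|complex.Re z| <= N z.
Proof. by rewrite /N lerDl. Qed.

Lemma Im_le_N z : `|complex.Im z| <= N z.
Proof. by rewrite /N lerDr. Qed.

Lemma normc_le_N z : Normc.normc z <= N z.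
Proof.
case: z => a b; rewrite /N /=.
rewrite -(@ler_pXn2r _ 2)// ?nnegrE ?sqrtr_ge0 ?addr_ge0//.
rewrite sqr_sqrtr ?addr_ge0 ?sqr_ge0// sqrrD !real_normK ?num_real//.
have : 0 <= `|a| * `|b| by rewrite mulr_ge0.
by rewrite -mulr_natl; lra.
Qed.

Lemma N_le_normc z : N z <= 2 * Normc.normc z.
Proof.
case: z => a b; rewrite /N /=.
have h (c d : R) : `|c| <= Num.sqrt (c ^+ 2 + d ^+ 2).
  rewrite -sqrtr_sqr ler_wsqrtr// lerDl sqr_ge0//.
by have := h a b; have := h b a; rewrite (addrC (b ^+ 2)); lra.
Qed.

Definition cmlb f := mlb (fun x => complex.Re (f x)) /\ mlb (fun x => complex.Im (f x)).

Definition cprim F f :=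
  prim (fun x => complex.Re (F x)) (fun x => complex.Re (f x)) /\
  prim (fun x => complex.Im (F x)) (fun x => complex.Im (f x)).

Lemma eq_cprim F f g : f =1 g -> cprim F f -> cprim F g.
Proof. by move=> /funext ->. Qed.

Lemma cmlbM f g : cmlb f -> cmlb g -> cmlb (fun x => f x * g x).
Proof.
move=> [f1 f2] [g1 g2]; split.
  by under eq_fun do rewrite cReM; apply: mlbB; exact: mlbM.
by under eq_fun do rewrite cImM; apply: mlbD; exact: mlbM.
Qed.

Lemma cmlbD f g : cmlb f -> cmlb g -> cmlb (fun x => f x + g x).
Proof.
move=> [f1 f2] [g1 g2]; split.
  by under eq_fun do rewrite cReD; exact: mlbD.
by under eq_fun do rewrite cImD; exact: mlbD.
Qed.

Lemma cmlb_cst z : cmlb (fun=> z).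
Proof. by split; exact: mlb_cst. Qed.

Lemma cmlb_real (f : R -> R) : mlb f -> cmlb (fun x => (f x)%:C).
Proof. by move=> mf; split => //=; exact: mlb_cst. Qed.

Lemma cprimD F G f g : cprim F f -> cprim G g ->
  cprim (fun x => F x + G x) (fun x => f x + g x).
Proof.
move=> [f1 f2] [g1 g2]; split.
  by under eq_fun do rewrite cReD; under [X in prim _ X]eq_fun do rewrite cReD; exact: primD.
by under eq_fun do rewrite cImD; under [X in prim _ X]eq_fun do rewrite cImD; exact: primD.
Qed.

Lemma cprimN F f : cprim F f -> cprim (fun x => - F x) (fun x => - f x).
Proof.
move=> [f1 f2]; split.
  by under eq_fun do rewrite cReN; under [X in prim _ X]eq_fun do rewrite cReN; exact: primN.
by under eq_fun do rewrite cImN; under [X in prim _ X]eq_fun do rewrite cImN; exact: primN.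
Qed.

Lemma cprimB F G f g : cprim F f -> cprim G g ->
  cprim (fun x => F x - G x) (fun x => f x - g x).
Proof. by move=> pF pG; apply: cprimD => //; exact: cprimN. Qed.

Lemma cprimM F G f g : cprim F f -> cprim G g ->
  cprim (fun x => F x * G x) (fun x => f x * G x + F x * g x).
Proof.
move=> [f1 f2] [g1 g2]; split.
  under eq_fun do rewrite cReM.
  by apply: eq_prim (primB (primM f1 g1) (primM f2 g2)) => x; rewrite !ReImE; ring.
under eq_fun do rewrite cImM.
by apply: eq_prim (primD (primM f1 g2) (primM f2 g1)) => x; rewrite !ReImE; ring.
Qed.

Lemma cprim_cst z : cprim (fun=> z) (fun=> 0).
Proof. by split; exact: prim_cst. Qed.

Lemma cprimZ z F f : cprim F f -> cprim (fun x => z * F x) (fun x => z * f x).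
Proof.
move=> pF; apply: eq_cprim (cprimM (cprim_cst z) pF) => x.
by rewrite mul0r add0r.
Qed.

Lemma cprim_real (F f : R -> R) : prim F f -> cprim (fun x => (F x)%:C) (fun x => (f x)%:C).
Proof. by move=> pF; split => //=; exact: prim_cst. Qed.

Lemma cprim0 F : cprim F (fun=> 0) -> forall a b, F a = F b.
Proof. by move=> [f1 f2] a b; apply: eq_ReIm; [exact: (prim0 f1)|exact: (prim0 f2)]. Qed.

Lemma cprim_cmlb F f : cprim F f -> cmlb F.
Proof. by move=> [f1 f2]; split; [exact: prim_mlb f1|exact: prim_mlb f2]. Qed.

Lemma cprim_oppx F f : cprim F f -> cprim (fun x => F (- x)) (fun x => - f (- x)).
Proof.
move=> [f1 f2]; split.
  by apply: eq_prim (prim_oppx f1) => x; rewrite cReN.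
by apply: eq_prim (prim_oppx f2) => x; rewrite cImN.
Qed.

Lemma cprim_cderive F f g x : cprim F f -> cprim f g -> cderive F x = f x.
Proof.
move=> [f1 f2] [g1 g2]; rewrite /cderive.
have [_ ->] := prim_derive f1 (prim_continuous g1) x.
by have [_ ->] := prim_derive f2 (prim_continuous g2) x; apply: eq_ReIm.
Qed.

(** The factor 2 comes from estimating the real and imaginary parts separately. *)
Lemma N_int_le F f M x : cprim F f -> (forall y, `|y| <= `|x| -> N (f y) <= M) ->
  N (F x - F 0) <= 2 * M * `|x|.
Proof.
move=> [[m1 f1] [m2 f2]] HM; rewrite /N !ReImE.
have h1 y : `|y| <= `|x| -> `|complex.Re (f y)| <= M.
  by move=> /HM; apply: le_trans; rewrite lerDl.
have h2 y : `|y| <= `|x| -> `|complex.Im (f y)| <= M.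
  by move=> /HM; apply: le_trans; rewrite lerDr.
have [x0|/ltW x0] := leP 0 x.
  rewrite f1// f2//.
  have [] := (mlb_int_le x0 m1 (M := M), mlb_int_le x0 m2 (M := M)).
  rewrite subr0 (ger0_norm x0) => H1 H2.
  have := H1 _; have := H2 _ => H3 H4.
  have K1 : forall y, 0 <= y -> y <= x -> `|complex.Re (f y)| <= M.
    by move=> y y0 yx; apply: h1; rewrite !ger0_norm.
  have K2 : forall y, 0 <= y -> y <= x -> `|complex.Im (f y)| <= M.
    by move=> y y0 yx; apply: h2; rewrite !ger0_norm.
  by have := H1 K1; have := H2 K2; lra.
rewrite distrC (distrC _ (complex.Im (F 0))) f1// f2//.
have [] := (mlb_int_le x0 m1 (M := M), mlb_int_le x0 m2 (M := M)).
rewrite sub0r (ler0_norm x0) => H1 H2.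
have K1 : forall y, x <= y -> y <= 0 -> `|complex.Re (f y)| <= M.
  by move=> y y0 yx; apply: h1; rewrite !ler0_norm// lerN2.
have K2 : forall y, x <= y -> y <= 0 -> `|complex.Im (f y)| <= M.
  by move=> y y0 yx; apply: h2; rewrite !ler0_norm// lerN2.
by have := H1 K1; have := H2 K2; lra.
Qed.

Definition ctail (c : R) f := tail c (fun x => complex.Re (f x)) /\ tail c (fun x => complex.Im (f x)).

Definition cJ f x : R[i] := J (fun x => complex.Re (f x)) x +i* J (fun x => complex.Im (f x)) x.

Lemma ctailN_intro (c : R) f : cmlb f ->
  (forall x, exists M, forall y, x <= y -> N (f y) <= M * expR (- (c * y))) -> ctail c f.
Proof.
move=> [[m1 _] [m2 _]] HM; split; split => // x; have [M H] := HM x; exists M => y /H; apply: le_trans.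
  by rewrite lerDl.
by rewrite lerDr.
Qed.

Lemma tail_N (c : R) f : ctail c f -> tail c (fun x => N (f x)).
Proof. by move=> [t1 t2]; apply: tailD; exact: tail_norm. Qed.

Lemma ctailN (c : R) f : ctail c f -> ctail c (fun x => - f x).
Proof.
move=> [f1 f2]; split.
  by under eq_fun do rewrite cReN; exact: tailN.
by under eq_fun do rewrite cImN; exact: tailN.
Qed.

Lemma ctailZ (c : R) z f : ctail c f -> ctail c (fun x => z * f x).
Proof.
move=> [f1 f2]; split.
  by under eq_fun do rewrite cReM; apply: tailB; exact: tailZ.
by under eq_fun do rewrite cImM; apply: tailD; exact: tailZ.
Qed.

Lemma cJD (c : R) f g x : 0 < c -> ctail c f -> ctail c g ->
  cJ (fun x => f x + g x) x = cJ f x + cJ g x.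
Proof.
move=> c0 [f1 f2] [g1 g2]; rewrite /cJ.
under eq_fun do rewrite cReD; under [in X in _ +i* X]eq_fun do rewrite cImD.
by rewrite !(@JD _ c).
Qed.

Lemma cJN (c : R) f x : 0 < c -> ctail c f ->
  cJ (fun x => - f x) x = - cJ f x.
Proof.
move=> c0 [f1 f2]; rewrite /cJ.
under eq_fun do rewrite cReN; under [in X in _ +i* X]eq_fun do rewrite cImN.
by rewrite !(@JN _ c).
Qed.

Lemma cJB (c : R) f g x : 0 < c -> ctail c f -> ctail c g ->
  cJ (fun x => f x - g x) x = cJ f x - cJ g x.
Proof.
by move=> c0 tf tg; rewrite (@cJD c)// ?(@cJN c)//; exact: ctailN.
Qed.

Lemma cJZ (c : R) z f x : 0 < c -> ctail c f ->
  cJ (fun x => z * f x) x = z * cJ f x.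
Proof.
move=> c0 [f1 f2]; rewrite /cJ.
under eq_fun do rewrite cReM; under [in X in _ +i* X]eq_fun do rewrite cImM.
rewrite (@JB _ c)// ?(@JD _ c)// ?(@JZ _ c)//; try exact: tailZ.
by case: z => a b; apply: eq_ReIm.
Qed.

Lemma cJ_prim (c : R) f : 0 < c -> ctail c f -> cprim (cJ f) (fun x => - f x).
Proof.
move=> c0 [f1 f2]; split => /=.
  by apply: eq_prim (J_prim c0 f1) => x; rewrite cReN.
by apply: eq_prim (J_prim c0 f2) => x; rewrite cImN.
Qed.

Lemma N_cJ_le (c : R) f x : 0 < c -> ctail c f -> N (cJ f x) <= J (fun x => N (f x)) x.
Proof.
move=> c0 [f1 f2]; rewrite /N /cJ /= (@JD _ c)//; try exact: tail_norm.
by apply: lerD; apply: (@normr_J_le _ c) => //; exact: tail_norm.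
Qed.

Lemma eq_cJ f g x : (forall y, x <= y -> f y = g y) -> cJ f x = cJ g x.
Proof.
by move=> fg; apply: eq_ReIm => /=; apply: eq_J => y xy; rewrite fg.
Qed.

End ComplexPrimitive.

(** * Exponential, cosine and sine with complex wave number *)

Section Oscillations.
Context {R : realType}.
Implicit Types (x y b : R) (z w k : R[i]).

Lemma cexpD z w : cexp (z + w) = cexp z * cexp w.
Proof.
apply: eq_ReIm; rewrite /cexp !ReImE /= expRD cosD sinD; ring.
Qed.

Lemma cexp0 : cexp (0 : R[i]) = 1.
Proof. by apply: eq_ReIm; rewrite /cexp !ReImE /= expR0 cos0 sin0; ring. Qed.

Lemma cexpN z : cexp z * cexp (- z) = 1.
Proof. by rewrite -cexpD subrr cexp0. Qed.

Lemma N_cexp_le z : N (cexp z) <= 2 * expR (N z).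
Proof.
have -> : 2 * expR (N z) = expR (N z) * 1 + expR (N z) * 1 :> R by ring.
rewrite /N /cexp !ReImE /= !mul0r subr0 addr0 !normrM ger0_norm ?expR_ge0//.
have h : expR (complex.Re z) <= expR (`|complex.Re z| + `|complex.Im z|).
  by rewrite ler_expR (le_trans (ler_norm _))// lerDl.
apply: lerD; apply: ler_pM => //; rewrite ?expR_ge0//.
  by rewrite ler_norml; apply/andP; split; [exact: cos_geN1|exact: cos_le1].
by rewrite ler_norml; apply/andP; split; [exact: sin_geN1|exact: sin_le1].
Qed.

Lemma prim_cosM (c : R) : prim (fun x => cos (c * x)) (fun x => - (c * sin (c * x))).
Proof.
have d (x : R) : is_derive x (1:R) (fun y => cos (c * y)) (- (c * sin (c * x))).
  by rewrite -mulrN; apply: is_derive_compM.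
apply: (derive_prim d) => x; apply: (@cvgN _ R^o); apply: cvgM; first exact: cvg_cst.
apply: (@continuous_comp _ _ _ (fun x => c * x) sin); last exact: continuous_sin.
by apply: cvgM; [exact: cvg_cst|exact: cvg_id].
Qed.

Lemma prim_sinM (c : R) : prim (fun x => sin (c * x)) (fun x => c * cos (c * x)).
Proof.
have d (x : R) : is_derive x (1:R) (fun y => sin (c * y)) (c * cos (c * x)).
  exact: is_derive_compM.
apply: (derive_prim d) => x; apply: cvgM; first exact: cvg_cst.
apply: (@continuous_comp _ _ _ (fun x => c * x) cos); last exact: continuous_cos.
by apply: cvgM; [exact: cvg_cst|exact: cvg_id].
Qed.

Lemma cprim_cexp z : cprim (fun x : R => cexp (z * x%:C)) (fun x => z * cexp (z * x%:C)).
Proof.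
have e := prim_expRM (complex.Re z).
split.
  have -> : (fun x : R => complex.Re (cexp (z * x%:C))) =
    (fun x => expR (complex.Re z * x) * cos (complex.Im z * x)).
    by apply/funext => x; rewrite /cexp !ReImE /= !mulr0 subr0 add0r mul0r subr0.
  apply: eq_prim (primM e (prim_cosM (complex.Im z))) => x.
  by rewrite /cexp !ReImE /=; rewrite !mulr0 !mul0r !(subr0, add0r, addr0); ring.
have -> : (fun x : R => complex.Im (cexp (z * x%:C))) =
    (fun x => expR (complex.Re z * x) * sin (complex.Im z * x)).
  by apply/funext => x; rewrite /cexp !ReImE /= !mulr0 subr0 add0r mul0r addr0.
apply: eq_prim (primM e (prim_sinM (complex.Im z))) => x.
by rewrite /cexp !ReImE /=; rewrite !mulr0 !mul0r !(subr0, add0r, addr0); ring.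
Qed.

Definition ic : R[i] := 'i.
Definition ek k x : R[i] := cexp (ic * k * x%:C).
(** This is cos(kx). With [sinkz k], that is sin(kx)/k, it forms the fundamental system of the free
    equation normalised at 0, which stays regular at k = 0. *)
Definition ck k x : R[i] := (ek k x + ek (- k) x) / 2.

Lemma complexi2 : ic * ic = -1.
Proof. by apply: eq_ReIm => /=; ring. Qed.

Lemma N_ic : N ic = 1.
Proof. by rewrite /N /= normr0 normr1 add0r. Qed.

Lemma complexi_neq0 : ic != 0.
Proof. by rewrite eq_complex /= oner_eq0 andbF. Qed.

Lemma ekN k x : ek (- k) x = cexp (- (ic * k * x%:C)).
Proof. by rewrite /ek; congr cexp; ring. Qed.

Lemma ekM k x : ek k x * ek (- k) x = 1.
Proof. by rewrite ekN cexpN. Qed.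

Lemma ekD k x y : ek k (x + y) = ek k x * ek k y.
Proof. by rewrite /ek -cexpD; congr cexp; rewrite rmorphD /= mulrDr. Qed.

Lemma ek_oppx k x : ek k (- x) = ek (- k) x.
Proof. by rewrite /ek; congr cexp; rewrite rmorphN /=; ring. Qed.

Lemma ek0 k : ek k 0 = 1.
Proof. by rewrite /ek (_ : (0:R)%:C = 0)// mulr0 cexp0. Qed.

Lemma cprim_ek k : cprim (ek k) (fun x => ic * k * ek k x).
Proof. exact: cprim_cexp. Qed.

Lemma sinkzE k x : k != 0 -> sinkz k x = (ek k x - ek (- k) x) / (2 * ic * k).
Proof.
move=> k0; rewrite /sinkz (negbTE k0).
have -> : csin (k * x%:C) = (cexp (ic * (k * x%:C)) - cexp (- (ic * (k * x%:C)))) / (2 * ic) by [].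
rewrite ekN /ek !mulrA.
have : (2 : R[i]) != 0 by rewrite pnatr_eq0.
have := complexi_neq0; move: k0; move: (cexp _) (cexp _) => A B; move: ic => i k0 i0 t0.
by field; rewrite ?k0 ?i0 ?t0.
Qed.

Lemma two_neq0 : (2 : R[i]) != 0. Proof. by rewrite pnatr_eq0. Qed.

Lemma ek00 x : ek 0 x = 1.
Proof. by rewrite /ek mulr0 mul0r cexp0. Qed.

Lemma ck0 x : ck 0 x = 1.
Proof. by rewrite /ck oppr0 ek00 -mulr2n -mulr_natr mul1r divff ?two_neq0. Qed.

Lemma sinkz00 x : sinkz (0 : R[i]) x = x%:C.
Proof. by rewrite /sinkz eqxx. Qed.

Lemma sinkzk0 k : sinkz k 0 = 0 :> R[i].
Proof.
have [->|k0] := eqVneq k 0; first by rewrite sinkz00.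
by rewrite sinkzE// !ek0 subrr mul0r.
Qed.

Lemma cprim_sinkz k : cprim (sinkz k) (ck k).
Proof.
have [->|k0] := eqVneq k 0.
  have := cprim_real (@prim_id R).
  rewrite (_ : (fun x : R => x%:C) = sinkz 0); last by apply/funext => x; rewrite sinkz00.
  by apply: eq_cprim => x; rewrite ck0.
have := cprimZ (2 * ic * k)^-1 (cprimB (cprim_ek k) (cprim_ek (- k))).
rewrite (_ : (fun x : R => _ * _) = sinkz k); last by apply/funext => x; rewrite sinkzE// mulrC.
apply: eq_cprim => x; rewrite /ck.
have := complexi_neq0; have := two_neq0; move: (ek k x) (ek (- k) x) => A B; move: ic => i t0 i0.
by field; rewrite ?k0 ?i0 ?t0.
Qed.

Lemma cprim_ck k : cprim (ck k) (fun x => - (k ^+ 2 * sinkz k x)).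
Proof.
have [->|k0] := eqVneq k 0.
  have := cprim_cst (1 : R[i]); rewrite (_ : (fun=> 1) = ck 0); last by apply/funext => x; rewrite ck0.
  by apply: eq_cprim => x; rewrite expr0n /= mul0r oppr0.
have := cprimZ (2^-1) (cprimD (cprim_ek k) (cprim_ek (- k))).
rewrite (_ : (fun x : R => _ * _) = ck k); last by apply/funext => x; rewrite /ck mulrC.
apply: eq_cprim => x; rewrite sinkzE//.
have := complexi_neq0; have := complexi2; have := two_neq0; move: (ek k x) (ek (- k) x) => A B; move: ic => i t0 i2 i0.
have -> : 2^-1 * (i * k * A + i * - k * B) = - (k ^+ 2 * ((A - B) / (2 * i * k))) * (- (i * i)).
  by field; rewrite ?k0 ?i0 ?t0.
by rewrite i2 opprK mulr1.
Qed.

Lemma ck_sinkz1 k x : ck k x ^+ 2 + k ^+ 2 * sinkz k x ^+ 2 = 1.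
Proof.
have [->|k0] := eqVneq k 0; first by rewrite ck0 expr0n /= mul0r addr0 expr1n.
rewrite sinkzE// /ck.
have := ekM k x; have := complexi_neq0; have := complexi2; have := two_neq0.
move: (ek k x) (ek (- k) x) => A B; move: ic => i t0 i2 i0 AB.
have -> : ((A + B) / 2) ^+ 2 + k ^+ 2 * ((A - B) / (2 * i * k)) ^+ 2 =
  ((A + B) ^+ 2 + (A - B) ^+ 2 / (i * i)) / 4%:R.
  have : (4%:R : R[i]) != 0 by rewrite pnatr_eq0.
  by move=> h4; field; rewrite ?k0 ?i0 ?t0.
rewrite i2 invrN1 mulrN1.
have -> : (A + B) ^+ 2 - (A - B) ^+ 2 = 4%:R * (A * B) by ring.
by rewrite AB mulr1 divff// pnatr_eq0.
Qed.

(** Separates the variables of the Volterra kernel, so that its dependence on x can be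
    differentiated outside the integral. *)
Lemma sinkzB k x y : sinkz k (y - x) = sinkz k y * ck k x - ck k y * sinkz k x.
Proof.
have [->|k0] := eqVneq k 0; first by rewrite !sinkz00 !ck0 mulr1 mul1r rmorphB.
rewrite !sinkzE// /ck !ekD !ek_oppx opprK.
have := complexi_neq0; have := two_neq0.
move: (ek k x) (ek (- k) x) (ek k y) (ek (- k) y) => A B C D; move: ic => i t0 i0.
by field; rewrite ?k0 ?i0 ?t0.
Qed.

Lemma N_ek_le k x b : N k <= b -> N (ek k x) <= 2 * expR (b * `|x|).
Proof.
move=> kb; apply: (le_trans (N_cexp_le _)).
rewrite ler_wpM2l// ler_expR.
apply: NM_le; last by rewrite NC.
rewrite -(mul1r b); apply: NM_le => //.
by rewrite N_ic.
Qed.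

Lemma N_half : N (2^-1 : R[i]) = 2^-1.
Proof.
have -> : (2^-1 : R[i]) = (2^-1 : R)%:C by rewrite rmorphV ?unitfE ?pnatr_eq0//= rmorph_nat.
by rewrite NC ger0_norm.
Qed.

Lemma N_ck_le k x b : N k <= b -> N (ck k x) <= 2 * expR (b * `|x|).
Proof.
move=> kb; rewrite /ck.
have -> : 2 * expR (b * `|x|) = (2 * expR (b * `|x|) + 2 * expR (b * `|x|)) * 2^-1 :> R by field.
apply: NM_le; last by rewrite N_half.
by apply: ND_le; apply: N_ek_le; rewrite ?NN.
Qed.

Lemma N_sinkz_le k x b : N k <= b -> 0 <= b -> N (sinkz k x) <= 4 * expR (b * `|x|) * `|x|.
Proof.
move=> kb b0.
have := @N_int_le R (sinkz k) (ck k) (2 * expR (b * `|x|)) x (cprim_sinkz k).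
rewrite sinkzk0 subr0 => H.
have -> : 4 * expR (b * `|x|) * `|x| = 2 * (2 * expR (b * `|x|)) * `|x| by ring.
apply: H => y yx; apply: (le_trans (N_ck_le y kb)).
by rewrite ler_wpM2l// ler_expR ler_wpM2l.
Qed.

Lemma N_ek1_le k x b : N k <= b -> 0 <= b ->
  N (ek k x - 1) <= 4 * expR (b * `|x|) * `|x| * N k.
Proof.
move=> kb b0.
have := @N_int_le R (ek k) _ (N k * (2 * expR (b * `|x|))) x (cprim_ek k).
rewrite ek0 => H.
have -> : 4 * expR (b * `|x|) * `|x| * N k = 2 * (N k * (2 * expR (b * `|x|))) * `|x| by ring.
apply: H => y yx; apply: NM_le.
  rewrite -[leRHS]mul1r; apply: NM_le => //.
  by rewrite /N /= normr0 normr1 add0r.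
apply: (le_trans (N_ek_le y kb)).
by rewrite ler_wpM2l// ler_expR ler_wpM2l.
Qed.

Lemma N_ck1_le k x b : N k <= b -> 0 <= b ->
  N (ck k x - 1) <= 4 * expR (b * `|x|) * `|x| * N k.
Proof.
move=> kb b0; set M := (X in _ <= X).
have -> : ck k x - 1 = ((ek k x - 1) + (ek (- k) x - 1)) / 2.
  by rewrite /ck; have := two_neq0 => t0; field.
have -> : M = (M + M) * 2^-1 by field.
apply: NM_le; last by rewrite N_half.
by apply: ND_le; rewrite /M; [exact: N_ek1_le|rewrite -(NN k); apply: N_ek1_le; rewrite ?NN].
Qed.

Lemma N_sinkzB_le k x b : N k <= b -> 0 <= b ->
  N (sinkz k x - x%:C) <= 8 * expR (b * `|x|) * `|x| * N k * `|x|.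
Proof.
move=> kb b0.
have := @N_int_le R (fun x => sinkz k x - x%:C) (fun x => ck k x - 1) (4 * expR (b * `|x|) * `|x| * N k) x
  (cprimB (cprim_sinkz k) (cprim_real (@prim_id R))).
rewrite sinkzk0 (_ : (0:R)%:C = 0)// subrr subr0 => H.
have -> : 8 * expR (b * `|x|) * `|x| * N k * `|x| = 2 * (4 * expR (b * `|x|) * `|x| * N k) * `|x| by ring.
apply: H => y yx; apply: (le_trans (N_ck1_le y kb b0)).
rewrite ler_wpM2r ?N_ge0//; have e0 := expR_ge0 (b * `|y|).
by apply: ler_pM => //; rewrite ?mulr_ge0// ler_wpM2l// ler_expR ler_wpM2l.
Qed.

End Oscillations.

(** * The Volterra equation of the Jost solutions *)

Section Volterra.
Context {R : realType}.
Implicit Types (x y : R) (z w k : R[i]) (f g : R -> R[i]).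

(** The sequences u_n - 2 c 2^-n and u_n + 2 c 2^-n are monotone and enclose the limit, taken as the
    supremum of the lower one; this yields the rate at every n at once. *)
Lemma geometric_limit (u : nat -> R) (c : R) :
  (forall n, `|u n.+1 - u n| <= c * 2^-1 ^+ n) ->
  exists l, forall n, `|l - u n| <= 2 * c * 2^-1 ^+ n.
Proof.
move=> uc.
pose v n := u n - 2 * c * 2^-1 ^+ n.
pose w n := u n + 2 * c * 2^-1 ^+ n.
have h n : 2 * c * 2^-1 ^+ n - 2 * c * 2^-1 ^+ n.+1 = c * 2^-1 ^+ n.
  by rewrite (exprS _ n); move: (2^-1 ^+ n) => t; field.
have vS n : v n <= v n.+1.
  by have := uc n; have := h n; rewrite /v ler_norml => ? /andP[? ?]; lra.
have wS n : w n.+1 <= w n.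
  by have := uc n; have := h n; rewrite /w ler_norml => ? /andP[? ?]; lra.
have vle m n : (m <= n)%N -> v m <= v n.
  by elim: n => [|n IH]; [rewrite leqn0 => /eqP ->|rewrite leq_eqVlt => /predU1P[-> //|/IH/le_trans]; exact].
have wle m n : (m <= n)%N -> w n <= w m.
  by elim: n => [|n IH]; [rewrite leqn0 => /eqP ->|rewrite leq_eqVlt => /predU1P[-> //|/IH]; exact: le_trans].
have c0 : 0 <= c by have := uc 0%N; rewrite expr0 mulr1; exact: le_trans.
have vw n : v n <= w n.
  have : 0 <= 2 * c * 2^-1 ^+ n by rewrite mulr_ge0 ?mulr_ge0// exprn_ge0.
  by rewrite /v /w; lra.
have vwmn m n : v m <= w n.
  by apply: (le_trans (vle _ _ (leq_maxl m n))); apply: (le_trans (vw _)); apply: wle; exact: leq_maxr.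
exists (sup (range v)) => n.
have hs : has_sup (range v).
  by split; [exists (v 0%N), 0%N|exists (w 0%N) => _ [m _ <-]].
have h1 : v n <= sup (range v) by apply: sup_upper_bound => //; exists n.
have h2 : sup (range v) <= w n.
  by apply: ge_sup; [exists (v 0%N), 0%N|move=> _ [m _ <-]].
by rewrite ler_norml; move: h1 h2; rewrite /v /w => h1 h2; apply/andP; split; lra.
Qed.

Lemma le_geometric_add (a b c : R) : (forall n : nat, a <= b + c * 2^-1 ^+ n) -> a <= b.
Proof.
move=> H.
have cv : (fun n : nat => b + c * 2^-1 ^+ n) @ \oo --> b + c * 0.
  apply: cvgD; first exact: cvg_cst.
  apply: cvgM; first exact: cvg_cst.
  by apply: cvg_expr; rewrite ger0_norm// invf_lt1// ltr1n.
rewrite mulr0 addr0 in cv.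
by apply: (ler_cvg_to (cvg_cst _) cv); apply: nearW => n; exact: H.
Qed.

Lemma le_expR_scale (c x : R) : 0 < c -> 0 <= x -> x <= c^-1 * expR (c * x).
Proof.
move=> c0 x0; rewrite mulrC ler_pdivlMr// mulrC.
by have := expR_ge1Dx (c * x); lra.
Qed.

Context (U : R -> R) (C beta : R).
Context (mU : measurable_fun setT U) (C0 : 0 <= C) (beta0 : 0 < beta).
Context (UC : forall x, `|U x| <= C * expR (- (beta * `|x|))).

Let b := beta / 4.
Let gam := beta / 2.
(** One summand of [L] for each kernel: the square serves sinkz k (y - x) - (y - x), the second
    sinkz k (y - x), and 2 serves ck k (y - x). The rate [gam] is what two weights of rate beta / 4
    leave of the decay beta, and [K] is chosen so that psi' = - 2 D exp(- gam x) psi. *)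
Let L := (8 * (32 / beta)) ^+ 2 + 32 / beta + 2.
Let D := L * C.
Let K := 2 * D / gam.

(* [psi] solves [psi x = 1 + \int_x^oo 2 * D * expR (- gam * y) * psi y], which
   makes the Volterra operator a contraction of ratio 1/2 in the norm weighted
   by [wt * psi]. *)
Definition wt x := expR (beta / 4 * `|x|).
Definition psi x := expR (K * expR (- gam * x)).

Let b0 : 0 < b. Proof. by rewrite /b divr_gt0. Qed.
Let gam0 : 0 < gam. Proof. by rewrite /gam divr_gt0. Qed.
Let L0 : 0 <= L.
Proof. by rewrite /L addr_ge0// addr_ge0 ?sqr_ge0// divr_ge0// ltW. Qed.
Let D0 : 0 <= D. Proof. exact: mulr_ge0. Qed.
Let K0 : 0 <= K. Proof. by rewrite /K divr_ge0 ?mulr_ge0// ltW. Qed.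

Lemma psi_ge1 x : 1 <= psi x.
Proof. by rewrite /psi -expR0 ler_expR mulr_ge0// expR_ge0. Qed.

Lemma psi_gt0 x : 0 < psi x. Proof. exact: expR_gt0. Qed.

Lemma wt_ge1 x : 1 <= wt x.
Proof. by rewrite /wt -expR0 ler_expR mulr_ge0// divr_ge0// ltW. Qed.

Lemma wt_gt0 x : 0 < wt x. Proof. exact: expR_gt0. Qed.

Lemma wp_gt0 x : 0 < wt x * psi x.
Proof. exact: mulr_gt0 (wt_gt0 x) (psi_gt0 x). Qed.

Lemma wp_ge0 x : 0 <= wt x * psi x. Proof. exact/ltW/wp_gt0. Qed.

Lemma psi_le x y : x <= y -> psi y <= psi x.
Proof.
move=> xy; rewrite /psi ler_expR ler_wpM2l// ler_expR.
by rewrite !mulNr lerN2 ler_wpM2l// ltW.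
Qed.

Lemma prim_psi : prim psi (fun x => - (2 * D * (expR (- gam * x) * psi x))).
Proof.
have cp : continuous psi.
  move=> x; apply: (@continuous_comp _ _ _ (fun x => K * expR (- gam * x)) expR); last exact: continuous_expR.
  by apply: cvgM; [exact: cvg_cst|exact: continuous_expRM].
have dp (x : R) : is_derive x (1:R) psi (- (2 * D * (expR (- gam * x) * psi x))).
  have h : is_derive x (1:R) (fun x => K * expR (- gam * x)) (K * (- gam * expR (- gam * x))).
    exact: (@is_deriveZ R R^o R^o (fun x => expR (- gam * x) : R^o) K x 1 _ (is_derive_expRM (- gam) x)).
  have := @is_derive1_comp R expR (fun x => K * expR (- gam * x)) x _ _ (is_derive_expR _) h.
  have -> : expR (K * expR (- gam * x)) * (K * (- gam * expR (- gam * x))) =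
     - (2 * D * (expR (- gam * x) * psi x)).
    by rewrite /psi /K; field; rewrite gt_eqF.
  by [].
apply: (derive_prim dp) => x.
apply: (@cvgN _ R^o); apply: cvgM; first exact: cvg_cst.
by apply: cvgM; [exact: continuous_expRM|exact: cp].
Qed.

Lemma tail_psi : tail gam (fun x => expR (- gam * x) * psi x).
Proof.
split.
  have [m1 _] := mlb_continuous (@continuous_expRM R (- gam)).
  by have [m2 _] := prim_mlb prim_psi; exact: measurable_funM.
move=> x; exists (psi x) => y xy.
have p0 := ltW (psi_gt0 y).
rewrite ger0_norm ?mulr_ge0 ?expR_ge0//.
by rewrite mulrC mulNr; apply: ler_wpM2r; [exact: expR_ge0|exact: psi_le].
Qed.

(** Both sides have the same derivative and decay at +oo; the decay of psi - 1 follows from e^t - 1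
    <= t e^t with t = K exp(- gam y). *)
Lemma J_psi x : J (fun x => 2 * D * (expR (- gam * x) * psi x)) x = psi x - 1.
Proof.
have t2 := tailZ (2 * D) tail_psi.
have p : prim (fun x => psi x - 1) (fun x => - (2 * D * (expR (- gam * x) * psi x))).
  apply: eq_prim (primB prim_psi (prim_cst 1)) => y; by rewrite subr0.
have := @prim_J R gam _ _ x (K * psi x) gam0 (tailN t2) p.
rewrite (JN x gam0 t2) opprK => ->//.
move=> y xy; rewrite ger0_norm ?subr_ge0 ?psi_ge1//.
set t := K * expR (- (gam * y)).
have t0 : 0 <= t by rewrite mulr_ge0// expR_ge0.
have -> : psi y = expR t by rewrite /psi mulNr.
apply: (@le_trans _ _ (t * expR t)).
  have := expR_ge1Dx (- t); rewrite expRN => h.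
  have e0 := expR_gt0 t.
  have : (1 - t) * expR t <= 1 by rewrite -ler_pdivlMr// div1r.
  by lra.
have -> : K * psi x * expR (- (gam * y)) = t * psi x by rewrite /t; ring.
by rewrite ler_wpM2l//; have := psi_le xy; rewrite {1}/psi mulNr.
Qed.

(** The class on which the Volterra operator contracts: growth of rate beta / 4 is allowed to the
    right, and to the left even the doubly exponential growth of [psi]. *)
Definition wbd f := cmlb f /\ exists B, forall x, N (f x) <= B * (wt x * psi x).

Lemma measurable_wt : mlb wt.
Proof.
apply: mlb_continuous => x.
apply: (@continuous_comp _ _ _ (fun x => beta / 4 * `|x|) expR); last exact: continuous_expR.
by apply: cvgM; [exact: cvg_cst|exact: norm_continuous].
Qed.

Lemma mlbU : mlb U.
Proof.
split => // r; exists C => x _; apply: (le_trans (UC x)).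
rewrite -[leRHS]mulr1 ler_wpM2l// -expR0 ler_expR oppr_le0 mulr_ge0// ltW//.
Qed.

Lemma cmlbU : cmlb (fun x => (U x)%:C). Proof. exact/cmlb_real/mlbU. Qed.

(** The two factors wt y, one from the kernel and one from u, take beta / 2 out of the decay beta of
    U. *)
Lemma integrand_bound (kap : R[i]) (u : R[i]) x y A B : N kap <= A * (wt x * wt y) -> 0 <= A ->
  N u <= B * (wt y * psi y) ->
  N (kap * (U y)%:C * u) <= A * B * C * wt x * (expR (- gam * y) * psi y).
Proof.
move=> kA A0 uB.
have h : N (kap * (U y)%:C * u) <= A * (wt x * wt y) * (C * expR (- (beta * `|y|))) * (B * (wt y * psi y)).
  by apply: NM_le => //; apply: NM_le => //; rewrite NC.
apply: (le_trans h).
have B0 : 0 <= B by rewrite -(pmulr_lge0 _ (wp_gt0 y)); exact: le_trans (N_ge0 _) uB.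
have -> : A * (wt x * wt y) * (C * expR (- (beta * `|y|))) * (B * (wt y * psi y)) =
  A * B * C * wt x * ((wt y * wt y * expR (- (beta * `|y|))) * psi y) by ring.
apply: ler_wpM2l; first by rewrite !mulr_ge0// ltW// wt_gt0.
apply: ler_wpM2r; first by rewrite ltW// psi_gt0.
rewrite /wt -!expRD ler_expR.
have := ler_norm y; rewrite /gam => yy.
have : beta / 2 * y <= beta / 2 * `|y| by rewrite ler_wpM2l// divr_ge0// ltW.
by lra.
Qed.

Lemma ctail_integrand (kap : R -> R[i]) f A x : cmlb kap -> 0 <= A ->
  (forall y, N (kap y) <= A * (wt x * wt y)) -> wbd f ->
  ctail gam (fun y => kap y * (U y)%:C * f y).
Proof.
move=> mk A0 kA [mf [B fB]]; apply: ctailN_intro.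
  by apply: cmlbM => //; apply: cmlbM => //; exact: cmlbU.
move=> x'; exists (A * B * C * wt x * psi x') => y xy.
apply: (le_trans (integrand_bound (kA y) A0 (fB y))).
have B0 : 0 <= B by rewrite -(pmulr_lge0 _ (wp_gt0 y)); exact: le_trans (N_ge0 _) (fB y).
rewrite -(mulrA _ (psi x')) ler_wpM2l//.
  by rewrite !mulr_ge0// ltW// wt_gt0.
by rewrite mulrC mulNr ler_wpM2r ?expR_ge0// psi_le.
Qed.

(** The integral of 2 D exp(- gam y) psi y over [x, +oo[ is psi x - 1 <= psi x, and A B C = (A / L)
    (B / 2) (2 D): this is the origin of the contraction ratio 1/2. *)
Lemma N_cJ_integrand (kap : R -> R[i]) f A B x : cmlb kap -> 0 <= A -> 0 <= B ->
  (forall y, N (kap y) <= A * (wt x * wt y)) -> wbd f ->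
  (forall y, x <= y -> N (f y) <= B * (wt y * psi y)) ->
  N (cJ (fun y => kap y * (U y)%:C * f y) x) <= A / L * (B / 2) * (wt x * psi x).
Proof.
move=> mk A0 B0 kA wf fB.
have t1 := ctail_integrand mk A0 kA wf.
apply: (le_trans (N_cJ_le x gam0 t1)).
have Lp : 0 < L.
  by rewrite /L ltr_wpDl// addr_ge0 ?sqr_ge0// divr_ge0// ltW.
have t2 := tailZ (A / L * (B / 2) * wt x) (tailZ (2 * D) tail_psi).
apply: (@le_trans _ _ (J (fun y => A / L * (B / 2) * wt x * (2 * D * (expR (- gam * y) * psi y))) x)).
  apply: (@le_J _ gam) => //; first exact: tail_N.
  move=> y xy; apply: (le_trans (integrand_bound (kA y) A0 (fB y xy))).
  rewrite le_eqVlt; apply/orP; left; apply/eqP; rewrite /D.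
  by field; rewrite gt_eqF.
rewrite (JZ _ _ gam0 (tailZ (2 * D) tail_psi)) J_psi [leRHS]mulrA.
apply: ler_wpM2l; last by rewrite lerBlDr lerDl.
have w0 := ltW (wt_gt0 x).
by rewrite mulr_ge0// mulr_ge0// divr_ge0.
Qed.

(** The factor |y - x| is absorbed by a second exponential of rate beta / 8; two of them have the
    rate of [wt], and |y - x| <= |x| + |y| splits the product. *)
Lemma sinkz_kernel k x y : N k <= beta / 8 -> N (sinkz k (y - x)) <= L * (wt x * wt y).
Proof.
move=> kb; have b80 : 0 < beta / 8 by rewrite divr_gt0.
apply: (le_trans (N_sinkz_le _ kb (ltW b80))).
have h := le_expR_scale b80 (normr_ge0 (y - x)).
set e := expR (beta / 8 * `|y - x|) in h *.
have e0 : 0 <= e by exact: expR_ge0.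
have ee : e * e <= wt x * wt y.
  rewrite /e /wt -!expRD ler_expR.
  have := ler_normB y x => tri.
  have : beta / 8 * `|y - x| <= beta / 8 * (`|y| + `|x|) by rewrite ler_wpM2l// ltW.
  by lra.
have h2 : 4 * e * `|y - x| <= 32 / beta * (e * e).
  apply: (@le_trans _ _ (4 * e * ((beta / 8)^-1 * e))); first by rewrite ler_wpM2l// mulr_ge0.
  by rewrite le_eqVlt; apply/orP; left; apply/eqP; field; rewrite gt_eqF.
apply: (le_trans h2).
apply: ler_pM => //; first by rewrite divr_ge0// ltW.
  exact: mulr_ge0.
rewrite /L; have := sqr_ge0 (8 * (32 / beta)).
by lra.
Qed.

Lemma sinkzB_kernel k x y : N k <= beta / 8 ->
  N (sinkz k (y - x) - (y - x)%:C) <= L * N k * (wt x * wt y).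
Proof.
move=> kb; have b80 : 0 < beta / 8 by rewrite divr_gt0.
have b160 : 0 < beta / 16 by rewrite divr_gt0.
apply: (le_trans (N_sinkzB_le _ kb (ltW b80))).
have h := le_expR_scale b160 (normr_ge0 (y - x)).
set e := expR (beta / 8 * `|y - x|).
set d := expR (beta / 16 * `|y - x|) in h *.
have e0 : 0 <= e by exact: expR_ge0.
have d0 : 0 <= d by exact: expR_ge0.
have dd : d * d = e by rewrite /d -expRD /e; congr expR; field.
have ee : e * e <= wt x * wt y.
  rewrite /e /wt -!expRD ler_expR.
  have := ler_normB y x => tri.
  have : beta / 8 * `|y - x| <= beta / 8 * (`|y| + `|x|) by rewrite ler_wpM2l// ltW.
  by lra.
have h2 : `|y - x| * `|y - x| <= (beta / 16)^-1 ^+ 2 * e.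
  rewrite -dd; apply: (@le_trans _ _ ((beta / 16)^-1 * d * ((beta / 16)^-1 * d))).
    by apply: ler_pM.
  by rewrite expr2 le_eqVlt; apply/orP; left; apply/eqP; ring.
have -> : 8 * e * `|y - x| * N k * `|y - x| = N k * (8 * e * (`|y - x| * `|y - x|)) by ring.
have -> : L * N k * (wt x * wt y) = N k * (L * (wt x * wt y)) by ring.
rewrite ler_wpM2l ?N_ge0//.
apply: (@le_trans _ _ (8 * (beta / 16)^-1 ^+ 2 * (e * e))).
  have -> : 8 * (beta / 16)^-1 ^+ 2 * (e * e) = 8 * e * ((beta / 16)^-1 ^+ 2 * e) by ring.
  by rewrite ler_wpM2l// mulr_ge0.
apply: ler_pM => //; first by rewrite mulr_ge0// exprn_ge0// invr_ge0 ltW.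
  exact: mulr_ge0.
rewrite /L.
have -> : (beta / 16)^-1 = 16 / beta by field; rewrite gt_eqF.
have i0 : 0 <= beta^-1 by rewrite invr_ge0 ltW.
move: (beta^-1) i0 => t t0.
have : 0 <= t * t by rewrite mulr_ge0.
by rewrite !expr2; nra.
Qed.

Lemma ck_kernel k x y : N k <= beta / 8 -> N (ck k (y - x)) <= L * (wt x * wt y).
Proof.
move=> kb; have b80 : 0 < beta / 8 by rewrite divr_gt0.
apply: (le_trans (N_ck_le _ kb)).
apply: ler_pM; [by []|exact: expR_ge0| |].
  rewrite /L; have := sqr_ge0 (8 * (32 / beta)).
  by have : 0 <= 32 / beta by [rewrite divr_ge0// ltW|]; lra.
rewrite /wt -!expRD ler_expR.
have := ler_normB y x => tri.
have h1 : beta / 8 * `|y - x| <= beta / 8 * (`|y| + `|x|) by rewrite ler_wpM2l// ltW.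
have : 0 <= beta / 8 * (`|y| + `|x|) by rewrite mulr_ge0 ?addr_ge0// ltW.
by lra.
Qed.

(** [V k] is the Volterra operator. As its kernel contains x, the addition formula splits it into
    [J1] and [J2], which depend on x through the endpoint only; [Vd] is the resulting derivative. *)
Definition V k f x : R[i] := cJ (fun y => sinkz k (y - x) * (U y)%:C * f y) x.
Definition J1 k f x : R[i] := cJ (fun y => sinkz k y * (U y)%:C * f y) x.
Definition J2 k f x : R[i] := cJ (fun y => ck k y * (U y)%:C * f y) x.
Definition Vd k f x : R[i] := - (k ^+ 2 * sinkz k x * J1 k f x + ck k x * J2 k f x).

Lemma cmlb_sinkz_shift k x : cmlb (fun y => sinkz k (y - x)).
Proof.
have h1 := cprim_cmlb (cprim_sinkz k); have h2 := cprim_cmlb (cprim_ck k).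
rewrite (_ : (fun y : R => _) = (fun y => sinkz k y * ck k x + - sinkz k x * ck k y)).
  by apply: cmlbD; apply: cmlbM => //; exact: cmlb_cst.
by apply/funext => y; rewrite sinkzB; ring.
Qed.

Lemma sinkz_kernel0 k y : N k <= beta / 8 -> N (sinkz k y) <= L * (wt 0 * wt y).
Proof. by move=> kb; have := sinkz_kernel 0 y kb; rewrite subr0. Qed.

Lemma ck_kernel0 k y : N k <= beta / 8 -> N (ck k y) <= L * (wt 0 * wt y).
Proof. by move=> kb; have := ck_kernel 0 y kb; rewrite subr0. Qed.

Lemma ctail_V k f x : N k <= beta / 8 -> wbd f ->
  ctail gam (fun y => sinkz k (y - x) * (U y)%:C * f y).
Proof.
move=> kb wf; apply: (@ctail_integrand _ _ L x) => //; first exact: cmlb_sinkz_shift.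
by move=> y; exact: sinkz_kernel.
Qed.

Lemma ctail_J1 k f : N k <= beta / 8 -> wbd f ->
  ctail gam (fun y => sinkz k y * (U y)%:C * f y).
Proof.
move=> kb wf; apply: (@ctail_integrand _ _ L 0) => //.
  exact: cprim_cmlb (cprim_sinkz k).
by move=> y; exact: sinkz_kernel0.
Qed.

Lemma ctail_J2 k f : N k <= beta / 8 -> wbd f ->
  ctail gam (fun y => ck k y * (U y)%:C * f y).
Proof.
move=> kb wf; apply: (@ctail_integrand _ _ L 0) => //.
  exact: cprim_cmlb (cprim_ck k).
by move=> y; exact: ck_kernel0.
Qed.

Let Lgt0 : 0 < L.
Proof. by rewrite /L ltr_wpDl// addr_ge0 ?sqr_ge0// divr_ge0// ltW. Qed.

Lemma V_le k f B x : N k <= beta / 8 -> 0 <= B -> wbd f ->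
  (forall y, x <= y -> N (f y) <= B * (wt y * psi y)) ->
  N (V k f x) <= B / 2 * (wt x * psi x).
Proof.
move=> kb B0 wf fB.
have := @N_cJ_integrand (fun y => sinkz k (y - x)) f L B x (cmlb_sinkz_shift k x) L0 B0.
rewrite divff ?gt_eqF// mul1r; apply => //.
by move=> y; exact: sinkz_kernel.
Qed.

Lemma V_split k f x : N k <= beta / 8 -> wbd f ->
  V k f x = ck k x * J1 k f x - sinkz k x * J2 k f x.
Proof.
move=> kb wf; rewrite /V /J1 /J2.
have t1 := ctail_J1 kb wf; have t2 := ctail_J2 kb wf.
rewrite -(cJZ (ck k x) x gam0 t1) -(cJZ (sinkz k x) x gam0 t2).
rewrite -(cJB x gam0 (ctailZ _ t1) (ctailZ _ t2)).
by apply: eq_cJ => y _; rewrite sinkzB; ring.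
Qed.

Lemma cprim_J1 k f : N k <= beta / 8 -> wbd f ->
  cprim (J1 k f) (fun x => - (sinkz k x * (U x)%:C * f x)).
Proof. by move=> kb wf; exact: cJ_prim gam0 (ctail_J1 kb wf). Qed.

Lemma cprim_J2 k f : N k <= beta / 8 -> wbd f ->
  cprim (J2 k f) (fun x => - (ck k x * (U x)%:C * f x)).
Proof. by move=> kb wf; exact: cJ_prim gam0 (ctail_J2 kb wf). Qed.

Lemma cprim_V k f : N k <= beta / 8 -> wbd f -> cprim (V k f) (Vd k f).
Proof.
move=> kb wf.
have -> : V k f = (fun x => ck k x * J1 k f x - sinkz k x * J2 k f x).
  by apply/funext => x; exact: V_split.
have h1 := cprimM (cprim_ck k) (cprim_J1 kb wf).
have h2 := cprimM (cprim_sinkz k) (cprim_J2 kb wf).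
by apply: eq_cprim (cprimB h1 h2) => x; rewrite /Vd; ring.
Qed.

(** The terms from differentiating [J1] and [J2] combine to U f by cos^2 + sin^2 = 1; the others
    give - k^2 V. *)
Lemma cprim_Vd k f : N k <= beta / 8 -> wbd f ->
  cprim (Vd k f) (fun x => (U x)%:C * f x - k ^+ 2 * V k f x).
Proof.
move=> kb wf.
have h1 := cprimM (cprimZ (k ^+ 2) (cprim_sinkz k)) (cprim_J1 kb wf).
have h2 := cprimM (cprim_ck k) (cprim_J2 kb wf).
apply: eq_cprim (cprimN (cprimD h1 h2)) => x.
rewrite V_split//.
have e : (U x)%:C * f x = (ck k x ^+ 2 + k ^+ 2 * sinkz k x ^+ 2) * ((U x)%:C * f x).
  by rewrite ck_sinkz1 mul1r.
by rewrite e; ring.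
Qed.

Lemma wbdD f g : wbd f -> wbd g -> wbd (fun x => f x + g x).
Proof.
move=> [mf [B fB]] [mg [A gA]]; split; first exact: cmlbD.
by exists (B + A) => x; rewrite mulrDl; exact: ND_le.
Qed.

Lemma wbdN f : wbd f -> wbd (fun x => - f x).
Proof.
move=> [mf [B fB]]; split.
  have := cmlbM (cmlb_cst (-1)) mf; congr cmlb.
  by apply/funext => x; rewrite mulN1r.
by exists B => x; rewrite NN.
Qed.

Lemma wbdB f g : wbd f -> wbd g -> wbd (fun x => f x - g x).
Proof. by move=> wf wg; apply: wbdD => //; exact: wbdN. Qed.

Lemma wbd_pos f : wbd f -> exists2 B, 0 <= B & forall x, N (f x) <= B * (wt x * psi x).
Proof.
move=> [mf [B fB]]; exists (`|B|) => // x; apply: (le_trans (fB x)).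
by rewrite ler_wpM2r ?ler_norm//; exact: wp_ge0.
Qed.

Lemma wbd_V k f : N k <= beta / 8 -> wbd f -> wbd (V k f).
Proof.
move=> kb wf; split; first exact: cprim_cmlb (cprim_V kb wf).
have [B B0 fB] := wbd_pos wf; exists (B / 2) => x.
by apply: V_le.
Qed.

Lemma N_ek_wt k x : N k <= beta / 8 -> N (ek k x) <= 2 * (wt x * psi x).
Proof.
move=> kb; apply: (le_trans (N_ek_le x kb)); rewrite ler_wpM2l//.
rewrite -[leLHS]mulr1; apply: ler_pM; [exact: expR_ge0|by []| |exact: psi_ge1].
by rewrite /wt ler_expR ler_wpM2r//; move: beta0; lra.
Qed.

Lemma wbd_ek k : N k <= beta / 8 -> wbd (ek k).
Proof.
move=> kb; split; first exact: cprim_cmlb (cprim_ek k).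
by exists 2 => x; exact: N_ek_wt.
Qed.

Lemma VB k f g x : N k <= beta / 8 -> wbd f -> wbd g ->
  V k (fun y => f y - g y) x = V k f x - V k g x.
Proof.
move=> kb wf wg; rewrite /V -(cJB x gam0 (ctail_V x kb wf) (ctail_V x kb wg)).
by apply: eq_cJ => y _; rewrite mulrBr.
Qed.

Definition jost_sol k f := wbd f /\ forall x, f x = ek k x + V k f x.

(** Picard iteration from 0: successive differences halve in the weighted norm. *)
Lemma jost_sol_exists k : N k <= beta / 8 -> exists f, jost_sol k f.
Proof.
move=> kb.
pose F n := iter n (fun f x => ek k x + V k f x) (fun=> 0).
have FS n x : F n.+1 x = ek k x + V k (F n) x by [].
have wF n : wbd (F n).
  elim: n => [|n IH].
    by split; [exact: cmlb_cst|exists 0 => x; rewrite N0 mul0r].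
  by apply: wbdD; [exact: wbd_ek|exact: wbd_V].
have dF n x : N (F n.+1 x - F n x) <= 2 * (wt x * psi x) * 2^-1 ^+ n.
  elim: n x => [|n IH] x.
    rewrite FS expr0 mulr1 subr0.
    have -> : V k (F 0%N) x = 0.
      apply: N_eq0; have := @V_le k (F 0%N) 0 x kb (lexx _) (wF 0%N).
      by rewrite !mul0r; apply => y _; rewrite N0 mul0r.
    by rewrite addr0; exact: N_ek_wt.
  have -> : F n.+2 x - F n.+1 x = V k (fun y => F n.+1 y - F n y) x.
    by rewrite VB// FS (FS n); ring.
  have -> : 2 * (wt x * psi x) * 2^-1 ^+ n.+1 = 2 * 2^-1 ^+ n / 2 * (wt x * psi x).
    by rewrite exprS; ring.
  apply: V_le; [by []|by rewrite mulr_ge0// exprn_ge0|exact: wbdB|].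
  by move=> y _; rewrite mulrAC.
have lRe x : exists l, forall n, `|l - complex.Re (F n x)| <= 2 * (2 * (wt x * psi x)) * 2^-1 ^+ n.
  apply: (@geometric_limit (fun n => complex.Re (F n x))) => n.
  by apply: le_trans (dF n x); rewrite -cReN -cReD; exact: Re_le_N.
have lIm x : exists l, forall n, `|l - complex.Im (F n x)| <= 2 * (2 * (wt x * psi x)) * 2^-1 ^+ n.
  apply: (@geometric_limit (fun n => complex.Im (F n x))) => n.
  by apply: le_trans (dF n x); rewrite -cImN -cImD; exact: Im_le_N.
have [l1 Hl1] := choice lRe; have [l2 Hl2] := choice lIm.
pose f x : R[i] := l1 x +i* l2 x.
have fF n x : N (f x - F n x) <= 8 * 2^-1 ^+ n * (wt x * psi x).
  rewrite /N !ReImE /=; have := Hl1 x n; have := Hl2 x n.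
  have -> : 8 * 2^-1 ^+ n * (wt x * psi x) = 2 * (2 * (2 * (wt x * psi x)) * 2^-1 ^+ n) by ring.
  by lra.
have lim_meas (l : R -> R) (u : nat -> R -> R) : (forall n, mlb (u n)) ->
    (forall x n, `|l x - u n x| <= 2 * (2 * (wt x * psi x)) * 2^-1 ^+ n) -> mlb l.
  move=> mu Hl; split.
    apply: (@measurable_fun_cvg _ _ _ _ u) => [n|x _]; first by case: (mu n).
    apply/(@cvgrPdist_le _ R^o) => e e0.
    have cv : (fun n : nat => 2 * (2 * (wt x * psi x)) * 2^-1 ^+ n) @ \oo --> (0:R).
      rewrite -(mulr0 (2 * (2 * (wt x * psi x)))).
      apply: cvgM; first exact: cvg_cst.
      by apply: cvg_expr; rewrite ger0_norm// invf_lt1// ltr1n.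
    have /(@cvgrPdist_le _ R^o)/(_ e e0) := cv.
    apply: filterS => n; rewrite sub0r normrN => h.
    apply: (le_trans (Hl x n)); apply: le_trans h; exact: ler_norm.
  move=> r.
  have [_ /(_ r)[M HM]] := mlbD (mu 0%N) (mu 0%N).
  have [_ /(_ r)[M' HM']] := mlbM measurable_wt (prim_mlb prim_psi).
  have [_ /(_ r)[M2 HM2]] := mu 0%N.
  exists (M2 + 4 * M') => x xr.
  have := Hl x 0%N; rewrite expr0 mulr1.
  have := HM2 x xr; have := HM' x xr.
  rewrite ger0_norm; last exact: wp_ge0.
  move=> h1 h2 h3.
  have -> : l x = (l x - u 0%N x) + u 0%N x by rewrite subrK.
  apply: (le_trans (ler_normD _ _)); lra.
have wf : wbd f.
  split; first split.
  - by apply: (@lim_meas l1 (fun n x => complex.Re (F n x))) => // n; case: (wF n) => -[].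
  - by apply: (@lim_meas l2 (fun n x => complex.Im (F n x))) => // n; case: (wF n) => -[].
  by exists 8 => x; have := fF 0%N x; rewrite expr0 mulr1 subr0.
exists f; split => // x.
(* The limit fails the equation by at most its distance to the iterates n and n + 1, which is
   O(2^-n). *)
apply/eqP; rewrite -subr_eq0; apply/eqP/N_eq0.
apply: (@le_geometric_add _ _ (8 * (wt x * psi x))) => n; rewrite add0r.
have -> : f x - (ek k x + V k f x) = (f x - F n.+1 x) + V k (fun y => F n y - f y) x.
  by rewrite VB// FS; ring.
have -> : 8 * (wt x * psi x) * 2^-1 ^+ n =
    8 * 2^-1 ^+ n.+1 * (wt x * psi x) + 8 * 2^-1 ^+ n / 2 * (wt x * psi x).
  by rewrite exprS; move: (2^-1 ^+ n) => t; field.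
apply: ND_le; first exact: fF.
apply: V_le; [by []|by rewrite mulr_ge0// exprn_ge0|exact: wbdB|].
by move=> y _; rewrite -NN opprB; exact: fF.
Qed.

(** Iterating d = r + V d reduces the a priori bound B of d to B 2^-n, while the contributions of r
    add up to 2 A. Only y >= x enters V at x, which allows working on a half-line. *)
Lemma volterra_stability k d r A x0 : N k <= beta / 8 -> wbd d -> 0 <= A ->
  (forall x, x0 <= x -> d x = r x + V k d x) ->
  (forall x, x0 <= x -> N (r x) <= A * (wt x * psi x)) ->
  forall x, x0 <= x -> N (d x) <= 2 * A * (wt x * psi x).
Proof.
move=> kb wd A0 dE rA.
have [B B0 dB] := wbd_pos wd.
have H n x : x0 <= x -> N (d x) <= (2 * A + B * 2^-1 ^+ n) * (wt x * psi x).
  elim: n x => [|n IH] x xx.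
    rewrite expr0 mulr1; apply: (le_trans (dB x)); rewrite ler_wpM2r//.
      exact: wp_ge0.
    by rewrite lerDr mulr_ge0.
  rewrite dE//.
  have -> : (2 * A + B * 2^-1 ^+ n.+1) * (wt x * psi x) =
     A * (wt x * psi x) + (2 * A + B * 2^-1 ^+ n) / 2 * (wt x * psi x).
    by rewrite exprS; move: (2^-1 ^+ n) => t; field.
  apply: ND_le; first exact: rA.
  apply: V_le; [by []|by rewrite addr_ge0// mulr_ge0// exprn_ge0|by []|].
  by move=> y xy; apply: IH; exact: le_trans xy.
move=> x xx; apply: (@le_geometric_add _ _ (B * (wt x * psi x))) => n.
have -> : 2 * A * (wt x * psi x) + B * (wt x * psi x) * 2^-1 ^+ n =
  (2 * A + B * 2^-1 ^+ n) * (wt x * psi x) by ring.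
exact: H.
Qed.

Lemma jost_sol_le k f : N k <= beta / 8 -> jost_sol k f ->
  forall x, N (f x) <= 4 * (wt x * psi x).
Proof.
move=> kb [wf fE] x.
have -> : 4 * (wt x * psi x) = 2 * 2 * (wt x * psi x) by ring.
apply: (@volterra_stability k f (ek k) 2 x) => //.
by move=> y _; exact: N_ek_wt.
Qed.

Definition jost_d k f x : R[i] := ic * k * ek k x + Vd k f x.

Lemma cprim_jost k f : N k <= beta / 8 -> jost_sol k f -> cprim f (jost_d k f).
Proof.
move=> kb [wf fE].
have E : (fun x => ek k x + V k f x) = f by apply/funext => x; rewrite fE.
by have := cprimD (cprim_ek k) (cprim_V kb wf); rewrite E.
Qed.

Lemma cprim_jost_d k f : N k <= beta / 8 -> jost_sol k f ->
  cprim (jost_d k f) (fun x => ((U x)%:C - k ^+ 2) * f x).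
Proof.
move=> kb [wf fE].
apply: eq_cprim (cprimD (cprimZ (ic * k) (cprim_ek k)) (cprim_Vd kb wf)) => x.
have -> : k ^+ 2 * V k f x = k ^+ 2 * (f x - ek k x) by rewrite (fE x); ring.
have -> : ic * k * (ic * k * ek k x) = (ic * ic) * (k ^+ 2 * ek k x) by ring.
rewrite complexi2; ring.
Qed.

Lemma wt0 : wt 0 = 1.
Proof. by rewrite /wt normr0 mulr0 expR0. Qed.

Let Lge : 32 / beta <= L /\ 2 <= L.
Proof.
have h := sqr_ge0 (8 * (32 / beta)).
have h2 : 0 <= 32 / beta by rewrite divr_ge0// ltW.
by rewrite /L; split; lra.
Qed.

Lemma near1_kernel (z : R[i]) k y : N k <= beta / 8 ->
  N z <= 4 * expR (beta / 8 * `|y|) * `|y| * N k -> N z <= L * N k * wt y.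
Proof.
move=> kb; move=> /le_trans; apply.
have b80 : 0 < beta / 8 by rewrite divr_gt0.
have h := le_expR_scale b80 (normr_ge0 y).
set e := expR (beta / 8 * `|y|) in h *.
have e0 : 0 <= e by exact: expR_ge0.
have ee : e * e = wt y by rewrite /e /wt -expRD; congr expR; field.
have -> : L * N k * wt y = N k * (L * wt y) by ring.
have -> : 4 * e * `|y| * N k = N k * (4 * e * `|y|) by ring.
rewrite ler_wpM2l ?N_ge0// -ee.
apply: (@le_trans _ _ (32 / beta * (e * e))); last first.
  by rewrite ler_wpM2r ?mulr_ge0//; case: Lge.
apply: (@le_trans _ _ (4 * e * ((beta / 8)^-1 * e))); first by rewrite ler_wpM2l// mulr_ge0.
by rewrite le_eqVlt; apply/orP; left; apply/eqP; field; rewrite gt_eqF.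
Qed.

(** Lipschitz dependence on k at k = 0, needed only at the point x = 0 where Wronskians are
    evaluated; A does not depend on the solutions. *)
Lemma jost_sol_lip : exists2 A, 0 <= A & forall k f f0, N k <= beta / 8 ->
  jost_sol k f -> jost_sol 0 f0 ->
  N (f 0 - f0 0) <= A * N k /\ N (jost_d k f 0 - jost_d 0 f0 0) <= A * N k.
Proof.
have [L32 L2] := Lge.
have p0 := psi_ge1 0.
have P0 : 0 <= psi 0 by apply: le_trans p0.
have L20 : 0 <= L + 2 by rewrite addr_ge0.
have A1 : 0 <= 2 * (L + 2) * psi 0 by apply: mulr_ge0 => //; apply: mulr_ge0.
have A2 : 0 <= 1 + (2 * psi 0 + (L + 2) * psi 0).
  by apply: addr_ge0 => //; apply: addr_ge0; apply: mulr_ge0.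
exists (2 * (L + 2) * psi 0 + (1 + (2 * psi 0 + (L + 2) * psi 0))).
  exact: addr_ge0.
move=> k f f0 kb jf jf0.
have k00 : N (0 : R[i]) <= beta / 8 by rewrite N0 divr_ge0// ltW.
have f04 := jost_sol_le k00 jf0; have f4 := jost_sol_le kb jf.
case: (jf) => wf fE; case: (jf0) => wf0 f0E.
pose d y := f y - f0 y.
have wd : wbd d by exact: wbdB.
have Nk := N_ge0 k.
(* The difference of the two solutions solves the Volterra equation at k with this source, which is
   O(N k). *)
pose r x := (ek k x - 1) + cJ (fun y => (sinkz k (y - x) - (y - x)%:C) * (U y)%:C * f0 y) x.
have dE x : d x = r x + V k d x.
  rewrite /d VB// /r.
  have -> : cJ (fun y => (sinkz k (y - x) - (y - x)%:C) * (U y)%:C * f0 y) x = V k f0 x - V 0 f0 x.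
    rewrite /V -(cJB x gam0 (ctail_V x kb wf0) (ctail_V x k00 wf0)).
    by apply: eq_cJ => y _; rewrite sinkz00; ring.
  by rewrite fE f0E ek00; ring.
have mB x : cmlb (fun y => sinkz k (y - x) - (y - x)%:C).
  have h1 := cmlb_sinkz_shift k x.
  have h2 := cmlbM (cmlb_cst (-1)) (cmlb_sinkz_shift 0 x).
  have := cmlbD h1 h2; congr cmlb; apply/funext => y.
  by rewrite sinkz00 mulN1r.
have rA x : N (r x) <= (L + 2) * N k * (wt x * psi x).
  have -> : (L + 2) * N k * (wt x * psi x) = L * N k * (wt x * psi x) + 2 * N k * (wt x * psi x) by ring.
  have b8 : 0 <= beta / 8 by rewrite divr_ge0// ltW.
  apply: ND_le.
    apply: (le_trans (near1_kernel kb (N_ek1_le x kb b8))).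
    apply: ler_wpM2l; first exact: mulr_ge0.
    rewrite -[leLHS]mulr1; apply: ler_wpM2l; last exact: psi_ge1.
    exact/ltW/wt_gt0.
  have := @N_cJ_integrand (fun y => sinkz k (y - x) - (y - x)%:C) f0 (L * N k) 4 x (mB x) _ _ _ wf0 _.
  have -> : L * N k / L * (4 / 2) = 2 * N k by field; rewrite gt_eqF.
  have LN : 0 <= L * N k by apply: mulr_ge0.
  apply => //.
  by move=> y; exact: sinkzB_kernel.
have dA x : N (d x) <= 2 * ((L + 2) * N k) * (wt x * psi x).
  apply: (@volterra_stability k d r ((L + 2) * N k) x) => //.
  exact: mulr_ge0.
split.
  apply: (le_trans (dA 0)); rewrite wt0 mul1r.
  have -> : 2 * ((L + 2) * N k) * psi 0 = 2 * (L + 2) * psi 0 * N k by ring.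
  by rewrite ler_wpM2r// lerDl.
(* At x = 0 the term with [J1] drops out, since sinkz k 0 = 0, and ck k 0 = 1. *)
have -> : jost_d k f 0 - jost_d 0 f0 0 = ic * k - (J2 k f 0 - J2 0 f0 0).
  rewrite /jost_d /Vd !sinkzk0 ek0 ck0 mulr0 mul0r.
  rewrite (_ : ck k 0 = 1); last by rewrite /ck !ek0 -mulr2n -mulr_natr mul1r divff ?two_neq0.
  by rewrite !mulr0 !mul0r; ring.
have -> : J2 k f 0 - J2 0 f0 0 =
   cJ (fun y => (ck k y - 1) * (U y)%:C * f y) 0 + cJ (fun y => 1 * (U y)%:C * d y) 0.
  have t1 := ctail_J2 kb wf; have t2 := ctail_J2 k00 wf0.
  have t3 := ctail_J2 k00 wf; have t4 := ctail_J2 k00 wd.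
  rewrite -(@cJB _ gam)//.
  have -> : cJ (fun y => (ck k y - 1) * (U y)%:C * f y) 0 = J2 k f 0 - J2 0 f 0.
    by rewrite -(@cJB _ gam)//; apply: eq_cJ => y _; rewrite ck0; ring.
  have -> : cJ (fun y => 1 * (U y)%:C * d y) 0 = J2 0 f 0 - J2 0 f0 0.
    by rewrite -(@cJB _ gam)//; apply: eq_cJ => y _; rewrite ck0 /d; ring.
  by rewrite (@cJB _ gam)//; rewrite /J2; ring.
have e1 : N (ic * k) <= 1 * N k by apply: NM_le => //; rewrite N_ic.
have m1 : cmlb (fun y => ck k y - 1).
  have := cmlbD (cprim_cmlb (cprim_ck k)) (cmlb_cst (-1)); by congr cmlb.
have e2 : N (cJ (fun y => (ck k y - 1) * (U y)%:C * f y) 0) <= 2 * psi 0 * N k.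
  have := @N_cJ_integrand (fun y => ck k y - 1) f (L * N k) 4 0 m1 _ _ _ wf _.
  have -> : L * N k / L * (4 / 2) * (wt 0 * psi 0) = 2 * psi 0 * N k.
    by rewrite wt0; field; rewrite gt_eqF.
  have LN : 0 <= L * N k by apply: mulr_ge0.
  apply => //.
  move=> y; rewrite wt0 mul1r; apply: near1_kernel => //; apply: N_ck1_le => //.
  by rewrite divr_ge0// ltW.
have e3 : N (cJ (fun y => 1 * (U y)%:C * d y) 0) <= (L + 2) * psi 0 * N k.
  have := @N_cJ_integrand (fun y => 1) d L (2 * ((L + 2) * N k)) 0 (cmlb_cst 1) _ _ _ wd _.
  have -> : L / L * (2 * ((L + 2) * N k) / 2) * (wt 0 * psi 0) = (L + 2) * psi 0 * N k.
    by rewrite wt0; field; rewrite gt_eqF.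
  have LN : 0 <= 2 * ((L + 2) * N k) by apply: mulr_ge0 => //; apply: mulr_ge0.
  apply => //.
  move=> y; rewrite N1 wt0 mul1r; have := wt_ge1 y.
  have : 1 * wt y <= L * wt y by rewrite ler_wpM2r ?(ltW (wt_gt0 _))//; lra.
  by lra.
have := NB_le e1 (ND_le e2 e3).
move=> /le_trans; apply.
have -> : 1 * N k + (2 * psi 0 * N k + (L + 2) * psi 0 * N k) =
   (1 + (2 * psi 0 + (L + 2) * psi 0)) * N k by ring.
by rewrite ler_wpM2r// lerDr.
Qed.

End Volterra.

Lemma cwronskian_cst {R : realType} (U : R -> R) (k : R[i]) (f f' g g' : R -> R[i]) :
  cprim f f' -> cprim f' (fun x => ((U x)%:C - k ^+ 2) * f x) ->
  cprim g g' -> cprim g' (fun x => ((U x)%:C - k ^+ 2) * g x) ->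
  forall x y, f x * g' x - g x * f' x = f y * g' y - g y * f' y.
Proof.
move=> f1 f2 g1 g2; apply: (@cprim0 R (fun x => f x * g' x - g x * f' x)).
by apply: eq_cprim (cprimB (cprimM f1 g2) (cprimM g1 f2)) => x; ring.
Qed.

(** * Genericity from the Wronskian at zero energy *)

Section JostDefs.
Context {R : realType}.
Implicit Types (x y : R) (z w k : R[i]) (f g : R -> R[i]).

Local Notation mu := (@lebesgue_measure R).

Lemma aeS (P Q : R -> Prop) : (forall x, P x -> Q x) ->
  {ae mu, forall x, P x} -> {ae mu, forall x, Q x}.
Proof.
by move=> PQ; apply: filterS; first exact: (ae_filter_ringOfSetsType mu).
Qed.

Lemma ctail_cintegrable (c x : R) f : 0 < c -> ctail c f -> cintegrable `[x, +oo[ f.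
Proof. by move=> c0 [t1 t2]; split; exact: (tail_integrable x c0). Qed.

Lemma opp_itvNyc x : (-%R @^-1` `]-oo, x]) = `[- x, +oo[%classic :> set R.
Proof. by apply/seteqP; split => y /=; rewrite !in_itv /= andbT lerNl. Qed.

Lemma reflect_integrable (c x : R) (h : R -> R) : 0 < c -> tail c (fun y => h (- y)) ->
  mu.-integrable `]-oo, x] (EFin \o h) /\
  \int[mu]_(y in `]-oo, x]) h y = J (fun y => h (- y)) (- x).
Proof.
move=> c0 th.
have mh : measurable_fun setT h.
  have [m _] := mlb_oppx (tail_mlb c0 th).
  by rewrite (_ : h = (fun y => h (- - y)))//; apply/funext => y; rewrite opprK.
have hi : mu.-integrable (-%R @^-1` `]-oo, x]) (fun y => (h (- y))%:E).
  by rewrite opp_itvNyc; exact: (tail_integrable (- x) c0 th).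
split; first exact: integrable_opp.
by rewrite -(Rintegral_opp _ mh hi)// opp_itvNyc.
Qed.

Section AeEq.
Context (U U0 : R -> R) (C beta : R).
Context (mU : measurable_fun setT U) (C0 : 0 <= C) (beta0 : 0 < beta).
Context (UC : forall x, `|U x| <= C * expR (- (beta * `|x|))).
Context (mU0 : measurable_fun setT U0) (UU0 : {ae mu, forall x, U0 x = U x}).

Let gam0 : 0 < beta / 2. Proof. by rewrite divr_gt0. Qed.

Lemma Rint_ae (D : set R) (a : R -> R) : measurable D -> measurable_fun setT a ->
  mu.-integrable D (fun y => (a y * U y)%:E) ->
  mu.-integrable D (fun y => (a y * U0 y)%:E) /\
  \int[mu]_(y in D) (a y * U0 y) = \int[mu]_(y in D) (a y * U y).
Proof.
move=> mD ma iU.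
have m0 : measurable_fun D (fun y => (a y * U0 y)%:E).
  by apply/measurable_EFinP; apply: measurable_funTS; exact: measurable_funM.
have m1 : measurable_fun D (fun y => (a y * U y)%:E).
  by apply/measurable_EFinP; apply: measurable_funTS; exact: measurable_funM.
have e : ae_eq mu D (fun y => (a y * U0 y)%:E) (fun y => (a y * U y)%:E).
  by move: UU0; apply: aeS => y -> _.
split; last by rewrite /Rintegral; congr fine; apply: ae_eq_integral.
move/integrableP : iU => [_ H]; apply/integrableP; split => //.
apply: le_lt_trans H; rewrite le_eqVlt; apply/orP; left; apply/eqP.
apply: ae_eq_integral => //; try exact: measurableT_comp.
by move: UU0; apply: aeS => y /= -> _.
Qed.

Lemma cint_ae (D : set R) (a : R -> R[i]) : measurable D -> cmlb a ->
  cintegrable D (fun y => (U y)%:C * a y) ->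
  cintegrable D (fun y => (U0 y)%:C * a y) /\
  cintegral D (fun y => (U0 y)%:C * a y) = cintegral D (fun y => (U y)%:C * a y).
Proof.
move=> mD [[m1 _] [m2 _]] [].
have eR (W : R -> R) : (fun y => complex.Re ((W y)%:C * a y)) = (fun y => complex.Re (a y) * W y).
  by apply/funext => y; rewrite cReM /= mul0r subr0 mulrC.
have eI (W : R -> R) : (fun y => complex.Im ((W y)%:C * a y)) = (fun y => complex.Im (a y) * W y).
  by apply/funext => y; rewrite cImM /= mul0r addr0 mulrC.
rewrite /cintegrable /cintegral !eR !eI => h1 h2.
have [i1 e1] := Rint_ae mD m1 h1; have [i2 e2] := Rint_ae mD m2 h2.
by rewrite e1 e2.
Qed.

(** [U] is a representative bounded at every point, [U0] the potential as given. The Volterra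
    integrals do not see the null set where they differ, so a solution for [U] satisfies the
    equation of [U0] at every x. *)
Lemma jost_plusP k f : N k <= beta / 8 -> jost_sol U C beta k f -> jost_plus U0 k f.
Proof.
move=> kb [wf fE] x.
have E (W : R -> R) : (fun y => sinkz k (y - x) * (W y)%:C * f y) =
  (fun y => (W y)%:C * (sinkz k (y - x) * f y)) by apply/funext => y; ring.
have t := ctail_V mU C0 beta0 UC x kb wf.
have mk : cmlb (fun y => sinkz k (y - x) * f y).
  by apply: cmlbM; [exact: cmlb_sinkz_shift|case: wf].
have := ctail_cintegrable x gam0 t.
rewrite !E => h; have [i e] := cint_ae (measurable_itv _) mk h.
by split => //; rewrite e fE /V E.
Qed.

End AeEq.

Section Minus.
Context (U U0 : R -> R) (C beta : R).
Context (mU : measurable_fun setT U) (C0 : 0 <= C) (beta0 : 0 < beta).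
Context (UC : forall x, `|U x| <= C * expR (- (beta * `|x|))).
Context (mU0 : measurable_fun setT U0) (UU0 : {ae mu, forall x, U0 x = U x}).

Let gam0 : 0 < beta / 2. Proof. by rewrite divr_gt0. Qed.

Lemma sinkzN k x : sinkz k (- x) = - sinkz k x.
Proof.
have [->|k0] := eqVneq k 0; first by rewrite !sinkz00 rmorphN.
by rewrite !sinkzE// !ek_oppx opprK; ring.
Qed.

(** Reflection exchanges the two Volterra equations; the minus sign in front of the left integral is
    absorbed by the oddness of [sinkz]. *)
Lemma jost_minusP k g : N k <= beta / 8 -> jost_sol (fun x => U (- x)) C beta k g ->
  jost_minus U0 k (fun x => g (- x)).
Proof.
move=> kb [wg gE] x.
have mUo : measurable_fun setT (fun x => U (- x)).
  by apply: (measurableT_comp mU); exact: oppr_measurable.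
have UoC y : `|U (- y)| <= C * expR (- (beta * `|y|)) by rewrite -(normrN y).
have t := ctail_V mUo C0 beta0 UoC (- x) kb wg.
pose h (W : R -> R) y := sinkz k (y - x) * (W y)%:C * g (- y).
have hE : (fun y => h U (- y)) = (fun y => - (sinkz k (y - - x) * (U (- y))%:C * g y)).
  apply/funext => y; rewrite /h opprK.
  by rewrite (_ : - y - x = - (y - - x)) ?sinkzN; [ring|rewrite opprK opprD].
have [t1 t2] : ctail (beta / 2) (fun y => h U (- y)) by rewrite hE; exact: ctailN.
have [i1 e1] := @reflect_integrable (beta / 2) x (fun y => complex.Re (h U y)) gam0 t1.
have [i2 e2] := @reflect_integrable (beta / 2) x (fun y => complex.Im (h U y)) gam0 t2.
have E (W : R -> R) : h W = (fun y => (W y)%:C * (sinkz k (y - x) * g (- y))).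
  by apply/funext => y; rewrite /h; ring.
have mk : cmlb (fun y => sinkz k (y - x) * g (- y)).
  apply: cmlbM; first exact: cmlb_sinkz_shift.
  by case: wg => -[m1 m2] _; split; [exact: (mlb_oppx m1)|exact: (mlb_oppx m2)].
have := @cint_ae U U0 mU mU0 UU0 `]-oo, x] _ (measurable_itv _) mk.
rewrite -!E => /(_ (conj i1 i2))[i e].
split; first exact: i.
rewrite -/(h U0) e gE; congr (_ + _).
  by rewrite ek_oppx ekN.
rewrite /V -[LHS]opprK -(cJN _ gam0 t) -hE; congr (- _).
by rewrite /cintegral e1 e2.
Qed.

End Minus.

End JostDefs.

Section GenericCriterion.
Context {R : realType}.
Implicit Types (x y : R) (z w k : R[i]) (f g : R -> R[i]).
Local Notation mu := (@lebesgue_measure R).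

Lemma le_sum4 (a b c d : R) : 0 <= a -> 0 <= b -> 0 <= c -> 0 <= d ->
  a <= a + b + c + d /\ b <= a + b + c + d /\ c <= a + b + c + d /\ d <= a + b + c + d.
Proof. by move=> *; do !split; lra. Qed.

Lemma N_lipschitz_cvg (W : R[i] -> R[i]) (A d : R) : 0 < d -> 0 <= A ->
  (forall k, N k <= d -> N (W k - W 0) <= A * N k) ->
  (W : R[i]^o -> R[i]^o) k @[k --> (0 : R[i]^o)] --> (W 0 : R[i]^o).
Proof.
move=> d0 A0 HW; apply/(@cvgrPdist_le R[i] R[i]^o R[i]^o (nbhs (0 : R[i]^o)) (nbhs_filter (0 : R[i]^o)) W (W 0)) => e e0.
have er : e = (complex.Re e)%:C by move: e0; case: e => a b /=; rewrite ltcE /= => /andP[/eqP -> _].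
have r0 : 0 < complex.Re e by move: e0; rewrite ltcE => /andP[].
pose d' := Num.min d (complex.Re e / (A + 1)).
have d'0 : 0 < d' by rewrite lt_min d0 divr_gt0// ltr_wpDl.
have : \forall k \near (0 : R[i]^o), N k <= d'.
  exists ((d' / 2)%:C); first by rewrite /= ltcR divr_gt0.
  move=> k /=; rewrite sub0r normrN => kd.
  have : Normc.normc k < d' / 2 by rewrite -ltcR.
  by have := N_le_normc k; lra.
apply: filterS => k kd.
rewrite er; have : Normc.normc (W 0 - W k) <= complex.Re e.
  apply: (le_trans (normc_le_N _)); rewrite -NN opprB.
  apply: (le_trans (HW k _)).
    by apply: (le_trans kd); rewrite ge_min lexx.
  apply: (@le_trans _ _ (A * (complex.Re e / (A + 1)))).
    by rewrite ler_wpM2l//; apply: (le_trans kd); rewrite ge_min lexx orbT.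
  rewrite mulrA ler_pdivrMr ?ltr_wpDl//; lra.
by move=> h; rewrite -[`|_|]/((Normc.normc (W 0 - W k))%:C) lecR.
Qed.

(** The left solution x -> g (- x) has derivative - g' (- x), so the sum assumed nonzero is minus
    the Wronskian at k = 0. The Jost data are computed from [U] and transferred to [U0]. *)
Lemma generic_of_wronskian (U U0 : R -> R) (C beta : R) f0 g0 :
  measurable_fun setT U -> 0 <= C -> 0 < beta ->
  (forall x, `|U x| <= C * expR (- (beta * `|x|))) ->
  measurable_fun setT U0 -> {ae mu, forall x, U0 x = U x} ->
  jost_sol U C beta 0 f0 -> jost_sol (fun x => U (- x)) C beta 0 g0 ->
  f0 0 * jost_d (fun x => U (- x)) 0 g0 0 + g0 0 * jost_d U 0 f0 0 != 0 ->
  generic U0.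
Proof.
move=> mU C0 b0 UC mU0 UU0 jf0 jg0 W0.
have mUo : measurable_fun setT (fun x => U (- x)).
  by apply: (measurableT_comp mU); exact: oppr_measurable.
have UoC y : `|U (- y)| <= C * expR (- (beta * `|y|)) by rewrite -(normrN y).
have H k : exists p : (R -> R[i]) * (R -> R[i]), N k <= beta / 8 ->
    jost_sol U C beta k p.1 /\ jost_sol (fun x => U (- x)) C beta k p.2.
  have [kb|] := boolP (N k <= beta / 8); last by exists (f0, g0).
  have [f jf] := jost_sol_exists mU C0 b0 UC kb.
  have [g jg] := jost_sol_exists mUo C0 b0 UoC kb.
  by exists (f, g).
have [p0 Hp0] := choice H.
(* The chosen family is overridden at k = 0, so that W 0 is the value given by f0 and g0 without an
   appeal to uniqueness. *)
pose p k := if k == 0 then (f0, g0) else p0 k.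
have Hp k : N k <= beta / 8 -> jost_sol U C beta k (p k).1 /\
    jost_sol (fun x => U (- x)) C beta k (p k).2.
  by rewrite /p; case: eqP => [->//|_]; exact: Hp0.
pose W k := - ((p k).1 0 * jost_d (fun x => U (- x)) k (p k).2 0 + (p k).2 0 * jost_d U k (p k).1 0).
(* W is a sum of products of quantities that are Lipschitz at k = 0. *)
have cW : (W : R[i]^o -> R[i]^o) k @[k --> (0 : R[i]^o)] --> (W 0 : R[i]^o).
  have [A A0 HA] := jost_sol_lip mU C0 b0 UC.
  have [B B0 HB] := jost_sol_lip mUo C0 b0 UoC.
  pose a := (p 0).1 0; pose a' := jost_d U 0 (p 0).1 0.
  pose c := (p 0).2 0; pose c' := jost_d (fun x => U (- x)) 0 (p 0).2 0.
  pose M := (N a + N a' + N c + N c').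
  have M0 : 0 <= M by rewrite /M !addr_ge0 ?N_ge0.
  have d0 : 0 < Num.min 1 (beta / 8) by rewrite lt_min ltr01 divr_gt0.
  apply: (@N_lipschitz_cvg W ((A * (M + B) + M * B) + (B * (M + A) + M * A)) _ d0).
    by rewrite !addr_ge0// mulr_ge0// addr_ge0.
  move=> k; rewrite le_min => /andP[k1 kb].
  have k0b : N (0 : R[i]) <= beta / 8 by rewrite N0 divr_ge0// ltW.
  have [jf jg] := Hp k kb; have [jf0' jg0'] := Hp 0 k0b.
  have [h1 h2] := HA k _ _ kb jf jf0'; have [h3 h4] := HB k _ _ kb jg jg0'.
  have Nk := N_ge0 k.
  have Ma : N a <= M /\ N a' <= M /\ N c <= M /\ N c' <= M.
    by apply: le_sum4; exact: N_ge0.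
  case: Ma => Ma [Ma' [Mc Mc']].
  have prodlip u v u0 v0 P Q : 0 <= P -> 0 <= Q -> N (u - u0) <= P * N k -> N (v - v0) <= Q * N k ->
      N u0 <= M -> N v0 <= M -> N (u * v - u0 * v0) <= (P * (M + Q) + M * Q) * N k.
    move=> P0 Q0 hu hv Mu Mv.
    have -> : u * v - u0 * v0 = (u - u0) * (v0 + (v - v0)) + u0 * (v - v0) by ring.
    have -> : (P * (M + Q) + M * Q) * N k = (P * N k) * (M + Q) + M * (Q * N k) by ring.
    apply: ND_le; last exact: NM_le.
    apply: NM_le => //; apply: ND_le => //.
    by apply: (le_trans hv); rewrite -[leRHS]mulr1 ler_wpM2l.
  have -> : W k - W 0 = - (((p k).1 0 * jost_d (fun x => U (- x)) k (p k).2 0 - a * c') +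
       ((p k).2 0 * jost_d U k (p k).1 0 - c * a')).
    have E (u v u0 v0 : R[i]) : - (u + v) - - (u0 + v0) = - ((u - u0) + (v - v0)) by ring.
    exact: E.
  rewrite NN [leRHS]mulrDl.
  by apply: ND_le; apply: prodlip.
have W0' : W 0 != 0 by rewrite /W /p eqxx /= oppr_eq0.
pose t k := if k == 0 then 0 else - (2 * ic * k) / W k.
have ct : (t : R[i]^o -> R[i]^o) k @[k --> (0 : R[i]^o)^'] --> (0 : R[i]^o).
  have c1 : (fun k : R[i]^o => (- (2 * ic * k) / W k : R[i]^o)) k @[k --> (0 : R[i]^o)] --> (0 : R[i]^o).
    have c2 : (fun k : R[i]^o => (- (2 * ic * k) : R[i]^o)) k @[k --> (0 : R[i]^o)] --> (- (2 * ic * 0) : R[i]^o).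
      apply: (@N_lipschitz_cvg (fun k => - (2 * ic * k)) 2 1) => // k _.
      have -> : - (2 * ic * k) - - (2 * ic * 0) = - (k + k) * ic by ring.
      have -> : 2 * N k = (N k + N k) * 1 by ring.
      by apply: NM_le; rewrite ?N_ic// NN; exact: ND_le.
    have c3 := @cvgV R[i] R[i]^o (nbhs (0 : R[i]^o)) (nbhs_filter (0 : R[i]^o)) W (W 0) W0' cW.
    have c4 := @cvgM R[i] R[i]^o (nbhs (0 : R[i]^o)) (nbhs_filter (0 : R[i]^o)) _ _ _ _ c2 c3.
    have E : - (2 * ic * 0) * (W 0)^-1 = 0 by rewrite mulr0 oppr0 mul0r.
    by rewrite E in c4; exact: c4.
  have c2 : (fun k : R[i]^o => (- (2 * ic * k) / W k : R[i]^o)) k @[k --> (0 : R[i]^o)^'] --> (0 : R[i]^o).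
    by move=> P /c1; exact: nbhs_dnbhs.
  move=> P /c2 HP; rewrite /= in HP.
  have n0 : \forall k \near (0 : R[i]^o)^', k != 0 by exact: nbhs_dnbhs_neq.
  apply: filterS2 n0 HP => k k0.
  by rewrite /preimage /= /t ifN.
exists t; split; last by rewrite /t eqxx.
split; last by rewrite {2}/t eqxx.
have n1 : \forall k \near (0 : R[i]^o)^', N k <= beta / 8.
  apply: nbhs_dnbhs.
  have b8 : 0 < beta / 8 by rewrite divr_gt0.
  exists ((beta / 8 / 2)%:C); first by rewrite /= ltcR divr_gt0.
  move=> k /=; rewrite sub0r normrN => kd.
  have : Normc.normc k < beta / 8 / 2 by rewrite -ltcR.
  by have := N_le_normc k; lra.
have n2 : \forall k \near (0 : R[i]^o)^', W k != 0.
  apply: nbhs_dnbhs.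
  exact: (@cvgr_neq0 R[i] R[i]^o _ _ _ W _ cW).
have n3 : \forall k \near (0 : R[i]^o)^', k != 0 by exact: nbhs_dnbhs_neq.
near=> k.
have kb : N k <= beta / 8 by near: k.
have Wk : W k != 0 by near: k.
have k0 : k != 0 by near: k.
have [jf jg] := Hp k kb.
exists (p k).1, (fun x => (p k).2 (- x)); split.
- exact: (@jost_plusP R U U0 C beta) kb jf.
- exact: (@jost_minusP R U U0 C beta) kb jg.
- rewrite /t ifN// mulf_neq0 ?invr_eq0// oppr_eq0 !mulf_neq0 ?two_neq0//.
  exact: complexi_neq0.
have f1 := cprim_jost mU C0 b0 UC kb jf; have f2 := cprim_jost_d mU C0 b0 UC kb jf.
have g1 := cprim_oppx (cprim_jost mUo C0 b0 UoC kb jg).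
have g2 := cprimN (cprim_oppx (cprim_jost_d mUo C0 b0 UoC kb jg)).
move=> x; rewrite /wronskian (cprim_cderive x f1 f2) (cprim_cderive x g1 g2).
have g2' : cprim (fun x => - jost_d (fun x => U (- x)) k (p k).2 (- x))
    (fun x => ((U x)%:C - k ^+ 2) * (p k).2 (- x)).
  by apply: eq_cprim g2 => y; rewrite !opprK.
rewrite (cwronskian_cst f1 f2 g1 g2' x 0) oppr0.
rewrite /t ifN//.
have -> : (p k).1 0 * - jost_d (fun x => U (- x)) k (p k).2 0 - (p k).2 0 * jost_d U k (p k).1 0 = W k.
  by rewrite /W; ring.
change (- (2 * 'i * k)) with (- (2 * ic * k)).
have u0 : - (2 * ic * k) != 0 by rewrite oppr_eq0 !mulf_neq0 ?two_neq0 ?complexi_neq0.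
by rewrite invf_div mulrCA divff// mulr1.
Unshelve. all: by end_near. Qed.

End GenericCriterion.

(** * Real Jost solutions at zero energy *)

Local Close Scope complex_scope.

Section RealZeroEnergy.
Context {R : realType}.
Implicit Types (x y A : R) (U w u g r f : R -> R).
Context (C beta : R) (C0 : 0 <= C) (beta0 : 0 < beta).

Local Notation mu := (@lebesgue_measure R).

(** [C] and [beta] are fixed in the section: a constant obtained for this class is valid for q_av
    and all V_epsilon at once. *)
Definition potential U := measurable_fun setT U /\
  forall x, `|U x| <= C * expR (- (beta * `|x|)).

(** [rj_sol] and [rj_d] tie w and w' to the complex solution used by the genericity criterion; the
    other fields restate its equations over the reals. *)
Record real_jost U w (w' : R -> R) : Prop := RealJost {
  rj_sol : jost_sol U C beta 0 (fun x => (w x)%:C%C) ;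
  rj_d : forall x, jost_d U 0 (fun x => (w x)%:C%C) x = (w' x)%:C%C ;
  rj_prim : prim w w' ;
  rj_prim' : prim w' (fun x => U x * w x) ;
  rj_eq : forall x, w x = 1 + J (fun y => (y - x) * U y * w y) x ;
  rj_eq' : forall x, w' x = - J (fun y => U y * w y) x }.

Lemma cJ_real (h : R -> R) x : cJ (fun y => (h y)%:C%C) x = ((J h x)%:C)%C.
Proof. by apply: eq_ReIm => //=; exact: J0. Qed.

Lemma V0_real U g x : V U 0 (fun x => (g x)%:C%C) x =
  ((J (fun y => (y - x) * U y * g y) x)%:C)%C.
Proof. by rewrite -cJ_real; apply: eq_cJ => y _; rewrite sinkz00 !rmorphM. Qed.

Lemma J20_real U g x : J2 U 0 (fun x => (g x)%:C%C) x =
  ((J (fun y => U y * g y) x)%:C)%C.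
Proof. by rewrite -cJ_real; apply: eq_cJ => y _; rewrite ck0 mul1r rmorphM. Qed.

Lemma k00 : N (0 : R[i]) <= beta / 8.
Proof. by rewrite N0 divr_ge0// ltW. Qed.

(** At k = 0 the kernel and the free solution are real, so the real part of a complex solution is
    again a solution. *)
Lemma real_jost_exists U : potential U -> exists w w', real_jost U w w'.
Proof.
move=> [mU UC].
have [f [[[m1 m2] [B fB]] fE]] := jost_sol_exists mU C0 beta0 UC k00.
pose w x := complex.Re (f x).
pose w' x := - J (fun y => U y * w y) x.
have wE x : w x = 1 + J (fun y => (y - x) * U y * w y) x.
  rewrite /w fE ek00 cReD /=; congr (_ + _).
  rewrite /V /cJ /=; apply: eq_J => y _.
  by rewrite sinkz00 !(cReM, cImM) /=; ring.
have js : jost_sol U C beta 0 (fun x => (w x)%:C%C).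
  split; last by move=> x; rewrite V0_real ek00 {1}wE rmorphD.
  split; first exact: cmlb_real.
  exists B => x; rewrite NC; apply: le_trans (fB x).
  by rewrite /N lerDl.
have jd x : jost_d U 0 (fun x => (w x)%:C%C) x = (w' x)%:C%C.
  rewrite /jost_d /Vd J20_real ck0 mulr0 mul0r add0r.
  by rewrite expr0n /= !mul0r add0r mul1r /w' rmorphN.
exists w, w'; split => //.
- have [p _] := cprim_jost mU C0 beta0 UC k00 js.
  by apply: eq_prim p => x; rewrite jd.
- have := cprim_jost_d mU C0 beta0 UC k00 js.
  rewrite (_ : jost_d U 0 _ = (fun x => (w' x)%:C%C)); last by apply/funext => x; rewrite jd.
  move=> [p _]; apply: eq_prim p => x.
  by rewrite expr0n /=; ring.
Qed.

Lemma tail_intro (c M : R) f : 0 <= M -> mlb f ->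
  (forall y, 0 <= y -> `|f y| <= M * expR (- (c * y))) -> tail c f.
Proof.
move=> M0 mf HM; split; first by case: mf.
move=> x.
have [B B0 HB] := mlb_bound mf x 0.
have [D D0 HD] := mlb_bound (mlb_continuous (@continuous_expRM R c)) x 0.
exists (M + B * D) => y xy.
have [y0|/ltW y0] := leP 0 y.
  apply: (le_trans (HM _ y0)); rewrite ler_wpM2r ?expR_ge0// lerDl.
  exact: mulr_ge0.
apply: (le_trans (HB _ xy y0)).
have e1 : 1 <= D * expR (- (c * y)).
  have := HD _ xy y0; rewrite ger0_norm ?expR_ge0// => h.
  rewrite -(@expR0 R) -(subrr (c * y)) expRD.
  by rewrite ler_wpM2r// expR_ge0.
rewrite mulrDl -mulrA -[leLHS]add0r; apply: lerD.
  by rewrite mulr_ge0// expR_ge0.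
by rewrite -[leLHS]mulr1 ler_wpM2l.
Qed.

Lemma tail_half a f : 0 < a -> tail a f -> tail (a / 2) f.
Proof.
move=> a0 tf; have [M M0 HM] := tail_bound 0 a0 tf.
apply: (tail_intro M0 (tail_mlb a0 tf)) => y y0; apply: (le_trans (HM y y0)).
by rewrite ler_wpM2l// ler_expR lerN2 ler_wpM2r// ler_pdivrMr// ler_peMr ?ltW// ltr1n.
Qed.

Lemma mulx_expR_le (c y : R) : 0 < c -> 0 <= y ->
  y * expR (- (c * y)) <= 2 / c * expR (- (c / 2 * y)).
Proof.
move=> c0 y0; have c2 : 0 < c / 2 by rewrite divr_gt0.
have -> : expR (- (c * y)) = expR (- (c / 2 * y)) * expR (- (c / 2 * y)).
  by rewrite -expRD; congr expR; field.
have := le_expR_scale c2 y0.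
rewrite mulrA => h; rewrite ler_wpM2r ?expR_ge0//.
rewrite expRN ler_pdivrMr ?expR_gt0//.
by apply: (le_trans h); rewrite invf_div.
Qed.

Lemma potential_pos U y : potential U -> 0 <= y -> `|U y| <= C * expR (- (beta * y)).
Proof. by move=> [_ UC] y0; have := UC y; rewrite (ger0_norm y0). Qed.

Lemma potential_mlb U : potential U -> mlb U.
Proof. by move=> [mU UC]; apply: mlbU mU C0 beta0 UC. Qed.

Lemma mlb_shift x : mlb (fun y : R => y - x).
Proof.
apply: mlb_continuous => y; apply: cvgB; [exact: cvg_id|exact: cvg_cst].
Qed.

Lemma linear_factor_bound (c : R) (h : R -> R) x M : 0 < c -> 0 <= x -> 0 <= M ->
  (forall y, 0 <= y -> `|h y| <= M * expR (- (c * y))) ->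
  forall y, x <= y -> `|(y - x) * h y| <= 2 / c * M * expR (- (c / 2 * y)).
Proof.
move=> c0 x0 M0 HM y xy; have y0 := le_trans x0 xy.
rewrite normrM ger0_norm ?subr_ge0//.
apply: (@le_trans _ _ (y * (M * expR (- (c * y))))).
  by apply: ler_pM => //; [rewrite subr_ge0|rewrite lerBlDr lerDl|exact: HM].
rewrite mulrCA [leRHS]mulrAC [leRHS]mulrC.
by rewrite ler_wpM2l// mulx_expR_le.
Qed.

(** The factor y - x is paid for by half of the decay rate; since x >= 0 gives y - x <= y, the bound
    on the integral does not depend on x. *)
Lemma J_linear_bound (c : R) (h : R -> R) x M : 0 < c -> mlb h -> 0 <= x -> 0 <= M ->
  (forall y, 0 <= y -> `|h y| <= M * expR (- (c * y))) ->
  tail (c / 2) (fun y => (y - x) * h y) /\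
  `|J (fun y => (y - x) * h y) x| <= 4 / c ^+ 2 * M.
Proof.
move=> c0 mh x0 M0 HM; have b2 : 0 < c / 2 by rewrite divr_gt0.
have mm : mlb (fun y => (y - x) * h y) by apply: mlbM => //; exact: mlb_shift.
have H := linear_factor_bound c0 x0 M0 HM.
split.
  apply: (@tail_intro _ (2 / c * M + x * M)) => //.
    by apply: addr_ge0; apply: mulr_ge0 => //; rewrite divr_ge0// ltW.
  move=> y y0.
  rewrite normrM.
  have h1 : `|y - x| <= y + x by apply: (le_trans (ler_normB _ _)); rewrite !ger0_norm.
  apply: (@le_trans _ _ ((y + x) * (M * expR (- (c * y))))).
    by apply: ler_pM => //; exact: HM.
  rewrite mulrDl [leRHS]mulrDl; apply: lerD.
    rewrite mulrCA [leRHS]mulrAC [leRHS]mulrC.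
    by rewrite ler_wpM2l// mulx_expR_le.
  rewrite -mulrA ler_wpM2l// ler_wpM2l// ler_expR lerN2.
  by rewrite ler_wpM2r// ler_pdivrMr// ler_peMr ?ler1n// ltW.
have := J_bound b2 mm.1 H => /le_trans; apply.
have -> : 4 / c ^+ 2 * M = 2 / c * M / (c / 2) * 1 by field; rewrite gt_eqF.
rewrite ler_wpM2l//.
  by apply: divr_ge0; [apply: mulr_ge0 => //; rewrite divr_ge0// ltW|exact: ltW].
by rewrite -expR0 ler_expR oppr_le0 mulr_ge0// divr_ge0// ltW.
Qed.

(** Stability alone allows growth of rate beta / 4. Inserted once into the equation, it leaves the
    integrand a decay of rate 3 beta / 4, and the integral is then bounded. K depends on [C] and
    [beta] only. *)
Lemma volterra_bounded : exists2 K, 0 <= K & forall U g r A,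
  potential U -> wbd C beta (fun x => (g x)%:C%C) -> 0 <= A ->
  (forall x, 0 <= x -> g x = r x + J (fun y => (y - x) * U y * g y) x) ->
  (forall x, 0 <= x -> `|r x| <= A) ->
  forall x, 0 <= x -> `|g x| <= K * A.
Proof.
have c0 : 0 < 3 * beta / 4 by rewrite divr_gt0// mulr_gt0.
pose P := psi C beta 0.
have P0 : 0 <= P by exact/ltW/psi_gt0.
pose K' := 4 / (3 * beta / 4) ^+ 2 * (C * (2 * P)).
have K'0 : 0 <= K'.
  apply: mulr_ge0; first by rewrite divr_ge0// exprn_ge0// ltW.
  by apply: mulr_ge0 => //; apply: mulr_ge0.
exists (1 + K'); first by rewrite addr_ge0.
move=> U g r A pU wg A0 gE rA.
have [mU UC] := pU.
have gA x : 0 <= x -> `|g x| <= 2 * A * P * expR (beta / 4 * x).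
  move=> x0.
  have := @volterra_stability R U C beta mU C0 beta0 UC 0 (fun x => (g x)%:C%C) (fun x => (r x)%:C%C) A 0 k00 wg A0.
  move=> /(_ _ _ x x0); rewrite NC => h.
  have {}h := h _ _; apply: (le_trans (h _ _)).
  - by move=> y y0; rewrite V0_real -rmorphD /= -gE.
  - move=> y y0; rewrite NC; apply: (le_trans (rA y y0)).
    rewrite -[leLHS]mulr1 ler_wpM2l// -(mulr1 1).
    by apply: ler_pM => //; [exact: wt_ge1|exact: psi_ge1].
  rewrite -[leRHS]mulrA ler_wpM2l ?mulr_ge0// mulrC /wt ger0_norm//.
  by rewrite ler_wpM2r ?expR_ge0//; exact: psi_le.
move=> x x0; rewrite gE// mulrDl mul1r; apply: (le_trans (ler_normD _ _)).
apply: lerD; first exact: rA.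
have mg : mlb g by case: wg => -[].
have mh : mlb (fun y => U y * g y) by apply: mlbM => //; exact: potential_mlb.
have M0 : 0 <= C * (2 * A * P) by apply: mulr_ge0 => //; apply: mulr_ge0 => //; apply: mulr_ge0.
have [] := @J_linear_bound (3 * beta / 4) (fun y => U y * g y) x (C * (2 * A * P)) c0 mh x0 M0.
  move=> y y0; rewrite normrM.
  have -> : C * (2 * A * P) * expR (- (3 * beta / 4 * y)) =
    C * expR (- (beta * y)) * (2 * A * P * expR (beta / 4 * y)).
    have -> : - (3 * beta / 4 * y) = - (beta * y) + beta / 4 * y by field.
    by rewrite expRD; ring.
  by apply: ler_pM => //; [exact: potential_pos|exact: gA].
move=> _; under eq_fun do rewrite mulrA.
by move=> /le_trans; apply; rewrite /K' le_eqVlt; apply/orP; left; apply/eqP; field; rewrite gt_eqF.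
Qed.

Lemma real_jost_bound : exists2 B, 0 <= B & forall U w w',
  potential U -> real_jost U w w' ->
  forall x, 0 <= x -> `|w x| <= B /\ `|w' x| <= B * expR (- (beta * x)).
Proof.
have [K K0 HK] := volterra_bounded.
exists (K + C * K / beta).
  by rewrite addr_ge0// divr_ge0 ?mulr_ge0// ltW.
move=> U w w' pU rj.
have CK : 0 <= C * K / beta by rewrite divr_ge0 ?mulr_ge0// ltW.
have wK x : 0 <= x -> `|w x| <= K.
  have := @HK U w (fun=> 1) 1 pU (rj_sol rj).1 ler01; rewrite mulr1; apply => //.
  - by move=> y _; exact: rj_eq rj y.
  - by move=> y _; rewrite normr1.
move=> x x0; split; first by apply: (le_trans (wK x x0)); rewrite lerDl.
rewrite (rj_eq' rj) normrN.
have mm : mlb (fun y => U y * w y).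
  by apply: mlbM; [exact: potential_mlb|exact: prim_mlb (rj_prim rj)].
apply: (@le_trans _ _ (C * K / beta * expR (- (beta * x)))); last first.
  by rewrite ler_wpM2r ?expR_ge0// lerDr.
apply: J_bound => //; first by case: mm.
move=> y xy; have y0 := le_trans x0 xy; rewrite normrM [leRHS]mulrAC.
by apply: ler_pM => //; [exact: potential_pos|exact: wK].
Qed.

End RealZeroEnergy.

(** * Expansion on a half-line *)

Section HalfLine.
Context {R : realType}.
Implicit Types (x y A : R) (U w u g r f : R -> R).
Context (C beta : R) (C0 : 0 <= C) (beta0 : 0 < beta).

Let E y : R := expR (- (beta * y)).

Let E0 y : 0 <= E y. Proof. exact: expR_ge0. Qed.

Let E_le1 y : 0 <= y -> E y <= 1.
Proof. by move=> y0; rewrite /E -expR0 ler_expR oppr_le0 mulr_ge0// ltW. Qed.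

Lemma dec_prod (f g : R -> R) (M M' : R) y : `|f y| <= M -> `|g y| <= M' * E y ->
  `|f y * g y| <= M * M' * E y.
Proof. by move=> h1 h2; rewrite normrM -mulrA; apply: ler_pM. Qed.

Lemma dec_le (a M : R) y : 0 <= y -> 0 <= M -> `|a| <= M * E y -> `|a| <= M.
Proof.
move=> y0 M0 /le_trans; apply.
by rewrite -[leRHS]mulr1 ler_wpM2l// E_le1.
Qed.

(** [S] and [Q] are abstract: only S' = qe, Q' = S and their sizes e and e^2 matter. K depends on
    [C] and [beta] alone and so serves every e. *)
Lemma half_line_expansion : exists2 K, 0 <= K &
  forall (qav qe S Q w w' u u' : R -> R) (e : R), 0 <= e -> e <= 1 ->
  potential C beta qav -> potential C beta (fun x => qav x + qe x) ->
  prim S qe -> prim Q S ->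
  (forall x, 0 <= x -> `|S x| <= C * e * expR (- (beta * x))) ->
  (forall x, 0 <= x -> `|Q x| <= C * e ^+ 2 * expR (- (beta * x))) ->
  real_jost C beta qav w w' -> real_jost C beta (fun x => qav x + qe x) u u' ->
  [/\ `|u 0 - w 0| <= K * e ^+ 2,
      `|u' 0 - S 0 * u 0 - w' 0| <= K * e ^+ 2 &
      `|w 0 * (u' 0 - S 0 * u 0 - w' 0) - (u 0 - w 0) * w' 0
        - J (fun x => S x * (2 * (w x * w' x))) 0 - J (fun x => (S x * w x) ^+ 2) 0|
      <= K * e ^+ 3].
Proof.
have [B B0 HB] := real_jost_bound C0 beta0.
have [Kv Kv0 HKv] := volterra_bounded C0 beta0.
have ib : 0 <= beta^-1 by rewrite invr_ge0 ltW.
(* [K1], [Kz], [Ky] bound, in units of e^2, the source [I], the difference u - w and u' - S u - w';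
   [K3] bounds, in units of e^3, the integral of the remainder [Er]. *)
pose K1 := B * C + 2 * B * C / beta + 4 / beta ^+ 2 * (C * B * C).
have K10 : 0 <= K1.
  by rewrite /K1 !addr_ge0// ?mulr_ge0// invr_ge0 exprn_ge0// ltW.
pose Kz := Kv * K1.
have Kz0 : 0 <= Kz by exact: mulr_ge0.
pose Ky := C * Kz / beta + C * B + C * (C * B) / beta.
have Ky0 : 0 <= Ky by rewrite /Ky !addr_ge0// ?mulr_ge0.
pose K3 := C * (B * Kz + B * Ky + C * (Kz * B)) / beta.
have K30 : 0 <= K3 by rewrite /K3 !mulr_ge0// !addr_ge0// !mulr_ge0.
exists (Kz + Ky + K3); first by apply: addr_ge0 => //; apply: addr_ge0.
move=> qav qe S Q w w' u u' e e0 e1 pqav pU pS pQ bS bQ jw ju.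
have mqav := potential_mlb C0 beta0 pqav.
have mU := potential_mlb C0 beta0 pU.
have mqe := prim_mlb_d pS.
have mS := prim_mlb pS. have mQ := prim_mlb pQ.
have pw := rj_prim jw. have pw' := rj_prim' jw.
have pu := rj_prim ju. have pu' := rj_prim' ju.
have mw := prim_mlb pw. have mw' := prim_mlb pw'.
have mu := prim_mlb pu. have mu' := prim_mlb pu'.
have bw x : 0 <= x -> `|w x| <= B by move=> x0; case: (HB _ _ _ pqav jw x x0).
have bw' x : 0 <= x -> `|w' x| <= B * E x by move=> x0; case: (HB _ _ _ pqav jw x x0).
have bu x : 0 <= x -> `|u x| <= B by move=> x0; case: (HB _ _ _ pU ju x x0).
have bu' x : 0 <= x -> `|u' x| <= B * E x by move=> x0; case: (HB _ _ _ pU ju x x0).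
have bqav x : 0 <= x -> `|qav x| <= C * E x by move=> x0; exact: (potential_pos pqav x0).
have bU x : 0 <= x -> `|qav x + qe x| <= C * E x by move=> x0; exact: (potential_pos pU x0).
have bqe x : 0 <= x -> `|qe x| <= 2 * C * E x.
  move=> x0; have -> : qe x = (qav x + qe x) - qav x by ring.
  apply: (le_trans (ler_normB _ _)).
  by rewrite -mulrA mulrDl mul1r lerD// ?bU// bqav.
have Ce0 : 0 <= C * e by exact: mulr_ge0.
have e20 : 0 <= e ^+ 2 by exact: exprn_ge0.
have Ce20 : 0 <= C * e ^+ 2 by exact: mulr_ge0.
have bS' x : 0 <= x -> `|S x| <= C * e by move=> x0; apply: (dec_le x0) => //; exact: bS.
have bQ' x : 0 <= x -> `|Q x| <= C * e ^+ 2 by move=> x0; apply: (dec_le x0) => //; exact: bQ.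
have b2 : 0 < beta / 2 by rewrite divr_gt0.
pose u2 x := (qav x + qe x) * u x.
have mu2 : mlb u2 by apply: mlbM.
have bu2 x : 0 <= x -> `|u2 x| <= C * B * E x.
  move=> x0; rewrite /u2 normrM mulrAC; apply: ler_pM => //; [exact: bU|exact: bu].
have bu2' x : 0 <= x -> `|u2 x| <= C * B.
  by move=> x0; apply: (dec_le x0); [exact: mulr_ge0|exact: bu2].
(* The source term of the Volterra equation for [u - w]; it is [O(e ^+ 2)]
   because [qe] is the second derivative of [Q]. *)
pose I x := J (fun y => (y - x) * (qe y * u y)) x.
have t1 x : 0 <= x -> tail (beta / 2) (fun y => (y - x) * (qe y * u y)).
  move=> x0; have [] // := @J_linear_bound R beta (fun y => qe y * u y) x (2 * C * B) beta0 _ x0 _ _.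
  - exact: mlbM.
  - by rewrite !mulr_ge0.
  - by move=> y y0; rewrite normrM mulrAC; apply: ler_pM => //; [exact: bqe|exact: bu].
have bu2Q y : 0 <= y -> `|u2 y * Q y| <= C * B * C * e ^+ 2 * E y.
  by move=> y0; rewrite -(mulrA (C * B)); apply: dec_prod; [exact: bu2'|exact: bQ].
have M2 : 0 <= C * B * C * e ^+ 2 by rewrite !mulr_ge0.
have Jl x : 0 <= x -> tail (beta / 2) (fun y => (y - x) * (u2 y * Q y)) /\
   `|J (fun y => (y - x) * (u2 y * Q y)) x| <= 4 / beta ^+ 2 * (C * B * C * e ^+ 2).
  by move=> x0; apply: J_linear_bound => //; exact: mlbM.
have bu'Q y : 0 <= y -> `|2 * (u' y * Q y)| <= 2 * B * C * e ^+ 2 * E y.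
  move=> y0; rewrite normrM ger0_norm// -!mulrA ler_wpM2l// mulrCA.
  have := @dec_prod Q u' (C * e ^+ 2) B y (bQ' _ y0) (bu' _ y0).
  by rewrite (mulrC (Q y)) => /le_trans; apply; rewrite le_eqVlt; apply/orP; left; apply/eqP; ring.
have mu'Q : mlb (fun y => 2 * (u' y * Q y)) by apply: mlbZ; exact: mlbM.
have M3 : 0 <= 2 * B * C * e ^+ 2 by rewrite !mulr_ge0.
have tb (f : R -> R) M : 0 <= M -> mlb f -> (forall y, 0 <= y -> `|f y| <= M * E y) -> tail beta f.
  by move=> M0 mf; exact: tail_intro.
have t3 : tail beta (fun y => 2 * (u' y * Q y)) by apply: tb bu'Q.
have IE x : 0 <= x -> I x = u x * Q x + J (fun y => 2 * (u' y * Q y)) x +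
    J (fun y => (y - x) * (u2 y * Q y)) x.
  move=> x0.
  (* Two integrations by parts move both derivatives of Q'' = qe onto (y - x) u y and produce [G];
     at y = x it equals - u x * Q x. *)
  pose G y := (y - x) * (u y * S y - u' y * Q y) - u y * Q y.
  have pG : prim G (fun y => (y - x) * (qe y * u y) - (2 * (u' y * Q y) + (y - x) * (u2 y * Q y))).
    have p1 := primB (primM pu pS) (primM pu' pQ).
    have p2 := primM (primB (@prim_id R) (prim_cst x)) p1.
    apply: eq_prim (primB p2 (primM pu pQ)) => y.
    by rewrite /u2; ring.
  have [tl _] := Jl x x0.
  have tG : tail (beta / 2) (fun y => (y - x) * (qe y * u y) - (2 * (u' y * Q y) + (y - x) * (u2 y * Q y))).
    by apply: tailB; [exact: t1|apply: tailD => //; exact: tail_half].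
  pose MG := B * (C * e) + C * e ^+ 2 * B.
  have MG0 : 0 <= MG by rewrite /MG addr_ge0// !mulr_ge0.
  have bh y : 0 <= y -> `|u y * S y - u' y * Q y| <= MG * E y.
    move=> y0; apply: (le_trans (ler_normB _ _)); rewrite /MG mulrDl; apply: lerD.
      by apply: dec_prod; [exact: bu|exact: bS].
    by rewrite mulrC; apply: dec_prod; [exact: bQ'|exact: bu'].
  have bl := linear_factor_bound beta0 x0 MG0 bh.
  have GE : G x = - J (fun y => (y - x) * (qe y * u y) - (2 * (u' y * Q y) + (y - x) * (u2 y * Q y))) x.
    apply: (@prim_J R (beta / 2) G _ x (2 / beta * MG + B * (C * e ^+ 2)) b2 tG pG) => y xy.
    rewrite mulrDl; apply: (le_trans (ler_normB _ _)); apply: lerD; first exact: bl.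
    have y0 := le_trans x0 xy.
    have := @dec_prod u Q B (C * e ^+ 2) y (bu _ y0) (bQ _ y0).
    move=> /le_trans; apply; rewrite ler_wpM2l ?mulr_ge0// /E ler_expR lerN2 ler_wpM2r//.
    by rewrite ler_pdivrMr// ler_peMr ?ler1n// ltW.
  have t3' := tail_half beta0 t3.
  move: GE; rewrite (JB x b2 (t1 x x0) (tailD t3' tl)) (JD x b2 t3' tl) -/(I x) /G subrr mul0r.
  by clear; lra.
have bI x : 0 <= x -> `|I x| <= K1 * e ^+ 2.
  move=> x0; rewrite IE//.
  have [_ h3] := Jl x x0.
  have h1 : `|u x * Q x| <= B * (C * e ^+ 2).
    by rewrite normrM; apply: ler_pM => //; [exact: bu|exact: bQ'].
  have h2 : `|J (fun y => 2 * (u' y * Q y)) x| <= 2 * B * C * e ^+ 2 / beta.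
    have h : `|J (fun y => 2 * (u' y * Q y)) x| <= 2 * B * C * e ^+ 2 / beta * E x.
      apply: J_bound => //; first by case: mu'Q.
      by move=> y xy; apply: bu'Q; exact: le_trans xy.
    by apply: (dec_le x0) h; rewrite mulr_ge0.
  have -> : K1 * e ^+ 2 = B * (C * e ^+ 2) + 2 * B * C * e ^+ 2 / beta +
     4 / beta ^+ 2 * (C * B * C * e ^+ 2) by rewrite /K1; ring.
  by do 2 (apply: (le_trans (ler_normD _ _)); apply: lerD => //).
pose z x := u x - w x.
have mz : mlb z by exact: mlbB.
have tlin (a b : R -> R) x (Mb : R) : 0 <= x -> 0 <= Mb -> mlb a -> mlb b ->
    (forall y, 0 <= y -> `|a y| <= C * E y) -> (forall y, 0 <= y -> `|b y| <= Mb) ->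
    tail (beta / 2) (fun y => (y - x) * (a y * b y)).
  move=> x0 Mb0 ma mb ha hb; have [] // := @J_linear_bound R beta (fun y => a y * b y) x (C * Mb) beta0 _ x0 _ _.
  - exact: mlbM.
  - exact: mulr_ge0.
  - by move=> y y0; rewrite normrM mulrAC; apply: ler_pM => //; [exact: ha|exact: hb].
have bz' y : 0 <= y -> `|z y| <= B + B.
  by move=> y0; apply: (le_trans (ler_normB _ _)); apply: lerD; [exact: bu|exact: bw].
have BB0 : 0 <= B + B by exact: addr_ge0.
(* Subtracting the equations of u and w leaves q_av as the potential and [I] as the source. *)
have zE x : 0 <= x -> z x = I x + J (fun y => (y - x) * qav y * z y) x.
  move=> x0.
  have tu := tlin _ _ x B x0 B0 mU mu bU bu.
  have tw := tlin _ _ x B x0 B0 mqav mw bqav bw.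
  have tz := tlin _ _ x (B + B) x0 BB0 mqav mz bqav bz'.
  have -> : J (fun y => (y - x) * qav y * z y) x = J (fun y => (y - x) * (qav y * z y)) x.
    by apply: eq_J => y _; rewrite mulrA.
  have uE : u x = 1 + J (fun y => (y - x) * ((qav y + qe y) * u y)) x.
    by rewrite (rj_eq ju); congr (_ + _); apply: eq_J => y _; rewrite mulrA.
  have wE : w x = 1 + J (fun y => (y - x) * (qav y * w y)) x.
    by rewrite (rj_eq jw); congr (_ + _); apply: eq_J => y _; rewrite mulrA.
  rewrite /z uE wE opprD addrACA subrr add0r -(JB x b2 tu tw) /I -(JD x b2 (t1 x x0) tz).
  by apply: eq_J => y _; rewrite /z; ring.
have bz x : 0 <= x -> `|z x| <= Kz * e ^+ 2.
  move=> x0.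
  have wz : wbd C beta (fun x => (z x)%:C%C).
    have := wbdB (rj_sol ju).1 (rj_sol jw).1.
    by congr wbd; apply/funext => y; rewrite /z rmorphB.
  rewrite /Kz -mulrA; apply: (HKv qav z I) => //.
  exact: mulr_ge0.
pose yy x := u' x - S x * u x - w' x.
have Kze : 0 <= Kz * e ^+ 2 by exact: mulr_ge0.
have bqz y : 0 <= y -> `|qav y * z y| <= C * (Kz * e ^+ 2) * E y.
  by move=> y0; rewrite normrM mulrAC; apply: ler_pM => //; [exact: bqav|exact: bz].
have mqz : mlb (fun y => qav y * z y) by exact: mlbM.
have tqz : tail beta (fun y => qav y * z y) by apply: tb mqz bqz; exact: mulr_ge0.
have tqeu : tail beta (fun y => qe y * u y).
  apply: (tb _ (2 * C * B)); [by rewrite !mulr_ge0|exact: mlbM|].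
  by move=> y y0; rewrite normrM mulrAC; apply: ler_pM => //; [exact: bqe|exact: bu].
have mu2Q : mlb (fun y => u2 y * Q y) by exact: mlbM.
have tu2Q : tail beta (fun y => u2 y * Q y) by apply: tb mu2Q bu2Q.
(* Subtracting S u removes the boundary term of order e from the integral of qe u; every remaining
   term contains Q or z. *)
have yE x : 0 <= x -> yy x = - J (fun y => qav y * z y) x - Q x * u' x - J (fun y => u2 y * Q y) x.
  move=> x0.
  have p : prim (fun y => S y * u y - Q y * u' y) (fun y => qe y * u y - u2 y * Q y).
    by apply: eq_prim (primB (primM pS pu) (primM pQ pu')) => y; rewrite /u2; ring.
  have h := @prim_J R beta _ _ x (C * e * B + C * e ^+ 2 * B) beta0 (tailB tqeu tu2Q) p.
  have {}h : S x * u x - Q x * u' x = - J (fun y => qe y * u y - u2 y * Q y) x.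
    apply: h => y xy; have y0 := le_trans x0 xy.
    rewrite mulrDl; apply: (le_trans (ler_normB _ _)); apply: lerD.
      by rewrite normrM mulrAC; apply: ler_pM => //; [exact: bS|exact: bu].
    by apply: dec_prod; [exact: bQ'|exact: bu'].
  move: h; rewrite (JB x beta0 tqeu tu2Q) => h.
  have tU : tail beta u2 by apply: tb bu2 => //; exact: mulr_ge0.
  have tqw : tail beta (fun y => qav y * w y).
    apply: (tb _ (C * B)); [exact: mulr_ge0|exact: mlbM|].
    by move=> y y0; rewrite normrM mulrAC; apply: ler_pM => //; [exact: bqav|exact: bw].
  have e2 : J u2 x - J (fun y => qav y * w y) x = J (fun y => qav y * z y) x + J (fun y => qe y * u y) x.
    rewrite -(JB x beta0 tU tqw) -(JD x beta0 tqz tqeu).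
    by apply: eq_J => y _; rewrite /u2 /z; ring.
  have e3 : u' x = - J u2 x by exact: rj_eq' ju x.
  have e4 : w' x = - J (fun y => qav y * w y) x by exact: rj_eq' jw x.
  rewrite /yy e4 e3; rewrite e3 in h; move: h e2; clear; lra.
have byy x : 0 <= x -> `|yy x| <= Ky * e ^+ 2 * E x.
  move=> x0; rewrite yE//.
  have h1 : `|J (fun y => qav y * z y) x| <= C * (Kz * e ^+ 2) / beta * E x.
    apply: J_bound => //; first by case: mqz.
    by move=> y xy; apply: bqz; exact: le_trans xy.
  have h2 : `|Q x * u' x| <= C * e ^+ 2 * B * E x.
    by apply: dec_prod; [exact: bQ'|exact: bu'].
  have h3 : `|J (fun y => u2 y * Q y) x| <= C * B * C * e ^+ 2 / beta * E x.
    apply: J_bound => //; first by case: mu2Q.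
    by move=> y xy; apply: bu2Q; exact: le_trans xy.
  have -> : Ky * e ^+ 2 * E x = C * (Kz * e ^+ 2) / beta * E x + C * e ^+ 2 * B * E x +
     C * B * C * e ^+ 2 / beta * E x by rewrite /Ky; ring.
  apply: (le_trans (ler_normB _ _)); apply: lerD => //.
  by apply: (le_trans (ler_normB _ _)); rewrite normrN; apply: lerD.
have KK : Kz <= Kz + Ky + K3 /\ Ky <= Kz + Ky + K3 /\ K3 <= Kz + Ky + K3.
  by move: Kz0 Ky0 K30; clear; move: (Kz) Ky K3 => a b c *; do !split; lra.
case: KK => KK1 [KK2 KK3].
have l0 : (0 : R) <= 0 by [].
split.
- by apply: (le_trans (bz 0 l0)); rewrite ler_wpM2r.
- apply: (@le_trans _ _ (Ky * e ^+ 2)); last by rewrite ler_wpM2r.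
  by apply: (dec_le l0) (byy 0 l0); exact: mulr_ge0.
pose D x := w x * (u' x - S x * u x) - u x * w' x.
have pD : prim D (fun x => - (S x * (w' x * u x + w x * u' x))).
  have p := primB (primM pw (primB pu' (primM pS pu))) (primM pu pw').
  by apply: eq_prim p => x; ring.
have mww : mlb (fun x => S x * (w' x * u x + w x * u' x)).
  by apply: mlbM => //; apply: mlbD; exact: mlbM.
have bww x : 0 <= x -> `|w' x * u x + w x * u' x| <= 2 * B * B.
  move=> x0; apply: (le_trans (ler_normD _ _)).
  have -> : 2 * B * B = B * B + B * B by ring.
  apply: lerD; rewrite normrM; apply: ler_pM => //; [|exact: bu|exact: bw|].
    by apply: (dec_le x0) => //; exact: bw'.
  by apply: (dec_le x0) => //; exact: bu'.
have tww : tail beta (fun x => S x * (w' x * u x + w x * u' x)).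
  apply: (tb _ (C * e * (2 * B * B))) => //; first by rewrite !mulr_ge0.
  by move=> x x0; rewrite normrM mulrAC; apply: ler_pM => //; [exact: bS|exact: bww].
have DE : D 0 = J (fun x => S x * (w' x * u x + w x * u' x)) 0.
  rewrite -[RHS]opprK -(JN _ beta0 tww).
  apply: (@prim_J R beta D _ 0 (B * B + B * (C * e * B) + B * B) beta0 (tailN tww) pD) => y y0.
  have -> : D y = w y * u' y - w y * (S y * u y) - u y * w' y by rewrite /D; ring.
  rewrite !mulrDl.
  apply: (le_trans (ler_normB _ _)); apply: lerD; last by apply: dec_prod; [exact: bu|exact: bw'].
  apply: (le_trans (ler_normB _ _)); apply: lerD; first by apply: dec_prod; [exact: bw|exact: bu'].
  apply: (@dec_prod w (fun y => S y * u y)); first exact: bw.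
  by rewrite normrM mulrAC; apply: ler_pM => //; [exact: bS|exact: bu].
have m1 : mlb (fun x => S x * (2 * (w x * w' x))) by apply: mlbM => //; apply: mlbZ; exact: mlbM.
have b1 x : 0 <= x -> `|2 * (w x * w' x)| <= 2 * (B * B).
  move=> x0; rewrite normrM ger0_norm// ler_wpM2l// normrM; apply: ler_pM => //; first exact: bw.
  by apply: (dec_le x0) => //; exact: bw'.
have tt1 : tail beta (fun x => S x * (2 * (w x * w' x))).
  apply: (tb _ (C * e * (2 * (B * B)))) => //; first by rewrite !mulr_ge0.
  by move=> x x0; rewrite normrM mulrAC; apply: ler_pM => //; [exact: bS|exact: b1].
have m2 : mlb (fun x => (S x * w x) ^+ 2).
  by under eq_fun do rewrite expr2; apply: mlbM; exact: mlbM.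
have b2' x : 0 <= x -> `|(S x * w x) ^+ 2| <= C * e * B * (C * e * B) * E x.
  move=> x0; rewrite expr2.
  have h : `|S x * w x| <= C * e * B * E x.
    by rewrite normrM mulrAC; apply: ler_pM => //; [exact: bS|exact: bw].
  rewrite normrM -mulrA; apply: ler_pM => //.
  by apply: (dec_le x0) h; rewrite !mulr_ge0.
have tt2 : tail beta (fun x => (S x * w x) ^+ 2).
  by apply: tb b2' => //; rewrite !mulr_ge0.
(* Remainder of S (w u)' after its two main terms, when u = w + z and u' = w' + S u + yy are
   inserted: each summand has a factor z or yy besides S. *)
pose Er x := S x * (w' x * z x + w x * yy x + S x * (z x * w x)).
have mEr : mlb Er.
  apply: mlbM => //; apply: mlbD; last by apply: mlbM => //; exact: mlbM.
  apply: mlbD; apply: mlbM => //.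
  by apply: mlbB => //; apply: mlbB => //; exact: mlbM.
have bEr x : 0 <= x -> `|Er x| <= C * (B * Kz + B * Ky + C * (Kz * B)) * e ^+ 3 * E x.
  move=> x0; rewrite /Er normrM.
  have h1 : `|w' x * z x| <= B * (Kz * e ^+ 2).
    rewrite normrM; apply: ler_pM => //; last exact: bz.
    by apply: (dec_le x0) => //; exact: bw'.
  have h2 : `|w x * yy x| <= B * (Ky * e ^+ 2).
    rewrite normrM; apply: ler_pM => //; first exact: bw.
    by apply: (dec_le x0 _ (byy x x0)); exact: mulr_ge0.
  have h3 : `|S x * (z x * w x)| <= C * (Kz * e ^+ 2 * B).
    rewrite normrM; apply: ler_pM => //.
      by apply: (le_trans (bS' x x0)); rewrite -[leRHS]mulr1 ler_wpM2l.
    by rewrite normrM; apply: ler_pM => //; [exact: bz|exact: bw].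
  have -> : C * (B * Kz + B * Ky + C * (Kz * B)) * e ^+ 3 * E x =
     C * e * E x * (B * (Kz * e ^+ 2) + B * (Ky * e ^+ 2) + C * (Kz * e ^+ 2 * B)) by ring.
  apply: ler_pM => //; first exact: bS.
  by do 2 (apply: (le_trans (ler_normD _ _)); apply: lerD => //).
have e30 : 0 <= e ^+ 3 by exact: exprn_ge0.
have ME : 0 <= C * (B * Kz + B * Ky + C * (Kz * B)) * e ^+ 3.
  by rewrite mulr_ge0// mulr_ge0// !addr_ge0// !mulr_ge0.
have tEr : tail beta Er by apply: tb mEr bEr.
have -> : w 0 * (u' 0 - S 0 * u 0 - w' 0) - (u 0 - w 0) * w' 0 = D 0 by rewrite /D; ring.
have -> : D 0 = J (fun x => S x * (2 * (w x * w' x))) 0 + J (fun x => (S x * w x) ^+ 2) 0 + J Er 0.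
  rewrite DE -(JD 0 beta0 tt1 tt2) -(JD 0 beta0 (tailD tt1 tt2) tEr).
  by apply: eq_J => x _; rewrite /Er /yy /z; ring.
rewrite -addrA -opprD addrC addKr.
apply: (@le_trans _ _ (K3 * e ^+ 3)); last by rewrite ler_wpM2r.
have -> : K3 * e ^+ 3 = C * (B * Kz + B * Ky + C * (Kz * B)) * e ^+ 3 / beta * 1.
  by rewrite /K3; ring.
have h : `|J Er 0| <= C * (B * Kz + B * Ky + C * (Kz * B)) * e ^+ 3 / beta * E 0.
  by apply: J_bound => //; case: mEr.
rewrite mulr1; apply: (dec_le l0) h.
by rewrite mulr_ge0.
Qed.

End HalfLine.

(** * Oscillating integrals *)

Section Modes.
Context {R : realType}.
Implicit Types (x y M : R) (A B F f g : R -> R) (k : nat) (om : R).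

(* [F] and its first [k] derivatives decay at rate [b], the last one in the sense
   of [prim] only. *)
Fixpoint wk k (b M : R) F : Prop :=
  (forall x, `|F x| <= M * expR (- (b * `|x|))) /\
  if k is k'.+1 then exists2 F', prim F F' & wk k' b M F' else mlb F.

Lemma wk_bound k b M F x : wk k b M F -> `|F x| <= M * expR (- (b * `|x|)).
Proof. by case: k => [|k] []. Qed.

Lemma wk_ge0 k b M F : wk k b M F -> 0 <= M.
Proof.
move=> /(wk_bound 0); rewrite normr0 mulr0 oppr0 expR0 mulr1.
exact: le_trans.
Qed.

Lemma wk_mlb k b M F : wk k b M F -> mlb F.
Proof. by case: k => [[]//|k [_ [F' /prim_mlb]]]. Qed.

Lemma wk_succ k b M F : wk k.+1 b M F -> wk k b M F.
Proof.
elim: k b M F => [|k IH] b M F [bF [F' pF wF']].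
  by split => //; exact: prim_mlb pF.
by split => //; exists F' => //; exact: IH.
Qed.

Lemma wk_leq j k b M F : (j <= k)%N -> wk k b M F -> wk j b M F.
Proof.
elim: k => [|k IH]; first by rewrite leqn0 => /eqP ->.
by rewrite leq_eqVlt => /predU1P[-> //|jk] /wk_succ; exact: IH.
Qed.

Lemma wk_le k b M M' F : M <= M' -> wk k b M F -> wk k b M' F.
Proof.
move=> MM; elim: k F => [|k IH] F [bF H].
  by split => // x; apply: (le_trans (bF x)); rewrite ler_wpM2r ?expR_ge0.
split; first by move=> x; apply: (le_trans (bF x)); rewrite ler_wpM2r ?expR_ge0.
by case: H => F' pF wF'; exists F' => //; exact: IH.
Qed.

Lemma wkD k b M M' F G : wk k b M F -> wk k b M' G -> wk k b (M + M') (fun x => F x + G x).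
Proof.
elim: k F G => [|k IH] F G [bF H] [bG H'].
  split; last exact: mlbD.
  by move=> x; rewrite mulrDl; apply: (le_trans (ler_normD _ _)); exact: lerD.
split; first by move=> x; rewrite mulrDl; apply: (le_trans (ler_normD _ _)); exact: lerD.
case: H => F' pF wF'; case: H' => G' pG wG'.
by exists (fun x => F' x + G' x); [exact: primD|exact: IH].
Qed.

Lemma wkZ k b M c F : wk k b M F -> wk k b (`|c| * M) (fun x => c * F x).
Proof.
elim: k F => [|k IH] F [bF H].
  by split; [move=> x; rewrite normrM -mulrA ler_wpM2l|exact: mlbZ].
split; first by move=> x; rewrite normrM -mulrA ler_wpM2l.
case: H => F' pF wF'.
by exists (fun x => c * F' x); [exact: primZ|exact: IH].
Qed.

Lemma wkN k b M F : wk k b M F -> wk k b M (fun x => - F x).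
Proof.
move=> /(wkZ (-1)); rewrite normrN1 mul1r; congr wk.
by apply/funext => x; rewrite mulN1r.
Qed.

Lemma wk_oppx k b M F : wk k b M F -> wk k b M (fun x => F (- x)).
Proof.
elim: k F => [|k IH] F [bF H].
  by split; [move=> x; have := bF (- x); rewrite normrN|exact: mlb_oppx].
split; first by move=> x; have := bF (- x); rewrite normrN.
case: H => F' pF wF'.
by exists (fun x => - F' (- x)); [exact: prim_oppx|apply/wkN/IH].
Qed.

(** Leibniz rule: each derivative doubles the constant. The second factor need only be bounded,
    hence the rate 0. *)
Lemma wkM k b M M' F G : wk k b M F -> wk k 0 M' G -> wk k b (2 ^+ k * (M * M')) (fun x => F x * G x).
Proof.
have bnd j F1 G1 : wk j b M F1 -> wk j 0 M' G1 -> forall x, `|F1 x * G1 x| <= M * M' * expR (- (b * `|x|)).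
  move=> wF wG x; rewrite normrM mulrAC; apply: ler_pM => //; first exact: (wk_bound _ wF).
  by have := wk_bound x wG; rewrite mul0r oppr0 expR0 mulr1.
elim: k F G => [|k IH] F G wF wG.
  rewrite expr0 mul1r; split; first exact: (bnd 0%N).
  by case: wF => _ mF; case: wG => _ mG; exact: mlbM.
have MM : 0 <= M * M' by rewrite mulr_ge0 ?(wk_ge0 wF) ?(wk_ge0 wG).
split.
  move=> x; apply: (le_trans (bnd _ _ _ wF wG x)).
  rewrite ler_wpM2r ?expR_ge0// ler_peMl// exprn_ege1// ler1n//.
case: (wF) => _ [F' pF wF']; case: (wG) => _ [G' pG wG'].
exists (fun x => F' x * G x + F x * G' x); first exact: primM.
rewrite exprS -mulrA mulrDl mul1r.
by apply: wkD; apply: IH => //; exact: wk_succ.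
Qed.

Lemma wk_weaken k b M F : 0 <= b -> wk k b M F -> wk k 0 M F.
Proof.
move=> b0; elim: k F => [|k IH] F wF.
  split; last by case: wF.
  move=> x; apply: (le_trans (wk_bound x wF)).
  rewrite ler_wpM2l ?(wk_ge0 wF)// ler_expR mul0r lerN2.
  by rewrite mulr_ge0.
split.
  move=> x; apply: (le_trans (wk_bound x wF)).
  by rewrite ler_wpM2l ?(wk_ge0 wF)// ler_expR mul0r lerN2 mulr_ge0.
by case: wF => _ [F' pF wF']; exists F' => //; exact: IH.
Qed.

(** A real Fourier mode of frequency [om] with amplitudes [A] and [B] that do not depend on [om]. *)
Definition md A B om x : R := A x * cos (om * x) + B x * sin (om * x).

Lemma mlb_md A B om : mlb A -> mlb B -> mlb (md A B om).
Proof.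
move=> mA mB; apply: mlbD; apply: mlbM => //.
  exact: prim_mlb (prim_cosM om).
exact: prim_mlb (prim_sinM om).
Qed.

Lemma md_le A B om x a b : `|A x| <= a -> `|B x| <= b -> `|md A B om x| <= a + b.
Proof.
move=> Aa Bb; apply: (le_trans (ler_normD _ _)); apply: lerD; rewrite normrM.
  rewrite -[leRHS]mulr1; apply: ler_pM => //.
  by rewrite ler_norml; apply/andP; split; [exact: cos_geN1|exact: cos_le1].
rewrite -[leRHS]mulr1; apply: ler_pM => //.
by rewrite ler_norml; apply/andP; split; [exact: sin_geN1|exact: sin_le1].
Qed.

Lemma md_wk_le k b M A B om x : wk k b M A -> wk k b M B ->
  `|md A B om x| <= 2 * M * expR (- (b * `|x|)).
Proof.
move=> wA wB.
have -> : 2 * M * expR (- (b * `|x|)) = M * expR (- (b * `|x|)) + M * expR (- (b * `|x|)) by ring.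
by apply: md_le; [exact: (wk_bound _ wA)|exact: (wk_bound _ wB)].
Qed.

(** The shift by a quarter period, (A, B) -> (- B, A), is om times an antiderivative up to a mode
    with differentiated amplitudes. Each use therefore gains a factor 1 / om at the cost of one
    derivative. *)
Lemma prim_md A B A' B' om : prim A A' -> prim B B' ->
  prim (md (fun x => - B x) A om) (fun x => md (fun x => - B' x) A' om x + om * md A B om x).
Proof.
move=> pA pB.
apply: eq_prim (primD (primM (primN pB) (prim_cosM om)) (primM pA (prim_sinM om))) => x.
by rewrite /md; ring.
Qed.

Lemma mdM A B A' B' om om' x : md A B om x * md A' B' om' x =
  md (fun x => (A x * A' x + B x * B' x) / 2) (fun x => (B x * A' x - A x * B' x) / 2) (om - om') x +
  md (fun x => (A x * A' x - B x * B' x) / 2) (fun x => (A x * B' x + B x * A' x) / 2) (om + om') x.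
Proof.
rewrite /md.
have -> : (om - om') * x = om * x - om' * x by ring.
have -> : (om + om') * x = om * x + om' * x by ring.
by rewrite cosB sinB cosD sinD; field.
Qed.

Section Decay.
Context (b : R) (b0 : 0 < b).

Lemma expR_normN_le x : expR (- (b * `|x|)) <= expR (- (b * x)).
Proof. by rewrite ler_expR lerN2 ler_wpM2l ?ler_norm// ltW. Qed.

Lemma tail_dec M f : 0 <= M -> mlb f ->
  (forall x, `|f x| <= M * expR (- (b * `|x|))) -> tail b f.
Proof.
move=> M0 mf HM; split; first by case: mf.
move=> x; exists M => y _; apply: (le_trans (HM y)).
by rewrite ler_wpM2l// expR_normN_le.
Qed.

Lemma J_dec M f x : 0 <= M -> mlb f ->
  (forall x, `|f x| <= M * expR (- (b * `|x|))) -> `|J f x| <= M / b * expR (- (b * x)).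
Proof.
move=> M0 mf HM; apply: J_bound => //; first by case: mf.
by move=> y _; apply: (le_trans (HM y)); rewrite ler_wpM2l// expR_normN_le.
Qed.

(** Both sides are the integral over the whole line, cut at 0 and at - x respectively. *)
Lemma J_reflect M f x : 0 <= M -> mlb f ->
  (forall x, `|f x| <= M * expR (- (b * `|x|))) ->
  J f 0 + J (fun y => f (- y)) 0 = J f (- x) + J (fun y => f (- y)) x.
Proof.
move=> M0 mf HM.
have mo := mlb_oppx mf.
have HMo y : `|f (- y)| <= M * expR (- (b * `|y|)) by have := HM (- y); rewrite normrN.
have p1 := prim_oppx (J_prim b0 (tail_dec M0 mf HM)).
have p2 := J_prim b0 (tail_dec M0 mo HMo).
have p : prim (fun x => J f (- x) + J (fun y => f (- y)) x) (fun=> 0).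
  by apply: eq_prim (primD p1 p2) => y; rewrite opprK subrr.
by have := prim0 p 0 x; rewrite oppr0.
Qed.

(** For x < 0 the tail is the integral over the line minus the reflected tail from - x: three
    integrals over right half-lines, whence the factor 3. *)
Lemma J_dec_unif M f x : 0 <= M -> mlb f ->
  (forall x, `|f x| <= M * expR (- (b * `|x|))) -> `|J f x| <= 3 * M / b.
Proof.
move=> M0 mf HM.
have Mb : 0 <= M / b by rewrite divr_ge0// ltW.
have pos g y : mlb g -> (forall x, `|g x| <= M * expR (- (b * `|x|))) -> 0 <= y -> `|J g y| <= M / b.
  move=> mg Hg y0; apply: (le_trans (J_dec y M0 mg Hg)).
  rewrite -[leRHS]mulr1 ler_wpM2l// -expR0 ler_expR oppr_le0 mulr_ge0// ltW//.
have -> : 3 * M / b = M / b + M / b + M / b by ring.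
have [x0|/ltW x0] := leP 0 x.
  by apply: (le_trans (pos f x mf HM x0)); rewrite lerDr addr_ge0.
have mo := mlb_oppx mf.
have HMo y : `|f (- y)| <= M * expR (- (b * `|y|)) by have := HM (- y); rewrite normrN.
have := J_reflect (- x) M0 mf HM; rewrite opprK => h.
have -> : J f x = J f 0 + J (fun y => f (- y)) 0 - J (fun y => f (- y)) (- x) by rewrite h; ring.
apply: (le_trans (ler_normB _ _)); apply: lerD; last by apply: pos => //; rewrite oppr_ge0.
by apply: (le_trans (ler_normD _ _)); apply: lerD; apply: pos.
Qed.

Lemma J_md_parts M A B A' B' om x : om != 0 ->
  (forall x, `|A x| <= M * expR (- (b * `|x|))) -> (forall x, `|B x| <= M * expR (- (b * `|x|))) ->
  (forall x, `|A' x| <= M * expR (- (b * `|x|))) -> (forall x, `|B' x| <= M * expR (- (b * `|x|))) ->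
  prim A A' -> prim B B' ->
  J (md A B om) x = - om^-1 * (md (fun x => - B x) A om x + J (md (fun x => - B' x) A' om) x).
Proof.
move=> om0 bA bB bA' bB' pA pB.
have M0 : 0 <= M by have := bA 0; rewrite normr0 mulr0 oppr0 expR0 mulr1; exact: le_trans.
have M20 : 0 <= 2 * M by exact: mulr_ge0.
have b2 F G : (forall x, `|F x| <= M * expR (- (b * `|x|))) -> (forall x, `|G x| <= M * expR (- (b * `|x|))) ->
    forall x, `|md F G om x| <= 2 * M * expR (- (b * `|x|)).
  move=> bF bG y.
  have -> : 2 * M * expR (- (b * `|y|)) = M * expR (- (b * `|y|)) + M * expR (- (b * `|y|)) by ring.
  exact: md_le.
have bNB y : `|- B y| <= M * expR (- (b * `|y|)) by rewrite normrN.
have bNB' y : `|- B' y| <= M * expR (- (b * `|y|)) by rewrite normrN.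
have mA' := prim_mlb_d pA; have mB' := prim_mlb_d pB.
have t1 : tail b (md A B om).
  by apply: tail_dec M20 _ (b2 _ _ bA bB); apply: mlb_md; [exact: prim_mlb pA|exact: prim_mlb pB].
have t2 : tail b (md (fun x => - B' x) A' om).
  by apply: tail_dec M20 _ (b2 _ _ bNB' bA'); apply: mlb_md => //; exact: mlbN.
have p := prim_md om pA pB.
have := @prim_J R b _ _ x (2 * M) b0 (tailD t2 (tailZ om t1)) p.
rewrite (JD x b0 t2 (tailZ om t1)) (JZ om x b0 t1) => ->.
  by field.
move=> y _; apply: (le_trans (b2 _ _ bNB bA y)).
by rewrite ler_wpM2l// expR_normN_le.
Qed.

(** k integrations by parts. All boundary terms sit at x and decay in |x|, so that they disappear as
    x -> -oo and only |om|^-k survives. *)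
Lemma J_md_wk k M A B om x : 1 <= `|om| -> wk k b M A -> wk k b M B ->
  `|J (md A B om) x| <= M * (2 * k%:R * expR (- (b * `|x|)) + 6 / b * `|om|^-1 ^+ k).
Proof.
move=> om1; have om0 : om != 0 by rewrite -normr_gt0; exact: lt_le_trans om1.
have omV : `|om|^-1 <= 1 by rewrite invf_le1// normr_gt0.
have omV0 : 0 <= `|om|^-1 by rewrite invr_ge0.
elim: k A B => [|k IH] A B wA wB.
  have M0 := wk_ge0 wA.
  have -> : M * (2 * 0%:R * expR (- (b * `|x|)) + 6 / b * `|om|^-1 ^+ 0) = 3 * (2 * M) / b.
    by rewrite expr0; ring.
  apply: J_dec_unif; first exact: mulr_ge0.
    by apply: mlb_md; [exact: wk_mlb wA|exact: wk_mlb wB].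
  by move=> y; exact: md_wk_le wA wB.
have M0 := wk_ge0 wA.
case: (wA) => bA [A' pA wA']; case: (wB) => bB [B' pB wB'].
have bA' y := wk_bound y wA'; have bB' y := wk_bound y wB'.
rewrite (@J_md_parts M A B A' B')// normrM normrN normfV.
have h1 := md_wk_le om x (wkN wB) wA.
have h2 := IH _ _ (wkN wB') wA'.
set e := expR (- (b * `|x|)) in h1 h2 *.
have e0 : 0 <= e by exact: expR_ge0.
apply: (@le_trans _ _ (`|om|^-1 * (2 * M * e + M * (2 * k%:R * e + 6 / b * `|om|^-1 ^+ k)))).
  by rewrite ler_wpM2l//; apply: (le_trans (ler_normD _ _)); exact: lerD.
have -> : `|om|^-1 * (2 * M * e + M * (2 * k%:R * e + 6 / b * `|om|^-1 ^+ k)) =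
   `|om|^-1 * (M * (2 * k.+1%:R * e)) + M * (6 / b * `|om|^-1 ^+ k.+1).
  by rewrite exprS -natr1; ring.
rewrite mulrDr lerD2r.
by rewrite -[leRHS]mul1r ler_wpM2r// mulr_ge0// mulr_ge0.
Qed.

Lemma J_md_dec M A B om x : om != 0 -> wk 1 b M A -> wk 1 b M B ->
  `|J (md A B om) x| <= (2 + 2 / b) * `|om|^-1 * M * expR (- (b * x)).
Proof.
move=> om0 wA wB.
have M0 := wk_ge0 wA.
case: (wA) => bA [A' pA wA']; case: (wB) => bB [B' pB wB'].
have {}wA' : wk 0 b M A' by [].
have {}wB' : wk 0 b M B' by [].
have bA' y := wk_bound y wA'; have bB' y := wk_bound y wB'.
rewrite (@J_md_parts M A B A' B')// normrM normrN normfV.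
have omV0 : 0 <= `|om|^-1 by rewrite invr_ge0.
have -> : (2 + 2 / b) * `|om|^-1 * M * expR (- (b * x)) =
  `|om|^-1 * (2 * M * expR (- (b * x)) + 2 * M / b * expR (- (b * x))) by ring.
rewrite ler_wpM2l//; apply: (le_trans (ler_normD _ _)); apply: lerD.
  apply: (le_trans (md_wk_le om x (wkN wB) wA)).
  by rewrite ler_wpM2l ?mulr_ge0// expR_normN_le.
apply: J_dec; first exact: mulr_ge0.
  by apply: mlb_md; [exact: mlbN (prim_mlb_d pB)|exact: prim_mlb_d pA].
by move=> y; exact: md_wk_le (wkN wB') wA'.
Qed.

(** One power of 1 / om for each tail integral: the boundary part [F] of the inner one is again a
    mode, and the integral part [G] already carries a factor 1 / om. *)
Lemma JJ_md_dec M A B om x : om != 0 -> wk 2 b M A -> wk 2 b M B ->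
  `|J (J (md A B om)) x| <= (2 + 2 / b) * (1 + b^-1) * `|om|^-1 ^+ 2 * M * expR (- (b * x)).
Proof.
move=> om0 wA wB.
have M0 := wk_ge0 wA.
have w1A := wk_succ wA; have w1B := wk_succ wB.
case: (wA) => bA [A' pA wA1]; case: (wB) => bB [B' pB wB1].
have wA' : wk 1 b M A' by [].
have wB' : wk 1 b M B' by [].
have bA' y := wk_bound y wA'; have bB' y := wk_bound y wB'.
pose F := md (fun x => - B x) A om.
pose G := J (md (fun x => - B' x) A' om).
have wNB := wkN w1B; have wNB' := wkN wB'.
have bF y : `|F y| <= 2 * M * expR (- (b * `|y|)) by exact: md_wk_le wNB w1A.
have M20 : 0 <= 2 * M by exact: mulr_ge0.
have mF : mlb F by apply: mlb_md; [exact: mlbN (prim_mlb pB)|exact: prim_mlb pA].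
have tF : tail b F by exact: tail_dec M20 mF bF.
have pG : prim G (fun x => - md (fun x => - B' x) A' om x).
  apply: (J_prim b0); apply: (@tail_dec (2 * M)) => //.
    by apply: mlb_md; [exact: mlbN (prim_mlb_d pB)|exact: prim_mlb_d pA].
  by move=> y; exact: md_wk_le wNB' wA'.
pose KG := (2 + 2 / b) * `|om|^-1 * M.
have bG y : `|G y| <= KG * expR (- (b * y)) by exact: J_md_dec.
have mG := prim_mlb pG.
have tG : tail b G by split; [case: mG|move=> z; exists KG => y _].
have -> : J (J (md A B om)) x = - om^-1 * (J F x + J G x).
  rewrite -(JD x b0 tF tG) -(JZ _ x b0 (tailD tF tG)).
  by apply: eq_J => y _; rewrite (@J_md_parts M A B A' B').
rewrite normrM normrN normfV.
have -> : (2 + 2 / b) * (1 + b^-1) * `|om|^-1 ^+ 2 * M * expR (- (b * x)) =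
   `|om|^-1 * (KG * expR (- (b * x)) + KG / b * expR (- (b * x))).
  by rewrite /KG; ring.
rewrite ler_wpM2l ?invr_ge0//; apply: (le_trans (ler_normD _ _)); apply: lerD.
  exact: J_md_dec.
by apply: J_bound => //; case: mG.
Qed.

End Decay.

End Modes.

(** * Oscillating potentials *)

Section OscillatingPotential.
Context {R : realType}.
Implicit Types (x y : R) (f g q w : R -> R).

(** Index n will stand for the pair of Fourier indices n + 1 and - (n + 1). [modes_lamD] is then the
    gap between lam n and - lam m; it keeps the sum frequencies in products of modes away from 0,
    also for n = m. *)
Record modes (b th : R) (A_ B_ : nat -> R -> R) (M_ : nat -> R) (Mt : R)
    (lam : nat -> R) : Prop := Modes {
  modes_A : forall n, wk 3 b (M_ n) (A_ n) ;
  modes_B : forall n, wk 3 b (M_ n) (B_ n) ;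
  modes_M : forall n, \sum_(i < n) M_ i <= Mt ;
  modes_lam : forall n, th <= `|lam n| ;
  modes_lamB : forall n m, n != m -> th <= `|lam n - lam m| ;
  modes_lamD : forall n m, th <= `|lam n + lam m| }.

Definition qsum (A_ B_ : nat -> R -> R) (lam : nat -> R) (e : R) (n : nat) x : R :=
  \sum_(i < n) md (A_ i) (B_ i) (lam i / e) x.

Definition oscillation A_ B_ lam e q : Prop :=
  forall x, (fun n => qsum A_ B_ lam e n x) @ \oo --> q x.

Lemma cvg_norm_le (u : nat -> R) (l c : R) : u @ \oo --> l ->
  (forall n, `|u n| <= c) -> `|l| <= c.
Proof.
move=> ul uc; apply: (ler_cvg_to (cvg_norm ul) (cvg_cst c)).
by apply: nearW => n; exact: uc.
Qed.

Context (b th : R) (A_ B_ : nat -> R -> R) (M_ : nat -> R) (Mt : R) (lam : nat -> R).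
Context (b0 : 0 < b) (th0 : 0 < th) (HM : modes b th A_ B_ M_ Mt lam).

Let M_ge0 n : 0 <= M_ n. Proof. exact: wk_ge0 (modes_A HM n). Qed.

Let Mt0 : 0 <= Mt.
Proof. by apply: le_trans (modes_M HM 0); rewrite big_ord0. Qed.

Let mdn e n := md (A_ n) (B_ n) (lam n / e).

Lemma mdn_le e n x : `|mdn e n x| <= 2 * M_ n * expR (- (b * `|x|)).
Proof. exact: md_wk_le (modes_A HM n) (modes_B HM n). Qed.

Lemma mdn_mlb e n : mlb (mdn e n).
Proof. by apply: mlb_md; [exact: wk_mlb (modes_A HM n)|exact: wk_mlb (modes_B HM n)]. Qed.

Lemma oscillation_exists e : exists q, oscillation A_ B_ lam e q.
Proof.
suff H x : exists l : R, (fun n => qsum A_ B_ lam e n x) @ \oo --> l.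
  by have [q Hq] := choice H; exists q.
pose u n := mdn e n x.
have -> : (fun n => qsum A_ B_ lam e n x) = series u.
  by apply/funext => n; rewrite /qsum /series /= big_mkord.
have cM : cvgn (series (fun n => 2 * M_ n)).
  apply: nondecreasing_is_cvgn.
    apply/nondecreasing_seqP => n; rewrite /series /= big_nat_recr//= lerDl.
    by rewrite mulr_ge0.
  exists (2 * Mt) => _ [n _ <-]; rewrite /series /= -mulr_sumr ler_wpM2l// big_mkord.
  exact: (modes_M HM).
have : cvgn (series u).
  apply: normed_cvg; apply: series_le_cvg cM => n //=; first by rewrite mulr_ge0.
  apply: (le_trans (mdn_le e n x)); rewrite -[leRHS]mulr1 ler_wpM2l ?mulr_ge0//.
  by rewrite -expR0 ler_expR oppr_le0 mulr_ge0// ltW.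
by move=> cu; exists (lim (series u @ \oo)).
Qed.

Lemma qsum_mlb e n : mlb (qsum A_ B_ lam e n).
Proof.
elim: n => [|n IH].
  have := @mlb_cst R 0; congr mlb; apply/funext => x; by rewrite /qsum big_ord0.
have -> : qsum A_ B_ lam e n.+1 = (fun x => qsum A_ B_ lam e n x + mdn e n x).
  by apply/funext => x; rewrite /qsum big_ord_recr.
by apply: mlbD => //; exact: mdn_mlb.
Qed.

Lemma qsum_le e n x : `|qsum A_ B_ lam e n x| <= 2 * Mt * expR (- (b * `|x|)).
Proof.
apply: (le_trans (ler_norm_sum _ _ _)).
apply: (@le_trans _ _ (\sum_(i < n) 2 * expR (- (b * `|x|)) * M_ i)).
  apply: ler_sum => i _; rewrite mulrAC; exact: mdn_le.
rewrite -mulr_sumr [leRHS]mulrAC ler_wpM2l ?mulr_ge0 ?expR_ge0//.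
exact: (modes_M HM).
Qed.

Lemma oscillation_le e q x : oscillation A_ B_ lam e q ->
  `|q x| <= 2 * Mt * expR (- (b * `|x|)).
Proof. by move=> Hq; apply: (cvg_norm_le (Hq x)) => n; exact: qsum_le. Qed.

Lemma oscillation_mlb e q : oscillation A_ B_ lam e q -> mlb q.
Proof.
move=> Hq; split.
  by apply: (@measurable_fun_cvg _ _ _ _ (qsum A_ B_ lam e)) => [n|x _];
    [case: (qsum_mlb e n)|exact: Hq].
move=> r; exists (2 * Mt) => x _; apply: (le_trans (oscillation_le x Hq)).
rewrite -[leRHS]mulr1 ler_wpM2l ?mulr_ge0// -expR0 ler_expR oppr_le0 mulr_ge0// ltW//.
Qed.

Lemma dec_mul M P f g : 0 <= P -> (forall x, `|f x| <= M * expR (- (b * `|x|))) ->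
  (forall x, `|g x| <= P) -> forall x, `|f x * g x| <= M * P * expR (- (b * `|x|)).
Proof.
by move=> P0 fM gP x; rewrite normrM mulrAC; apply: ler_pM.
Qed.

(** Termwise integration by dominated convergence: only mode m contributes the value c, and each
    mode an error proportional to its norm, so the summability of [M_] controls the total. *)
Lemma J_oscillation e q psi P x (c K : R) m : oscillation A_ B_ lam e q -> mlb psi ->
  (forall y, `|psi y| <= P) -> 0 <= K ->
  (forall n, `|J (fun y => mdn e n y * psi y) x - (if n == m then c else 0)| <= K * M_ n) ->
  `|J (fun y => q y * psi y) x - c| <= K * Mt.
Proof.
move=> Hq mpsi bpsi K0 Hn.
have P0 : 0 <= P by exact: le_trans (bpsi 0).
have M20 : 0 <= 2 * Mt * P by rewrite !mulr_ge0.
have mN n : mlb (fun y => qsum A_ B_ lam e n y * psi y) by apply: mlbM => //; exact: qsum_mlb.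
have mq := oscillation_mlb Hq.
have bN n := dec_mul P0 (qsum_le e n) bpsi.
have tm n : tail b (fun y => mdn e n y * psi y).
  apply: (@tail_dec _ _ b0 (2 * M_ n * P)); first by rewrite !mulr_ge0.
    by apply: mlbM => //; exact: mdn_mlb.
  exact: dec_mul P0 (mdn_le e n) bpsi.
have JN n : J (fun y => qsum A_ B_ lam e n y * psi y) x = \sum_(i < n) J (fun y => mdn e i y * psi y) x.
  elim: n => [|n IH].
    by rewrite big_ord0 -[RHS](@J0 R x); apply: eq_J => y _; rewrite /qsum big_ord0 mul0r.
  rewrite big_ord_recr /= -IH -(JD x b0 (tail_dec b0 M20 (mN n) (bN n)) (tm n)).
  by apply: eq_J => y _; rewrite /qsum big_ord_recr /= mulrDl.
have cJ : (fun n => J (fun y => qsum A_ B_ lam e n y * psi y) x) @ \oo --> J (fun y => q y * psi y) x.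
  apply: (@J_cvg R b _ _ x (2 * Mt * P)) => //.
  - by move=> n; case: (mN n).
  - by have [] : mlb (fun y => q y * psi y) by exact: mlbM.
  - by move=> n y _; apply: (le_trans (bN n y)); rewrite ler_wpM2l// expR_normN_le.
  - by move=> y _; apply: cvgM; [exact: Hq|exact: cvg_cst].
have cJ' : (fun n => `|J (fun y => qsum A_ B_ lam e n y * psi y) x - c|) @ \oo -->
    `|J (fun y => q y * psi y) x - c|.
  by apply: cvg_norm; apply: cvgB => //; exact: cvg_cst.
apply: (ler_cvg_to cJ' (cvg_cst (K * Mt))).
near=> n; rewrite JN.
have mn : (m < n)%N by near: n; exists m.+1.
have -> : c = \sum_(i < n) (if i == m :> nat then c else 0).
  rewrite (bigD1 (Ordinal mn))//= eqxx big1 ?addr0// => i im.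
  by rewrite ifN//; apply: contra im => /eqP im; apply/eqP/val_inj.
rewrite -sumrB; apply: (le_trans (ler_norm_sum _ _ _)).
apply: (@le_trans _ _ (\sum_(i < n) K * M_ i)); first by apply: ler_sum => i _; exact: Hn.
by rewrite -mulr_sumr ler_wpM2l//; exact: (modes_M HM).
Unshelve. all: by end_near. Qed.

Lemma J_oscillation0 e q psi P x K : oscillation A_ B_ lam e q -> mlb psi ->
  (forall y, `|psi y| <= P) -> 0 <= K ->
  (forall n, `|J (fun y => mdn e n y * psi y) x| <= K * M_ n) ->
  `|J (fun y => q y * psi y) x| <= K * Mt.
Proof.
move=> Hq mpsi bpsi K0 Hn; rewrite -[X in `|X|]subr0.
apply: (@J_oscillation e q psi P x 0 K 0%N) => // n.
by case: ifP => _; rewrite subr0.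
Qed.

Let freq_neq0 e n : 0 < e -> lam n / e != 0.
Proof.
move=> e0; have l0 : lam n != 0 by rewrite -normr_gt0; apply: lt_le_trans th0 (modes_lam HM n).
by rewrite mulf_neq0// invr_eq0 gt_eqF.
Qed.

Lemma freqV_le (l e : R) : 0 < e -> th <= `|l| -> `|l / e|^-1 <= e / th.
Proof.
move=> e0 hl; have l0 : 0 < `|l| by exact: lt_le_trans hl.
rewrite normrM normfV (gtr0_norm e0) invf_div.
by rewrite ler_wpM2l ?(ltW e0)// lef_pV2// posrE.
Qed.

(** [CS] and [CQ] are the constants in J q = O(e) and J (J q) = O(e^2): the bounds for a single mode
    with 1 / |om| <= e / th, summed over the modes. *)
Definition CS : R := (2 + 2 / b) / th * Mt.
Definition CQ : R := (2 + 2 / b) * (1 + b^-1) / th ^+ 2 * Mt.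

Let Cb0 : 0 <= 2 + 2 / b. Proof. by rewrite addr_ge0// divr_ge0// ltW. Qed.
Let Cb10 : 0 <= 1 + b^-1. Proof. by rewrite addr_ge0// invr_ge0 ltW. Qed.
Let thV0 : 0 <= th^-1. Proof. by rewrite invr_ge0 ltW. Qed.

Lemma CS_ge0 : 0 <= CS. Proof. by rewrite /CS !mulr_ge0. Qed.
Lemma CQ_ge0 : 0 <= CQ. Proof. by rewrite /CQ !mulr_ge0// invr_ge0 exprn_ge0// ltW. Qed.

Lemma J_mdn_le e n x : 0 < e ->
  `|J (mdn e n) x| <= (2 + 2 / b) * (e / th) * expR (- (b * x)) * M_ n.
Proof.
move=> e0.
apply: (le_trans (J_md_dec b0 x (freq_neq0 n e0) (wk_leq (isT : (1 <= 3)%N) (modes_A HM n)) (wk_leq (isT : (1 <= 3)%N) (modes_B HM n)))).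
rewrite mulrAC ler_wpM2r// ler_wpM2r ?expR_ge0// ler_wpM2l//.
by apply: freqV_le => //; exact: (modes_lam HM).
Qed.

Lemma J_oscillation_le e q x : 0 < e -> oscillation A_ B_ lam e q ->
  `|J q x| <= CS * e * expR (- (b * x)).
Proof.
move=> e0 Hq.
have -> : CS * e * expR (- (b * x)) = (2 + 2 / b) * (e / th) * expR (- (b * x)) * Mt.
  by rewrite /CS; ring.
have -> : J q x = J (fun y => q y * 1) x by apply: eq_J => y _; rewrite mulr1.
apply: (@J_oscillation0 e q (fun=> 1) 1) => //.
- exact: mlb_cst.
- by move=> y; rewrite normr1.
- by rewrite !mulr_ge0 ?expR_ge0// ltW.
move=> n; under eq_fun do rewrite mulr1.
exact: J_mdn_le.
Qed.

Lemma JJ_oscillation_le e q x : 0 < e -> oscillation A_ B_ lam e q ->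
  `|J (J q) x| <= CQ * e ^+ 2 * expR (- (b * x)).
Proof.
move=> e0 Hq.
have Kx y : 0 <= (2 + 2 / b) * (e / th) * expR (- (b * y)).
  by rewrite !mulr_ge0 ?expR_ge0// ltW.
have M20 : 0 <= 2 * Mt by exact: mulr_ge0.
have tN n : tail b (qsum A_ B_ lam e n).
  by apply: (tail_dec b0 M20); [exact: qsum_mlb|exact: qsum_le].
have M2n n : 0 <= 2 * M_ n by exact: mulr_ge0.
have tm n : tail b (mdn e n).
  by apply: (tail_dec b0 (M2n n)); [exact: mdn_mlb|exact: mdn_le].
have qS n : qsum A_ B_ lam e n.+1 = (fun y => qsum A_ B_ lam e n y + mdn e n y).
  by apply/funext => y; rewrite /qsum big_ord_recr.
have JNE n y : J (qsum A_ B_ lam e n) y = \sum_(i < n) J (mdn e i) y.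
  elim: n => [|n IH].
    by rewrite big_ord0 -[RHS](@J0 R y); apply: eq_J => z _; rewrite /qsum big_ord0.
  by rewrite big_ord_recr /= -IH -(JD y b0 (tN n) (tm n)) qS.
have bJN n y : `|J (qsum A_ B_ lam e n) y| <= CS * e * expR (- (b * y)).
  rewrite JNE; apply: (le_trans (ler_norm_sum _ _ _)).
  have -> : CS * e * expR (- (b * y)) = (2 + 2 / b) * (e / th) * expR (- (b * y)) * Mt.
    by rewrite /CS; ring.
  apply: (@le_trans _ _ (\sum_(i < n) (2 + 2 / b) * (e / th) * expR (- (b * y)) * M_ i)).
    by apply: ler_sum => i _; exact: J_mdn_le.
  by rewrite -mulr_sumr ler_wpM2l//; exact: (modes_M HM).
have tJN n : tail b (J (qsum A_ B_ lam e n)).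
  split; first by case: (prim_mlb (J_prim b0 (tN n))).
  by move=> z; exists (CS * e) => y _.
have tJm n : tail b (J (mdn e n)).
  split; first by case: (prim_mlb (J_prim b0 (tm n))).
  move=> z; exists ((2 + 2 / b) * (e / th) * M_ n) => y _.
  by rewrite mulrAC; exact: J_mdn_le.
have JJNE n : J (J (qsum A_ B_ lam e n)) x = \sum_(i < n) J (J (mdn e i)) x.
  elim: n => [|n IH].
    by rewrite big_ord0 -[RHS](@J0 R x); apply: eq_J => z _; rewrite JNE big_ord0.
  rewrite big_ord_recr /= -IH -(JD x b0 (tJN n) (tJm n)).
  by apply: eq_J => z _; rewrite !JNE big_ord_recr.
have cJ y : (fun n => J (qsum A_ B_ lam e n) y) @ \oo --> J q y.
  apply: (@J_cvg R b _ _ y (2 * Mt)) => //.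
  - by move=> n; case: (qsum_mlb e n).
  - by case: (oscillation_mlb Hq).
  - by move=> n z _; apply: (le_trans (qsum_le e n z)); rewrite ler_wpM2l// expR_normN_le.
have tq : tail b q.
  by apply: (tail_dec b0 M20); [exact: oscillation_mlb Hq|move=> y; exact: oscillation_le Hq].
have cJJ : (fun n => J (J (qsum A_ B_ lam e n)) x) @ \oo --> J (J q) x.
  apply: (@J_cvg R b _ _ x (CS * e)) => //.
  - by move=> n; case: (prim_mlb (J_prim b0 (tN n))).
  - by case: (prim_mlb (J_prim b0 tq)).
apply: (cvg_norm_le cJJ) => n; rewrite JJNE.
apply: (le_trans (ler_norm_sum _ _ _)).
pose K := (2 + 2 / b) * (1 + b^-1) * (e / th) ^+ 2 * expR (- (b * x)).
have K0 : 0 <= K by rewrite /K !mulr_ge0 ?expR_ge0// ?exprn_ge0// ?divr_ge0// ltW.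
have -> : CQ * e ^+ 2 * expR (- (b * x)) = K * Mt.
  by rewrite /CQ /K; field; rewrite !gt_eqF.
apply: (@le_trans _ _ (\sum_(i < n) K * M_ i)); last first.
  by rewrite -mulr_sumr ler_wpM2l//; exact: (modes_M HM).
apply: ler_sum => i _.
apply: (le_trans (JJ_md_dec b0 x (freq_neq0 i e0) (wk_leq (isT : (2 <= 3)%N) (modes_A HM i)) (wk_leq (isT : (2 <= 3)%N) (modes_B HM i)))).
rewrite /K [leLHS]mulrAC ler_wpM2r// ler_wpM2r ?expR_ge0// ler_wpM2l ?mulr_ge0//.
have h : `|lam i / e|^-1 <= e / th by apply: freqV_le => //; exact: (modes_lam HM).
by rewrite !expr2; apply: ler_pM; rewrite ?invr_ge0.
Qed.

Lemma md_mulr A B om (psi : R -> R) x : md A B om x * psi x =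
  md (fun y => A y * psi y) (fun y => B y * psi y) om x.
Proof. by rewrite /md; ring. Qed.

(** The two tails make up the integral over R. It is cut again at - X, where the boundary terms of
    the integrations by parts are exponentially small, and X is taken arbitrarily large; cut at 0,
    they would be of order e. *)
Lemma oscillation_third_order Mw w : wk 3 0 Mw w -> exists2 K, 0 <= K &
  forall e q, 0 < e -> e <= th -> oscillation A_ B_ lam e q ->
  `|J (fun x => q x * w x ^+ 2) 0 + J (fun x => q (- x) * w (- x) ^+ 2) 0| <= K * e ^+ 3.
Proof.
move=> ww.
have Mw0 := wk_ge0 ww.
pose Mv := 2 ^+ 3 * (Mw * Mw).
have Mv0 : 0 <= Mv by rewrite /Mv !mulr_ge0// exprn_ge0.
have wv : wk 3 0 Mv (fun x => w x ^+ 2).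
  by have := wkM ww ww; congr wk; apply/funext => x; rewrite expr2.
have bv y : `|w y ^+ 2| <= Mv.
  by have := wk_bound y wv; rewrite mul0r oppr0 expR0 mulr1.
pose M3 := 2 ^+ 3 * Mv.
have M30 : 0 <= M3 by rewrite /M3 mulr_ge0// exprn_ge0.
have K0 : 0 <= M3 * (6 / b) / th ^+ 3 * Mt.
  rewrite !mulr_ge0// ?invr_ge0 ?exprn_ge0 ?ltW//.
exists (M3 * (6 / b) / th ^+ 3 * Mt) => //.
move=> e q e0 eth Hq.
have mv := wk_mlb wv.
have mq := oscillation_mlb Hq.
have mqv : mlb (fun x => q x * w x ^+ 2) by exact: mlbM.
have bqv := dec_mul Mv0 (fun x => oscillation_le x Hq) bv.
have M20 : 0 <= 2 * Mt * Mv by rewrite !mulr_ge0.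
have key X : 0 <= X -> `|J (fun x => q x * w x ^+ 2) (- X)| <=
    M3 * (2 * 3%:R * expR (- (b * X)) + 6 / b * (e / th) ^+ 3) * Mt.
  move=> X0.
  apply: (@J_oscillation0 e q (fun x => w x ^+ 2) Mv) => //.
    rewrite mulr_ge0// addr_ge0// ?mulr_ge0 ?expR_ge0// ?exprn_ge0 ?divr_ge0// ?ltW//.
    by rewrite invr_gt0.
  move=> n; rewrite /mdn; under eq_fun do rewrite (md_mulr _ _ _ (fun x => w x ^+ 2)).
  have wA := wkM (modes_A HM n) wv; have wB := wkM (modes_B HM n) wv.
  (* This is where e <= th enters: for |om| >= 1 the boundary terms are bounded without tracking
     their powers of 1 / om. *)
  have om1 : 1 <= `|lam n / e|.
    rewrite normrM normfV (gtr0_norm e0) ler_pdivlMr// mul1r.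
    exact: le_trans eth (modes_lam HM n).
  apply: (le_trans (J_md_wk b0 (- X) om1 wA wB)).
  rewrite normrN (ger0_norm X0).
  have -> : 2 ^+ 3 * (M_ n * Mv) = M3 * M_ n by rewrite /M3; ring.
  rewrite [leRHS]mulrAC ler_wpM2l ?mulr_ge0// lerD2l ler_wpM2l ?divr_ge0// ?(ltW b0)//.
  have h : `|lam n / e|^-1 <= e / th by apply: freqV_le => //; exact: (modes_lam HM).
  by rewrite lerXn2r ?nnegrE ?invr_ge0// divr_ge0// ltW.
have refl X : 0 <= X -> `|J (fun x => q x * w x ^+ 2) 0 + J (fun x => q (- x) * w (- x) ^+ 2) 0| <=
   M3 * (6 / b) / th ^+ 3 * Mt * e ^+ 3 + (M3 * (2 * 3%:R) * Mt + 2 * Mt * Mv / b) * expR (- (b * X)).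
  move=> X0.
  rewrite (@J_reflect R b b0 (2 * Mt * Mv) (fun x => q x * w x ^+ 2) X M20 mqv bqv).
  apply: (le_trans (ler_normD _ _)).
  have h1 := key X X0.
  have h2 : `|J (fun y => q (- y) * w (- y) ^+ 2) X| <= 2 * Mt * Mv / b * expR (- (b * X)).
    apply: (J_dec b0) => //; first exact: (mlb_oppx mqv).
    by move=> y; have := bqv (- y); rewrite normrN.
  apply: (le_trans (lerD h1 h2)); rewrite le_eqVlt; apply/orP; left; apply/eqP.
  by field; rewrite !gt_eqF.
apply/ler_addgt0Pr => d d0.
set Z := M3 * (2 * 3%:R) * Mt + 2 * Mt * Mv / b in refl.
have Z0 : 0 <= Z by rewrite /Z addr_ge0// !mulr_ge0// invr_ge0 ltW.
have [X X0 HX] : exists2 X, 0 <= X & Z * expR (- (b * X)) <= d.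
  exists (Z / d / b); first by rewrite !divr_ge0// ltW.
  have -> : b * (Z / d / b) = Z / d by field; rewrite !gt_eqF.
  rewrite expRN ler_pdivrMr ?expR_gt0// mulrC -ler_pdivrMr//.
  by apply: (le_trans _ (expR_ge1Dx _)); rewrite lerDr.
exact: (le_trans (refl X X0)) (lerD (lexx _) HX).
Qed.

End OscillatingPotential.

(** * The resonant lower bound *)

Section LowerBound.
Context {R : realType}.
Implicit Types (x y : R) (f g q w : R -> R).
Context (b th : R) (A_ B_ : nat -> R -> R) (M_ : nat -> R) (Mt : R) (lam : nat -> R).
Context (b0 : 0 < b) (th0 : 0 < th) (HM : modes b th A_ B_ M_ Mt lam).

Lemma wk1_prod M M' Mw F G w : wk 1 b M F -> wk 1 b M' G -> wk 1 0 Mw w ->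
  wk 1 b (2 * (2 * (M * M') * (2 * (Mw * Mw)))) (fun x => F x * G x * w x ^+ 2).
Proof.
move=> wF wG ww.
have h1 := wkM wF (wk_weaken (ltW b0) wG).
have h2 := wkM ww ww.
have := wkM h1 h2; rewrite !expr1 => h.
by move: h; congr wk; apply/funext => x; rewrite expr2.
Qed.

Lemma wk1_avg M F G : wk 1 b M F -> wk 1 b M G ->
  wk 1 b M (fun x => (F x + G x) / 2) /\ wk 1 b M (fun x => (F x - G x) / 2).
Proof.
move=> wF wG.
have e (H : R -> R) : (fun x => H x / 2) = (fun x => 2^-1 * H x) by apply/funext => x; rewrite mulrC.
have M2 : `|2^-1| * (M + M) = M by rewrite ger0_norm//; field.
split; rewrite (e (fun x => _)) -M2; apply: wkZ; first exact: wkD.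
by apply: wkD => //; exact: wkN.
Qed.

Lemma oscillation_energy_lower m Mw w : wk 1 0 Mw w ->
  0 < J (fun x => (A_ m x ^+ 2 + B_ m x ^+ 2) * w x ^+ 2) 0 ->
  exists2 c, 0 < c & exists2 e1, 0 < e1 & forall e q, 0 < e -> e <= e1 ->
    oscillation A_ B_ lam e q -> c * e ^+ 2 <= J (fun x => (J q x * w x) ^+ 2) 0.
Proof.
move=> ww; set G := J _ 0 => G0.
have Mw0 := wk_ge0 ww.
have M0 n : 0 <= M_ n := wk_ge0 (modes_A HM n).
have Mt0 : 0 <= Mt by apply: le_trans (modes_M HM 0); rewrite big_ord0.
have CS0 := CS_ge0 b0 th0 HM.
have Cb0 : 0 <= 2 + 2 / b by rewrite addr_ge0// divr_ge0// ltW.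
have thV0 : 0 <= th^-1 by rewrite invr_ge0 ltW.
have bV0 : 0 <= b^-1 by rewrite invr_ge0 ltW.
pose D n := 2 * (2 * (M_ n * M_ m) * (2 * (Mw * Mw))).
have wA n : wk 1 b (M_ n) (A_ n) := wk_leq (isT : (1 <= 3)%N) (modes_A HM n).
have wB n : wk 1 b (M_ n) (B_ n) := wk_leq (isT : (1 <= 3)%N) (modes_B HM n).
have bw x : `|w x| <= Mw by have := wk_bound x ww; rewrite mul0r oppr0 expR0 mulr1.
case: (ww) => _ [w' pw ww'].
have bw' x : `|w' x| <= Mw by case: ww' => /(_ x); rewrite mul0r oppr0 expR0 mulr1.
have mw := prim_mlb pw; have mw' := prim_mlb_d pw.
case: (wA m) => _ [A' pA [bA' mA']]; case: (wB m) => _ [B' pB [bB' mB']].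
have mA := prim_mlb pA; have mB := prim_mlb pB.
(* Three errors of order e: [KK] from the non-resonant products of modes, [K2] from the boundary
   term at 0, [K3] from the derivatives falling on the amplitudes or on w. *)
pose KK := 16 * (2 + 2 / b) / th * M_ m * (Mw * Mw) * Mt.
pose K2 := CS b th Mt * (Mw * Mw * (2 * M_ m)).
pose K3 := CS b th Mt * (6 * (Mw * Mw) * M_ m) / b.
have KK0 : 0 <= KK by rewrite /KK !mulr_ge0.
have K20 : 0 <= K2 by rewrite /K2 !mulr_ge0.
have K30 : 0 <= K3 by rewrite /K3 !mulr_ge0.
pose K := KK + K2 + K3 + 1.
have K0 : 0 < K by rewrite /K ltr_wpDl// !addr_ge0.
have lm0 : 0 < `|lam m| by exact: lt_le_trans th0 (modes_lam HM m).
(* From |om T| >= G / 4 with om = lam m / e one gets T^2 / G >= G e^2 / (16 lam m^2). *)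
exists (G / (16 * `|lam m| ^+ 2)); first by rewrite divr_gt0// mulr_gt0// exprn_gt0.
(* For such e the total error K e is at most G / 4, half of the resonant value G / 2. *)
exists (G / 4 / K); first by rewrite !divr_gt0.
move=> e q e0 ele Hq.
have e0' := ltW e0.
pose om := lam m / e.
have om0 : om != 0 by rewrite mulf_neq0// ?invr_eq0 ?(gt_eqF e0)// -normr_gt0.
pose S x := - J q x.
have mq := oscillation_mlb b0 HM Hq.
have bq x := oscillation_le HM x Hq.
have M20 : 0 <= 2 * Mt by exact: mulr_ge0.
have tq : tail b q by apply: (tail_dec b0 M20).
have pS : prim S q.
  by apply: eq_prim (primN (J_prim b0 tq)) => x; rewrite opprK.
have mS := prim_mlb pS.
have bS x : `|S x| <= CS b th Mt * e * expR (- (b * x)).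
  by rewrite normrN; exact: (J_oscillation_le b0 th0 HM x e0 Hq).
have CSe : 0 <= CS b th Mt * e by exact: mulr_ge0.
have tS g P : 0 <= P -> mlb g -> (forall x, `|g x| <= P) -> tail b (fun x => S x * g x).
  move=> P0 mg bg; split; first by case: (mlbM mS mg).
  move=> x; exists (CS b th Mt * e * P) => y _.
  by rewrite normrM mulrAC; apply: ler_pM.
have ex1 x : expR (- (b * `|x|)) <= 1 by rewrite -expR0 ler_expR oppr_le0 mulr_ge0// ltW.
have dec1 M f : 0 <= M -> (forall x, `|f x| <= M * expR (- (b * `|x|))) -> forall x, `|f x| <= M.
  by move=> M'0 hf x; apply: (le_trans (hf x)); rewrite -[leRHS]mulr1 ler_wpM2l.
pose mdm := md (A_ m) (B_ m) om.
have bmdm x : `|mdm x| <= 2 * M_ m.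
  apply: (dec1 (2 * M_ m)); first exact: mulr_ge0.
  by move=> y; exact: md_wk_le (wA m) (wB m).
have mmdm : mlb mdm by exact: mlb_md.
pose psi y := mdm y * w y ^+ 2.
have mw2 : mlb (fun y => w y ^+ 2) by under eq_fun do rewrite expr2; exact: mlbM.
have bw2 y : `|w y ^+ 2| <= Mw * Mw by rewrite expr2 normrM; apply: ler_pM.
have mpsi : mlb psi by exact: mlbM.
have bpsi y : `|psi y| <= 2 * M_ m * (Mw * Mw) by rewrite normrM; apply: ler_pM.
(* Only the product of mode [m] with itself fails to oscillate; its mean is half
   the squared amplitude. *)
have res : `|J (fun y => q y * psi y) 0 - G / 2| <= KK * e.
  have -> : KK * e = 16 * (2 + 2 / b) * (e / th) * M_ m * (Mw * Mw) * Mt by rewrite /KK; ring.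
  apply: (@J_oscillation _ b th A_ B_ M_ Mt lam b0 HM e q psi (2 * M_ m * (Mw * Mw)) 0 (G / 2) _ m) => //.
    by rewrite !mulr_ge0.
  move=> n.
  have AA := wk1_prod (wA n) (wA m) ww; have BB := wk1_prod (wB n) (wB m) ww.
  have AB := wk1_prod (wA n) (wB m) ww; have BA := wk1_prod (wB n) (wA m) ww.
  (* Product-to-sum: [P1] and [P2] are the amplitudes at the difference frequency [o1], [P3] and
     [P4] those at the sum frequency [o2]. For n = m the first is 0, and P1 alone gives G / 2. *)
  have [w1 w3] := wk1_avg AA BB; have [w4 w2] := wk1_avg BA AB.
  set P1 := (fun x => (_ + _) / 2) in w1; set P3 := (fun x => (_ - _) / 2) in w3.
  set P4 := (fun x => (_ + _) / 2) in w4; set P2 := (fun x => (_ - _) / 2) in w2.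
  pose o1 := lam n / e - om; pose o2 := lam n / e + om.
  have E y : md (A_ n) (B_ n) (lam n / e) y * psi y = md P1 P2 o1 y + md P3 P4 o2 y.
    by rewrite /psi mulrA mdM mulrDl /md /P1 /P2 /P3 /P4; ring.
  have D0 : 0 <= D n by rewrite /D !mulr_ge0.
  have tmd F1 F2 o : wk 1 b (D n) F1 -> wk 1 b (D n) F2 -> tail b (md F1 F2 o).
    move=> v1 v2; apply: (@tail_dec _ _ b0 (2 * D n)); first exact: mulr_ge0.
      by apply: mlb_md; [exact: wk_mlb v1|exact: wk_mlb v2].
    by move=> y; exact: md_wk_le v1 v2.
  have -> : J (fun y => md (A_ n) (B_ n) (lam n / e) y * psi y) 0 =
     J (md P1 P2 o1) 0 + J (md P3 P4 o2) 0.
    by rewrite -(JD 0 b0 (tmd _ _ _ w1 w2) (tmd _ _ _ w3 w4)); apply: eq_J => y _; exact: E.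
  have hb F1 F2 l : wk 1 b (D n) F1 -> wk 1 b (D n) F2 -> th <= `|l| ->
     `|J (md F1 F2 (l / e)) 0| <= (2 + 2 / b) * (e / th) * D n.
    move=> v1 v2 hl.
    have l0 : l / e != 0.
      by rewrite mulf_neq0// ?invr_eq0 ?(gt_eqF e0)// -normr_gt0; exact: lt_le_trans th0 hl.
    apply: (le_trans (J_md_dec b0 0 l0 v1 v2)).
    rewrite mulr0 oppr0 expR0 mulr1 ler_wpM2r// ler_wpM2l//.
    by apply: freqV_le.
  have -> : 16 * (2 + 2 / b) * (e / th) * M_ m * (Mw * Mw) * M_ n =
     (2 + 2 / b) * (e / th) * D n + (2 + 2 / b) * (e / th) * D n by rewrite /D; ring.
  have Hc : 0 <= (2 + 2 / b) * (e / th) * D n by rewrite !mulr_ge0.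
  have h2 : `|J (md P3 P4 o2) 0| <= (2 + 2 / b) * (e / th) * D n.
    by rewrite /o2 /om -mulrDl; apply: hb => //; exact: modes_lamD HM n m.
  have [nm|nm] := eqVneq n m.
    have -> : J (md P1 P2 o1) 0 = G / 2.
      rewrite /o1 /om nm subrr mulrC /G.
      have tG : tail b (fun x => (A_ m x ^+ 2 + B_ m x ^+ 2) * w x ^+ 2).
        have := tailD (tmd _ _ 0 w1 w2) (tmd _ _ 0 w1 w2); congr tail.
        apply/funext => x; rewrite /md /P1 nm mul0r cos0 sin0 !mulr1 !mulr0 !addr0.
        by field.
      rewrite -(JZ _ 0 b0 tG); apply: eq_J => x _.
      by rewrite /md /P1 nm mul0r cos0 sin0 !mulr1 !mulr0 !addr0; field.
    by rewrite addrAC subrr add0r; apply: (le_trans h2); rewrite lerDl.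
  rewrite subr0; apply: (le_trans (ler_normD _ _)); apply: lerD => //.
  by rewrite /o1 /om -mulrBl; apply: hb => //; exact: modes_lamB HM n m nm.
(* The test function is mode m shifted by a quarter period. Since mdm' = - om X up to derivatives of
   the amplitudes, integrating S X w^2 by parts returns q mdm w^2 divided by om; moreover X^2 +
   mdm^2 = A^2 + B^2. *)
pose X x := md (fun x => - B_ m x) (A_ m) om x.
pose T := J (fun x => S x * (X x * w x ^+ 2)) 0.
have mX : mlb X by apply: mlb_md => //; exact: mlbN.
have bX x : `|X x| <= 2 * M_ m.
  apply: (dec1 (2 * M_ m)); first exact: mulr_ge0.
  by move=> y; exact: md_wk_le (wkN (wB m)) (wA m).
have Mm2 : 0 <= 2 * M_ m by exact: mulr_ge0.
have MwMw : 0 <= Mw * Mw by exact: mulr_ge0.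
have mXw : mlb (fun x => X x * w x ^+ 2) by exact: mlbM.
have bXw x : `|X x * w x ^+ 2| <= 2 * M_ m * (Mw * Mw) by rewrite normrM; apply: ler_pM.
have tT : tail b (fun x => S x * (X x * w x ^+ 2)).
  by apply: (tS _ (2 * M_ m * (Mw * Mw))) => //; exact: mulr_ge0.
pose X2 x := 2 * (w x * w' x) * mdm x + w x ^+ 2 * md A' B' om x.
have mX2 : mlb X2.
  apply: mlbD; apply: mlbM => //; first by apply: mlbZ; exact: mlbM.
  exact: mlb_md.
have bmd' x : `|md A' B' om x| <= 2 * M_ m.
  apply: (dec1 (2 * M_ m)) => // y.
  have -> : 2 * M_ m * expR (- (b * `|y|)) = M_ m * expR (- (b * `|y|)) + M_ m * expR (- (b * `|y|)) by ring.
  exact: md_le.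
have bX2 x : `|X2 x| <= 6 * (Mw * Mw) * M_ m.
  have -> : 6 * (Mw * Mw) * M_ m = 2 * (Mw * Mw) * (2 * M_ m) + Mw * Mw * (2 * M_ m) by ring.
  apply: (le_trans (ler_normD _ _)); apply: lerD; rewrite normrM; apply: ler_pM => //.
  by rewrite normrM ger0_norm// ler_wpM2l// normrM; apply: ler_pM.
have M60 : 0 <= 6 * (Mw * Mw) * M_ m by rewrite !mulr_ge0.
have tX2 : tail b (fun x => S x * X2 x) by exact: tS M60 mX2 bX2.
have tqp : tail b (fun x => q x * psi x).
  apply: (@tail_dec _ _ b0 (2 * Mt * (2 * M_ m * (Mw * Mw)))); first by rewrite !mulr_ge0.
    exact: mlbM.
  by apply: dec_mul bpsi => //; rewrite !mulr_ge0.
have pF : prim (fun x => S x * (w x ^+ 2 * mdm x))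
    (fun x => q x * psi x + S x * X2 x - om * (S x * (X x * w x ^+ 2))).
  have pmd : prim mdm (fun x => md A' B' om x - om * X x).
    have := prim_md om pB (primN pA).
    rewrite (_ : md (fun x => - - A_ m x) (B_ m) om = mdm); last first.
      by apply/funext => x; rewrite /md opprK.
    by apply: eq_prim => x; rewrite /X /md; ring.
  have pw2 := primM (primM pw pw) pmd.
  have := primM pS pw2.
  rewrite (_ : (fun x => S x * (w x * w x * mdm x)) = (fun x => S x * (w x ^+ 2 * mdm x))); last first.
    by apply/funext => x; rewrite expr2.
  by apply: eq_prim => x; rewrite /psi /X2; ring.
have tF : tail b (fun x => q x * psi x + S x * X2 x - om * (S x * (X x * w x ^+ 2))).
  by apply: tailB; [exact: tailD|exact: tailZ].
have FE : S 0 * (w 0 ^+ 2 * mdm 0) = - (J (fun x => q x * psi x) 0 + J (fun x => S x * X2 x) 0 - om * T).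
  have := @prim_J R b (fun x => S x * (w x ^+ 2 * mdm x)) _ 0
    (CS b th Mt * e * (Mw * Mw * (2 * M_ m))) b0 tF pF.
  rewrite (JB 0 b0 (tailD tqp tX2) (tailZ om tT)) (JD 0 b0 tqp tX2) (JZ om 0 b0 tT).
  apply => y _; rewrite normrM [leRHS]mulrAC; apply: ler_pM => //.
  by rewrite normrM; apply: ler_pM.
have omT : `|om * T - G / 2| <= K * e.
  have -> : om * T - G / 2 = (J (fun y => q y * psi y) 0 - G / 2) +
     S 0 * (w 0 ^+ 2 * mdm 0) + J (fun x => S x * X2 x) 0 by rewrite FE; ring.
  have h1 : `|S 0 * (w 0 ^+ 2 * mdm 0)| <= K2 * e.
    have -> : K2 * e = CS b th Mt * e * (Mw * Mw * (2 * M_ m)) by rewrite /K2; ring.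
    rewrite normrM; apply: ler_pM => //.
      by have := bS 0; rewrite mulr0 oppr0 expR0 mulr1.
    by rewrite normrM; apply: ler_pM.
  have h2 : `|J (fun x => S x * X2 x) 0| <= K3 * e.
    have -> : K3 * e = CS b th Mt * e * (6 * (Mw * Mw) * M_ m) / b * expR (- (b * 0)).
      by rewrite mulr0 oppr0 expR0 /K3; ring.
    apply: J_bound => //; first by case: (mlbM mS mX2).
    by move=> y _; rewrite normrM mulrAC; apply: ler_pM.
  apply: (le_trans (ler_normD _ _)).
  apply: (@le_trans _ _ (KK * e + K2 * e + K3 * e)); last first.
    by rewrite -!mulrDl ler_wpM2r// /K lerDl.
  apply: lerD => //; apply: (le_trans (ler_normD _ _)); exact: lerD.
have Ke : K * e <= G / 4 by rewrite mulrC -ler_pdivlMr.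
have omT4 : G / 4 <= `|om * T|.
  move: omT; rewrite ler_norml => /andP[h _].
  by apply: le_trans (ler_norm _); lra.
have TG : T ^+ 2 / G <= J (fun x => (J q x * w x) ^+ 2) 0.
  have mG : mlb (fun x => (A_ m x ^+ 2 + B_ m x ^+ 2) * w x ^+ 2).
    by apply: mlbM => //; apply: mlbD; under eq_fun do rewrite expr2; exact: mlbM.
  have tG : tail b (fun x => (A_ m x ^+ 2 + B_ m x ^+ 2) * w x ^+ 2).
    apply: (@tail_dec _ _ b0 ((M_ m * M_ m + M_ m * M_ m) * (Mw * Mw))) => //.
      by rewrite mulr_ge0// addr_ge0// mulr_ge0.
    apply: (dec_mul MwMw _ bw2) => x; rewrite mulrDl.
    apply: (le_trans (ler_normD _ _)); apply: lerD; rewrite expr2 normrM -mulrA; apply: ler_pM => //.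
    - by apply: (dec1 _ _ (M0 m)) => y; exact: (wk_bound _ (wA m)).
    - exact: (wk_bound _ (wA m)).
    - by apply: (dec1 _ _ (M0 m)) => y; exact: (wk_bound _ (wB m)).
    - exact: (wk_bound _ (wB m)).
  have tJ : tail b (fun x => (J q x * w x) ^+ 2).
    have mSw2 : mlb (fun x => S x * w x ^+ 2) by exact: mlbM.
    have := @tail_intro R b (CS b th Mt * e * (CS b th Mt * e * (Mw * Mw))) (fun x => S x * (S x * w x ^+ 2)) _ _ _.
    have -> : (fun x => S x * (S x * w x ^+ 2)) = (fun x => (J q x * w x) ^+ 2).
      by apply/funext => x; rewrite /S; ring.
    apply.
    - by rewrite !mulr_ge0.
    - have := mlbM mS mSw2; congr mlb; apply/funext => x; rewrite /S; ring.
    move=> y y0.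
    rewrite normrM mulrAC; apply: ler_pM => //.
    rewrite normrM; apply: ler_pM => //.
    apply: (le_trans (bS y)); rewrite -[leRHS]mulr1 ler_wpM2l//.
    by rewrite -expR0 ler_expR oppr_le0 mulr_ge0// ltW.
  (* Cauchy-Schwarz as positivity of the integral of (S w - s X w)^2 at the optimal s; X^2 <= A^2 +
     B^2 bounds the coefficient of s^2 by G. *)
  pose s := T / G.
  have -> : T ^+ 2 / G = 2 * s * T - s ^+ 2 * G by rewrite /s; field; rewrite gt_eqF.
  rewrite -(JZ (2 * s) 0 b0 tT) -(JZ (s ^+ 2) 0 b0 tG).
  rewrite -(JB 0 b0 (tailZ (2 * s) tT) (tailZ (s ^+ 2) tG)).
  apply: (le_J b0) => //; first by apply: tailB; exact: tailZ.
  move=> x _.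
  have cs := cos2Dsin2 (om * x).
  rewrite -subr_ge0.
  have -> : (J q x * w x) ^+ 2 - (2 * s * (S x * (X x * w x ^+ 2)) -
      s ^+ 2 * ((A_ m x ^+ 2 + B_ m x ^+ 2) * w x ^+ 2)) =
     (S x * w x - s * X x * w x) ^+ 2 +
     (s * w x * (A_ m x * cos (om * x) + B_ m x * sin (om * x))) ^+ 2 +
     s ^+ 2 * w x ^+ 2 * (A_ m x ^+ 2 + B_ m x ^+ 2) * (1 - (cos (om * x) ^+ 2 + sin (om * x) ^+ 2)).
    by rewrite /S /X /md; ring.
  by rewrite cs subrr mulr0 addr0 addr_ge0// sqr_ge0.
apply: le_trans TG.
have om20 : 0 < om ^+ 2 by rewrite exprn_even_gt0.
have h : (G / 4) ^+ 2 <= om ^+ 2 * T ^+ 2.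
  rewrite -exprMn -[leRHS]real_normK ?num_real// lerXn2r// nnegrE ?divr_ge0// ltW//.
rewrite -(ler_pM2l om20) mulrA [leRHS]mulrA ler_pdivlMr//.
apply: le_trans h; rewrite le_eqVlt; apply/orP; left; apply/eqP.
have l2 : `|lam m| ^+ 2 = lam m ^+ 2 by rewrite real_normK ?num_real.
have l0 : lam m != 0 by rewrite -normr_gt0.
by rewrite l2 /om; field; rewrite ?l0 ?gt_eqF.
Qed.

End LowerBound.

(** * Jost solutions of the average *)

Section Uniqueness.
Context {R : realType}.
Implicit Types (x y : R) (f g q w U : R -> R).

Lemma prim_le F f (a b : R) : prim F f -> (forall x, 0 <= f x) -> a <= b -> F a <= F b.
Proof.
move=> [_ Ff] f0 ab; rewrite -subr_ge0 Ff//; apply: Rintegral_ge0 => x _; exact: f0.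
Qed.

Lemma prim_near0 F f x : prim F f -> continuous f -> (\forall y \near x, F y = 0) -> f x = 0.
Proof.
move=> pF cf F0; have [_ <-] := prim_derive pF cf x.
rewrite derive1E.
have F0' : \near x, F x = cst 0 x by apply: filterS F0.
by rewrite (near_eq_derive _ F0') derive_cst.
Qed.

(* Gronwall: the energy [f ^+ 2 + f' ^+ 2] grows at most exponentially in both
   directions. *)
Lemma schrodinger_zero U f f' C x2 : prim f f' -> prim f' (fun x => U x * f x) ->
  (forall x, `|U x| <= C) -> f x2 = 0 -> f' x2 = 0 -> forall x, f x = 0.
Proof.
move=> pf pf' UC f0 f'0 x.
pose E x := f x * f x + f' x * f' x.
pose E' x := (f' x * f x + f x * f' x) + (U x * f x * f' x + f' x * (U x * f x)).
have pE : prim E E' by apply: primD; exact: primM.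
have E0 y : 0 <= E y by rewrite /E addr_ge0// -expr2 sqr_ge0.
pose c := 1 + C.
have bE' y : `|E' y| <= c * E y.
  have -> : E' y = 2 * (f y * f' y) * (1 + U y) by rewrite /E'; ring.
  rewrite normrM mulrC; apply: ler_pM => //.
    by apply: (le_trans (ler_normD _ _)); rewrite normr1 /c lerD2l.
  rewrite /E ler_norml; apply/andP; split.
    by have := sqr_ge0 (f y + f' y); rewrite expr2; lra.
  by have := sqr_ge0 (f y - f' y); rewrite expr2; lra.
have E2 : E x2 = 0 by rewrite /E f0 f'0 !mul0r addr0.
suff Ex : E x <= 0.
  apply/eqP; rewrite -sqrf_eq0 eq_le sqr_ge0 andbT.
  apply: le_trans Ex; rewrite /E expr2 lerDl -expr2 sqr_ge0//.
have [xx|/ltW xx] := leP x2 x.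
  have p := primN (primM pE (prim_expRM (- c))).
  have := prim_le p _ xx; rewrite E2 mul0r oppr0 => h.
  have : 0 <= - (E x * expR (- c * x)).
    apply: h => y; rewrite oppr_ge0.
    have -> : E' y * expR (- c * y) + E y * (- c * expR (- c * y)) = (E' y - c * E y) * expR (- c * y) by ring.
    apply: mulr_le0_ge0; last exact: expR_ge0.
    by rewrite subr_le0; exact: le_trans (ler_norm _) (bE' y).
  by rewrite oppr_ge0 pmulr_lle0// expR_gt0.
have p := primM pE (prim_expRM c).
have := prim_le p _ xx; rewrite E2 mul0r => h.
have : E x * expR (c * x) <= 0.
  apply: h => y.
  have -> : E' y * expR (c * y) + E y * (c * expR (c * y)) = (E' y + c * E y) * expR (c * y) by ring.
  apply: mulr_ge0; last exact: expR_ge0.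
  have := bE' y; rewrite ler_norml => /andP[h1 _]; by rewrite -lerBlDr sub0r.
by rewrite pmulr_lle0// expR_gt0.
Qed.

(** If the integral from 0 were not positive, all tails from x >= 0 would vanish, and with them h =
    - (J h)' near x1. *)
Lemma J_gt0 (b : R) h x1 : 0 < b -> tail b h -> continuous h -> (forall x, 0 <= h x) ->
  0 < x1 -> 0 < h x1 -> 0 < J h 0.
Proof.
move=> b0 th ch h0 x10 hx1; rewrite ltNge; apply/negP => J0'.
have pJ := J_prim b0 th.
have Jx x : 0 <= x -> J h x = 0.
  move=> x0; apply/eqP; rewrite eq_le; apply/andP; split.
    apply: le_trans J0'; rewrite -lerN2.
    by apply: (prim_le (primN pJ)) x0 => y; rewrite opprK.
  by apply: Rintegral_ge0 => y _; exact: h0.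
have : - h x1 = 0.
  apply: (prim_near0 pJ).
    by move=> x; apply: (@cvgN _ R^o); exact: ch.
  by near=> y; apply: Jx; near: y; exact: lt_le_nbhsr.
by move/eqP; rewrite oppr_eq0 => /eqP h1; rewrite h1 ltxx in hx1.
Unshelve. all: by end_near. Qed.

End Uniqueness.

(** * Half-line expansion for an oscillating perturbation *)

Section HalfModes.
Context {R : realType}.
Implicit Types (x y : R) (f g q w U : R -> R).
Context (b th : R) (A_ B_ : nat -> R -> R) (M_ : nat -> R) (Mt : R) (lam : nat -> R).
Context (b0 : 0 < b) (th0 : 0 < th) (HM : modes b th A_ B_ M_ Mt lam).
Context (Mq : R) (qav : R -> R) (wq : wk 0 b Mq qav).

(** A common constant for the decay of q_av, of V_epsilon, of S and of its primitive, since the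
    half-line expansion is stated with a single one. *)
Definition CC : R := Mq + 2 * Mt + CS b th Mt + CQ b th Mt.

Let Mt0 : 0 <= Mt.
Proof. by apply: le_trans (modes_M HM 0); rewrite big_ord0. Qed.

Let Mq0 : 0 <= Mq := wk_ge0 wq.

Let CC_parts : [/\ 0 <= CC, Mq <= CC, Mq + 2 * Mt <= CC, CS b th Mt <= CC & CQ b th Mt <= CC].
Proof.
have h1 := CS_ge0 b0 th0 HM; have h2 := CQ_ge0 b0 th0 HM.
by move: h1 h2 Mt0 Mq0; rewrite /CC; move: (CS _ _ _) (CQ _ _ _) => c1 c2 *; split; lra.
Qed.

Lemma CC_ge0 : 0 <= CC. Proof. by case: CC_parts. Qed.

Lemma potential_qav : potential CC b qav.
Proof.
case: (wq) => bq mq; split; first by case: mq.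
by move=> x; apply: (le_trans (bq x)); rewrite ler_wpM2r ?expR_ge0//; case: CC_parts.
Qed.

Lemma potential_oscillation e q : oscillation A_ B_ lam e q -> potential CC b (fun x => qav x + q x).
Proof.
move=> Hq; case: (wq) => bq mq; have mo := oscillation_mlb b0 HM Hq.
split; first by case: (mlbD mq mo).
move=> x; apply: (@le_trans _ _ ((Mq + 2 * Mt) * expR (- (b * `|x|)))).
  rewrite mulrDl; apply: (le_trans (ler_normD _ _)); apply: lerD => //.
  exact: (oscillation_le HM x Hq).
by rewrite ler_wpM2r ?expR_ge0//; case: CC_parts.
Qed.

(** With S = - J q, the integral of 2 S w w' becomes a boundary term at 0 and the integral of q w^2.
    The boundary term has order e and stays explicit: it cancels only against the other
    half-line. *)
Lemma half_line_modes : exists2 K, 0 <= K & forall e q w w' u u', 0 < e -> e <= 1 ->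
  oscillation A_ B_ lam e q -> real_jost CC b qav w w' ->
  real_jost CC b (fun x => qav x + q x) u u' ->
  [/\ `|J q 0| <= CC * e, `|u 0 - w 0| <= K * e ^+ 2,
      `|u' 0 + J q 0 * u 0 - w' 0| <= K * e ^+ 2 &
      `|w 0 * (u' 0 + J q 0 * u 0 - w' 0) - (u 0 - w 0) * w' 0
        - (J q 0 * w 0 ^+ 2 - J (fun x => q x * w x ^+ 2) 0)
        - J (fun x => (J q x * w x) ^+ 2) 0| <= K * e ^+ 3].
Proof.
have [C0 _ _ hCS hCQ] := CC_parts.
have [K K0 HK] := half_line_expansion C0 b0.
have [B Bn0 HB] := real_jost_bound C0 b0.
exists K => // e q w w' u u' e0 e1 Hq jw ju.
have e0' := ltW e0.
have M20 : 0 <= 2 * Mt by exact: mulr_ge0.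
have mq := oscillation_mlb b0 HM Hq.
have bq x := oscillation_le HM x Hq.
have tq : tail b q by apply: (tail_dec b0 M20).
have pJ := J_prim b0 tq.
have bJ x : `|J q x| <= CC * e * expR (- (b * x)).
  apply: (le_trans (J_oscillation_le b0 th0 HM x e0 Hq)).
  by rewrite ler_wpM2r ?expR_ge0// ler_wpM2r.
have bJJ x : `|J (J q) x| <= CC * e ^+ 2 * expR (- (b * x)).
  apply: (le_trans (JJ_oscillation_le b0 th0 HM x e0 Hq)).
  by rewrite ler_wpM2r ?expR_ge0// ler_wpM2r// exprn_ge0.
have mJ := prim_mlb pJ.
have tJ : tail b (J q) by split; [case: mJ|move=> x; exists (CC * e) => y _].
have pS : prim (fun x => - J q x) q.
  by apply: eq_prim (primN pJ) => x; rewrite opprK.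
have pQ : prim (J (J q)) (fun x => - J q x) by exact: J_prim b0 tJ.
have bS x : 0 <= x -> `|- J q x| <= CC * e * expR (- (b * x)) by rewrite normrN.
have [h1 h2 h3] := HK qav q _ _ w w' u u' e e0' e1 potential_qav (potential_oscillation Hq)
  pS pQ bS (fun x _ => bJJ x) jw ju.
have pw := rj_prim jw; have pw' := rj_prim' jw.
have mw := prim_mlb pw; have mw' := prim_mlb pw'.
have bw x : 0 <= x -> `|w x| <= B by move=> x0; case: (HB _ _ _ potential_qav jw x x0).
have bw' x : 0 <= x -> `|w' x| <= B.
  move=> x0; case: (HB _ _ _ potential_qav jw x x0) => _ /le_trans; apply.
  by rewrite -[leRHS]mulr1 ler_wpM2l// -expR0 ler_expR oppr_le0 mulr_ge0// ltW.
have BB : 0 <= B * B by exact: mulr_ge0.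
have bw2 x : 0 <= x -> `|w x ^+ 2| <= B * B.
  by move=> x0; rewrite expr2 normrM; apply: ler_pM => //; exact: bw.
have mw2 : mlb (fun x => w x ^+ 2) by under eq_fun do rewrite expr2; exact: mlbM.
have tqw : tail b (fun x => q x * w x ^+ 2).
  apply: (@tail_intro R b (2 * Mt * (B * B))); [exact: mulr_ge0|exact: mlbM|].
  move=> x x0; rewrite normrM mulrAC; apply: ler_pM => //; last exact: bw2.
  by have := bq x; rewrite (ger0_norm x0).
have mww : mlb (fun x => 2 * (w x * w' x)) by apply: mlbZ; exact: mlbM.
have tSw : tail b (fun x => - J q x * (2 * (w x * w' x))).
  apply: (@tail_intro R b (CC * e * (2 * (B * B)))); first by rewrite !mulr_ge0.
    by apply: mlbM => //; exact: mlbN.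
  move=> x x0; rewrite normrM mulrAC; apply: ler_pM => //; first exact: bS.
  by rewrite normrM ger0_norm// ler_wpM2l// normrM; apply: ler_pM => //; [exact: bw|exact: bw'].
have pSw : prim (fun x => - J q x * w x ^+ 2) (fun x => q x * w x ^+ 2 + - J q x * (2 * (w x * w' x))).
  have := primM pS (primM pw pw).
  rewrite (_ : (fun x => - J q x * (w x * w x)) = (fun x => - J q x * w x ^+ 2)); last first.
    by apply/funext => x; rewrite expr2.
  by apply: eq_prim => x; ring.
have SE : - J q 0 * w 0 ^+ 2 = - (J (fun x => q x * w x ^+ 2) 0 + J (fun x => - J q x * (2 * (w x * w' x))) 0).
  have := @prim_J R b _ _ 0 (CC * e * (B * B)) b0 (tailD tqw tSw) pSw.
  rewrite (JD 0 b0 tqw tSw); apply => y y0.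
  by rewrite normrM mulrAC; apply: ler_pM => //; [exact: bS|exact: bw2].
have sN : u' 0 + J q 0 * u 0 - w' 0 = u' 0 - - J q 0 * u 0 - w' 0 by ring.
split => //.
- by have := bJ 0; rewrite mulr0 oppr0 expR0 mulr1.
- by rewrite sN.
rewrite sN.
have -> : J q 0 * w 0 ^+ 2 - J (fun x => q x * w x ^+ 2) 0 = J (fun x => - J q x * (2 * (w x * w' x))) 0.
  by move: SE; lra.
have -> : J (fun x => (J q x * w x) ^+ 2) 0 = J (fun x => (- J q x * w x) ^+ 2) 0.
  by apply: eq_J => x _; ring.
exact: h3.
Qed.

End HalfModes.

(** * Reflection, proportional Jost solutions and the resonant mode *)

Section Combine.
Context {R : realType}.
Implicit Types (x y : R) (f g q w U : R -> R).
Context (b th : R) (A_ B_ : nat -> R -> R) (M_ : nat -> R) (Mt : R) (lam : nat -> R).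
Context (b0 : 0 < b) (th0 : 0 < th) (HM : modes b th A_ B_ M_ Mt lam).
Context (Mq : R) (qav : R -> R) (wq : wk 1 b Mq qav).

Let Ao n x := A_ n (- x).
Let Bo n x := - B_ n (- x).

Lemma modes_oppx : modes b th Ao Bo M_ Mt lam.
Proof.
case: HM => hA hB hM hl hlB hlD; split => // n.
  exact/wk_oppx/hA.
exact/wkN/wk_oppx/hB.
Qed.

Lemma oscillation_oppx e q : oscillation A_ B_ lam e q -> oscillation Ao Bo lam e (fun x => q (- x)).
Proof.
move=> Hq x; have := Hq (- x).
rewrite (_ : (fun n => qsum Ao Bo lam e n x) = (fun n => qsum A_ B_ lam e n (- x)))//.
apply/funext => n; apply: eq_bigr => i _.
by rewrite /md mulrN cosN sinN mulrN mulNr.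
Qed.

Lemma jost_neq0 C U w w' : real_jost C b U w w' -> ~ (forall x, w x = 0).
Proof.
move=> jw w0; have := rj_eq jw 0; rewrite w0.
rewrite (_ : J _ 0 = 0); first by move=> /esym/eqP; rewrite addr0 oner_eq0.
by rewrite -[RHS](@J0 R 0); apply: eq_J => y _; rewrite w0 mulr0.
Qed.

Let wq0 : wk 0 b Mq qav := wk_succ wq.
Let wqo : wk 0 b Mq (fun x => qav (- x)) := wk_oppx wq0.

Let C1 := CC b th Mt Mq.

Let bqav x : `|qav x| <= Mq.
Proof.
apply: (le_trans (wk_bound x wq)); rewrite -[leRHS]mulr1 ler_wpM2l ?(wk_ge0 wq)//.
by rewrite -expR0 ler_expR oppr_le0 mulr_ge0// ltW.
Qed.

(** A vanishing Wronskian makes the Cauchy data at 0 of w and of the reflected v proportional, and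
    uniqueness extends this to all x. *)
Lemma jost_proportional w w' v v' : real_jost C1 b qav w w' ->
  real_jost C1 b (fun x => qav (- x)) v v' -> w 0 * v' 0 + v 0 * w' 0 = 0 ->
  exists2 k, k != 0 & forall x, v x = k * w (- x) /\ v' x = - k * w' (- x).
Proof.
move=> jw jv W0.
have pw := rj_prim jw; have pw' := rj_prim' jw.
have pg := prim_oppx (rj_prim jv).
have pg' : prim (fun x => - v' (- x)) (fun x => qav x * v (- x)).
  by apply: eq_prim (primN (prim_oppx (rj_prim' jv))) => x; rewrite opprK opprK.
(* The ratio is read off from w 0, or from w' 0 if w 0 = 0; both cannot vanish, as w would then be
   identically zero. *)
have [k k1 k2] : exists2 k, v 0 = k * w 0 & - v' 0 = k * w' 0.
  have [w0|w0] := eqVneq (w 0) 0; last first.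
    exists (v 0 / w 0); first by rewrite divfK.
    have : w 0 * v' 0 = - (v 0 * w' 0) by apply/eqP; rewrite -addr_eq0 W0.
    move=> h; have -> : v 0 / w 0 * w' 0 = (v 0 * w' 0) / w 0 by ring.
    have -> : v 0 * w' 0 = - v' 0 * w 0 by rewrite mulNr (mulrC (v' 0)) h opprK.
    by rewrite mulfK.
  have w'0 : w' 0 != 0.
    apply/eqP => w'0; apply: (jost_neq0 jw).
    exact: (schrodinger_zero pw pw' bqav w0 w'0).
  exists (- v' 0 / w' 0); last by rewrite divfK.
  move: W0; rewrite w0 mul0r add0r mulr0 => /eqP; rewrite mulf_eq0 (negbTE w'0) orbF => /eqP //.
have pd := primB pg (primZ k pw).
have pd' : prim (fun x => - v' (- x) - k * w' x) (fun x => qav x * (v (- x) - k * w x)).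
  by apply: eq_prim (primB pg' (primZ k pw')) => x; ring.
have d0 : v (- 0) - k * w 0 = 0 by rewrite oppr0 k1 subrr.
have d'0 : - v' (- 0) - k * w' 0 = 0 by rewrite oppr0 k2 subrr.
have D0 := schrodinger_zero pd pd' bqav d0 d'0.
have D'0 x : - v' (- x) - k * w' x = 0.
  apply: (prim_near0 pd); first exact: prim_continuous pd'.
  by exists 1 => //= y _; exact: D0.
have vE x : v x = k * w (- x).
  by have := D0 (- x); rewrite opprK => /eqP; rewrite subr_eq0 => /eqP.
exists k.
  apply/eqP => k0; apply: (jost_neq0 jv) => x.
  by rewrite vE k0 mul0r.
move=> x; split; first exact: vE.
have := D'0 (- x); rewrite opprK => /eqP; rewrite subr_eq0 => /eqP h.
by rewrite mulNr -h opprK.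
Qed.

Context (m : nat) (x0 : R) (AB0 : A_ m x0 ^+ 2 + B_ m x0 ^+ 2 != 0).

(** Otherwise w would vanish on an open set where the amplitude of mode m does not, hence
    everywhere. The point x1 has to avoid 0 because the energy is bounded below on one open
    half-line. *)
Lemma exists_resonance w w' : real_jost C1 b qav w w' ->
  exists2 x1, x1 != 0 & 0 < (A_ m x1 ^+ 2 + B_ m x1 ^+ 2) * w x1 ^+ 2.
Proof.
move=> jw; apply: contrapT => Hno.
have pw := rj_prim jw; have pw' := rj_prim' jw.
have cw' := prim_continuous pw'.
have hzero x : x != 0 -> A_ m x ^+ 2 + B_ m x ^+ 2 != 0 -> w x = 0.
  move=> xn0 an0; apply: contrapT => /eqP wn0; apply: Hno; exists x => //.
  rewrite mulr_gt0//; last by rewrite exprn_even_gt0.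
  by rewrite lt_neqAle eq_sym an0 addr_ge0// sqr_ge0.
case: (modes_A HM m) => _ [A' pA _]; case: (modes_B HM m) => _ [B' pB _].
have ca : continuous (fun x => A_ m x ^+ 2 + B_ m x ^+ 2).
  move=> x; under eq_fun do rewrite !expr2.
  exact: (prim_continuous (primD (primM pA pA) (primM pB pB))).
have na : \forall x \near x0, A_ m x ^+ 2 + B_ m x ^+ 2 != 0.
  exact: (@cvgr_neq0 R R^o R _ _ (fun x => A_ m x ^+ 2 + B_ m x ^+ 2) _ (ca x0) AB0).
have [x2 x2n0 nx2] : exists2 x2, x2 != 0 & \forall x \near x2, A_ m x ^+ 2 + B_ m x ^+ 2 != 0.
  have [x00|x0n] := eqVneq x0 0; last by exists x0.
  have [/= d d0 Hd] := na.
  exists (x0 + d / 2).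
    by rewrite x00 add0r gt_eqF// divr_gt0.
  exists (d / 2); first by rewrite /= divr_gt0.
  move=> x /= xd; apply: Hd => /=.
  have -> : x0 - x = (x0 + d / 2 - x) - d / 2 by ring.
  apply: (le_lt_trans (ler_normB _ _)).
  rewrite [`|d / 2|]ger0_norm ?divr_ge0 ?(ltW d0)//.
  by move: xd; move: `|_| => t; lra.
have nx : \forall x \near x2, x != 0.
  exists (`|x2|); first by rewrite /= normr_gt0.
  by move=> x /= h; apply: contraTneq h => ->; rewrite subr0 ltxx.
have nw : \forall x \near x2, w x = 0.
  by near=> x; apply: hzero; near: x.
have w0 : w x2 = 0 by exact: nbhs_singleton nw.
have w'0 : w' x2 = 0 by exact: prim_near0 pw cw' nw.
exact: (jost_neq0 jw) (schrodinger_zero pw pw' bqav w0 w'0).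
Unshelve. all: by end_near. Qed.

(** Each Jost solution is bounded on its own side; proportionality bounds w on all of R. Then w'' =
    q_av w, with one derivative of q_av, supplies the third derivative. *)
Lemma jost_wk w w' v v' k : real_jost C1 b qav w w' ->
  real_jost C1 b (fun x => qav (- x)) v v' -> k != 0 ->
  (forall x, v x = k * w (- x) /\ v' x = - k * w' (- x)) ->
  exists Mw, wk 3 0 Mw w.
Proof.
move=> jw jv k0 vE.
have C10 : 0 <= C1 := CC_ge0 b0 th0 HM wq0.
have [B B0 HB] := real_jost_bound C10 b0.
have pw := rj_prim jw; have pw' := rj_prim' jw.
have ex1 x : 0 <= x -> expR (- (b * x)) <= 1.
  by move=> xx; rewrite -expR0 ler_expR oppr_le0 mulr_ge0// ltW.
have B1 x : 0 <= x -> B * expR (- (b * x)) <= B.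
  by move=> xx; rewrite -[leRHS]mulr1 ler_wpM2l// ex1.
pose Mw := B + B / `|k|.
have Bk0 : 0 <= B / `|k| by rewrite divr_ge0.
have Mw0 : 0 <= Mw by rewrite /Mw addr_ge0.
have pqav := potential_qav b0 th0 HM wq0.
have pqavo := potential_qav b0 th0 HM wqo.
have kp : 0 < `|k| by rewrite normr_gt0.
have bw x : `|w x| <= Mw.
  have [xx|/ltW xx] := leP 0 x.
    by case: (HB _ _ _ pqav jw x xx) => h _; apply: (le_trans h); rewrite lerDl.
  have xx' : 0 <= - x by rewrite oppr_ge0.
  case: (HB _ _ _ pqavo jv (- x) xx') => h _.
  have [e _] := vE (- x); rewrite opprK in e.
  move: h; rewrite e normrM mulrC -ler_pdivlMr// => h.
  by apply: (le_trans h); rewrite lerDr.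
have bw' x : `|w' x| <= Mw.
  have [xx|/ltW xx] := leP 0 x.
    case: (HB _ _ _ pqav jw x xx) => _ h; apply: (le_trans h); apply: (le_trans (B1 x xx)); by rewrite lerDl.
  have xx' : 0 <= - x by rewrite oppr_ge0.
  case: (HB _ _ _ pqavo jv (- x) xx') => _ h.
  have {}h := le_trans h (B1 _ xx').
  have [_ e] := vE (- x); rewrite opprK in e.
  move: h; rewrite e normrM normrN mulrC -ler_pdivlMr// => h.
  by apply: (le_trans h); rewrite lerDr.
have z0 x : (0 : R) * x = 0 by rewrite mul0r.
have e0 (x : R) : expR (- (0 * `|x|)) = 1 by rewrite mul0r oppr0 expR0.
have w1 : wk 1 0 Mw w.
  split; first by move=> x; rewrite e0 mulr1.
  by exists w' => //; split; [move=> x; rewrite e0 mulr1|exact: prim_mlb pw'].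
have w2 : wk 1 0 (2 * (Mq * Mw)) (fun x => qav x * w x).
  by have := wk_weaken (ltW b0) (wkM wq w1); rewrite expr1.
have q0 : 0 <= 2 * (Mq * Mw) := wk_ge0 w2.
pose M' := Mw + 2 * (Mq * Mw).
have MM' : Mw <= M' by rewrite lerDl.
exists M'.
split; first by move=> x; rewrite e0 mulr1 (le_trans (bw x)).
exists w' => //; split; first by move=> x; rewrite e0 mulr1 (le_trans (bw' x)).
exists (fun x => qav x * w x) => //.
by apply: wk_le w2; rewrite lerDr.
Qed.

End Combine.

(** * The Wronskian of the perturbed potential *)

Section NonzeroWronskian.
Context {R : realType}.
Implicit Types (x y : R) (f g q w U : R -> R).

Lemma normM_le (a c A B : R) : `|a| <= A -> `|c| <= B -> `|a * c| <= A * B.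
Proof. by move=> hA hB; rewrite normrM; apply: ler_pM. Qed.

Lemma normD_le (a c A B : R) : `|a| <= A -> `|c| <= B -> `|a + c| <= A + B.
Proof. by move=> hA hB; apply: (le_trans (ler_normD _ _)); exact: lerD. Qed.

Lemma expr_le_prev (e K : R) n : 0 <= e -> e <= 1 -> 0 <= K -> K * e ^+ n.+1 <= K * e ^+ n.
Proof.
move=> e0 e1 K0; rewrite ler_wpM2l// exprS -[leRHS]mul1r ler_wpM2r//.
exact: exprn_ge0.
Qed.

(** Pure algebra on values at x = 0: z = u - w, y = u' + s u - w', s = J q 0 = - S(0). The letter v
    and those with a trailing t belong to the reflected problem. *)
Lemma wronskian_first_order (w w' v v' y yt z zt s st u u' ut ut' K C P e : R) :
  0 <= e -> e <= 1 -> 0 <= K -> 0 <= C ->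
  u = w + z -> ut = v + zt -> u' = w' + y - s * u -> ut' = v' + yt - st * ut ->
  `|w| <= P -> `|w'| <= P -> `|v| <= P -> `|v'| <= P ->
  `|z| <= K * e ^+ 2 -> `|zt| <= K * e ^+ 2 -> `|y| <= K * e ^+ 2 -> `|yt| <= K * e ^+ 2 ->
  `|s| <= C * e -> `|st| <= C * e ->
  `|u * ut' + ut * u' - (w * v' + v * w')| <= (4 * P * K + 2 * K ^+ 2 + 2 * C * (P + K) ^+ 2) * e.
Proof.
move=> e0 e1 K0 C0 uE utE u'E ut'E hw hw' hv hv' hz hzt hy hyt hs hst.
have Ke2 := expr_le_prev 1 e0 e1 K0; rewrite expr1 in Ke2.
have Ke : K * e <= K by rewrite -[leRHS]mulr1 ler_wpM2l.
have hz1 := le_trans hz Ke2; have hzt1 := le_trans hzt Ke2.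
have hy1 := le_trans hy Ke2; have hyt1 := le_trans hyt Ke2.
have hu : `|u| <= P + K by rewrite uE; apply: normD_le => //; exact: le_trans Ke.
have hut : `|ut| <= P + K by rewrite utE; apply: normD_le => //; exact: le_trans Ke.
have -> : u * ut' + ut * u' - (w * v' + v * w') =
   (z * v' + w * yt + zt * w' + v * y) + (z * yt + zt * y) + (- s + - st) * (u * ut).
  by rewrite u'E ut'E uE utE; ring.
have h1 := normD_le (normD_le (normD_le (normM_le hz1 hv') (normM_le hw hyt1))
  (normM_le hzt1 hw')) (normM_le hv hy1).
have h2 := normD_le (normM_le hz1 (le_trans hyt1 Ke)) (normM_le hzt1 (le_trans hy1 Ke)).
have hs' : `|- s| <= C * e by rewrite normrN.
have hst' : `|- st| <= C * e by rewrite normrN.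
have h3 := normM_le (normD_le hs' hst') (normM_le hu hut).
apply: (le_trans (normD_le (normD_le h1 h2) h3)).
by rewrite le_eqVlt; apply/orP; left; apply/eqP; ring.
Qed.

(** Same notation, with v = k w. The boundary terms s w^2 and st v^2, weighted by k and 1 / k, add
    up to k (s + st) w^2, which cancels the leading part of (s + st) u ut. All other products have
    order e^3. *)
Lemma wronskian_third_order (w w' v v' y yt z zt s st u u' ut ut' K K3 C P e k Jq Jqo J2 J2t : R) :
  0 <= e -> e <= 1 -> 0 <= K -> 0 <= C -> k != 0 ->
  v = k * w -> v' = - k * w' ->
  u = w + z -> ut = v + zt -> u' = w' + y - s * u -> ut' = v' + yt - st * ut ->
  `|w| <= P -> `|z| <= K * e ^+ 2 -> `|zt| <= K * e ^+ 2 -> `|y| <= K * e ^+ 2 ->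
  `|yt| <= K * e ^+ 2 -> `|s| <= C * e -> `|st| <= C * e ->
  `|w * y - z * w' - (s * w ^+ 2 - Jq) - J2| <= K * e ^+ 3 ->
  `|v * yt - zt * v' - (st * v ^+ 2 - k ^+ 2 * Jqo) - J2t| <= K * e ^+ 3 ->
  `|Jq + Jqo| <= K3 * e ^+ 3 ->
  `|u * ut' + ut * u' - k * (J2 + J2t / k ^+ 2)| <=
    (`|k| * K3 + `|k| * K + `|k|^-1 * K + 2 * K ^+ 2 + 2 * C * (P * K + `|k| * P * K + K ^+ 2)) * e ^+ 3.
Proof.
move=> e0 e1 K0 C0 k0 vE v'E uE utE u'E ut'E hw hz hzt hy hyt hs hst hD hDt hJ.
have Ke2 := expr_le_prev 1 e0 e1 K0; rewrite expr1 in Ke2.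
have Ke1 : K * e <= K by rewrite -[leRHS]mulr1 ler_wpM2l.
have hz1 := le_trans hz Ke2; have hzt1 := le_trans hzt Ke2.
have hz0 := le_trans hz1 Ke1.
set r := w * y - z * w' - _ - _ in hD; set rt := v * yt - _ - _ - _ in hDt.
have hk : `|k| <= `|k| by [].
have hkV : `|k^-1| <= `|k|^-1 by rewrite normfV.
have -> : u * ut' + ut * u' - k * (J2 + J2t / k ^+ 2) =
   k * (- (Jq + Jqo)) + k * r + k^-1 * rt + (z * yt + zt * y) +
   (- s + - st) * (w * zt + k * w * z + z * zt).
  rewrite u'E ut'E uE utE /r /rt vE v'E.
  by field.
have hJ' : `|- (Jq + Jqo)| <= K3 * e ^+ 3 by rewrite normrN.
have hs' : `|- s| <= C * e by rewrite normrN.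
have hst' : `|- st| <= C * e by rewrite normrN.
have h2 := normD_le (normM_le hz1 hyt) (normM_le hzt1 hy).
have h3 := normM_le (normD_le hs' hst')
  (normD_le (normD_le (normM_le hw hzt) (normM_le (normM_le hk hw) hz)) (normM_le hz0 hzt)).
have h := normD_le (normD_le (normD_le (normD_le (normM_le hk hJ') (normM_le hk hD)) (normM_le hkV hDt)) h2) h3.
by apply: (le_trans h); rewrite le_eqVlt; apply/orP; left; apply/eqP; ring.
Qed.

Context (b th : R) (A_ B_ : nat -> R -> R) (M_ : nat -> R) (Mt : R) (lam : nat -> R).
Context (b0 : 0 < b) (th0 : 0 < th) (HM : modes b th A_ B_ M_ Mt lam).
Context (Mq : R) (qav : R -> R) (wq : wk 1 b Mq qav).
Context (m : nat) (x0 : R) (AB0 : A_ m x0 ^+ 2 + B_ m x0 ^+ 2 != 0).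

Let wq0 : wk 0 b Mq qav := wk_succ wq.
Let wqo : wk 0 b Mq (fun x => qav (- x)) := wk_oppx wq0.
Let HMo := modes_oppx HM.
Let C1 := CC b th Mt Mq.

Lemma modes_wronskian : exists2 e0, 0 < e0 & forall e q u u' ut ut', 0 < e -> e <= e0 ->
  oscillation A_ B_ lam e q ->
  real_jost C1 b (fun x => qav x + q x) u u' ->
  real_jost C1 b (fun x => qav (- x) + q (- x)) ut ut' ->
  u 0 * ut' 0 + ut 0 * u' 0 != 0.
Proof.
have C10 : 0 <= C1 := CC_ge0 b0 th0 HM wq0.
have [w [w' jw]] := real_jost_exists C10 b0 (potential_qav b0 th0 HM wq0).
have [v [v' jv]] := real_jost_exists C10 b0 (potential_qav b0 th0 HM wqo).
have [Ka Ka0 HKa] := half_line_modes b0 th0 HM wq0.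
have [Kb Kb0 HKb] := half_line_modes b0 th0 HMo wqo.
pose K := Ka + Kb.
have K0 : 0 <= K by exact: addr_ge0.
have KaK : Ka <= K by rewrite lerDl.
have KbK : Kb <= K by rewrite lerDr.
pose P := `|w 0| + `|w' 0| + `|v 0| + `|v' 0|.
have [hw [hw' [hv hv']]] : `|w 0| <= P /\ `|w' 0| <= P /\ `|v 0| <= P /\ `|v' 0| <= P.
  exact: le_sum4.
have P0 : 0 <= P by exact: le_trans hw.
have data e q u u' ut ut' : 0 < e -> e <= 1 -> oscillation A_ B_ lam e q ->
  real_jost C1 b (fun x => qav x + q x) u u' ->
  real_jost C1 b (fun x => qav (- x) + q (- x)) ut ut' ->
  [/\ `|J q 0| <= C1 * e, `|u 0 - w 0| <= K * e ^+ 2,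
      `|u' 0 + J q 0 * u 0 - w' 0| <= K * e ^+ 2 &
      `|w 0 * (u' 0 + J q 0 * u 0 - w' 0) - (u 0 - w 0) * w' 0
        - (J q 0 * w 0 ^+ 2 - J (fun x => q x * w x ^+ 2) 0)
        - J (fun x => (J q x * w x) ^+ 2) 0| <= K * e ^+ 3] /\
  (let qo := fun x => q (- x) in
   [/\ `|J qo 0| <= C1 * e, `|ut 0 - v 0| <= K * e ^+ 2,
      `|ut' 0 + J qo 0 * ut 0 - v' 0| <= K * e ^+ 2 &
      `|v 0 * (ut' 0 + J qo 0 * ut 0 - v' 0) - (ut 0 - v 0) * v' 0
        - (J qo 0 * v 0 ^+ 2 - J (fun x => qo x * v x ^+ 2) 0)
        - J (fun x => (J qo x * v x) ^+ 2) 0| <= K * e ^+ 3]).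
  move=> e0 e1 Hq ju jut.
  have e20 : 0 <= e ^+ 2 by rewrite exprn_ge0// ltW.
  have e30 : 0 <= e ^+ 3 by rewrite exprn_ge0// ltW.
  have a2 : Ka * e ^+ 2 <= K * e ^+ 2 by rewrite ler_wpM2r.
  have a3 : Ka * e ^+ 3 <= K * e ^+ 3 by rewrite ler_wpM2r.
  have b2 : Kb * e ^+ 2 <= K * e ^+ 2 by rewrite ler_wpM2r.
  have b3 : Kb * e ^+ 3 <= K * e ^+ 3 by rewrite ler_wpM2r.
  have [h1 h2 h3 h4] := HKa e q w w' u u' e0 e1 Hq jw ju.
  have [g1 g2 g3 g4] := HKb e _ v v' ut ut' e0 e1 (oscillation_oppx Hq) jv jut.
  split; split => //.
  - exact: le_trans a2.
  - exact: le_trans a2.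
  - exact: le_trans a3.
  - exact: le_trans b2.
  - exact: le_trans b2.
  - exact: le_trans b3.
pose W0 := w 0 * v' 0 + v 0 * w' 0.
(* For q_av generic, the Wronskian moves by at most K' e, which is less than |W0|. The + 1 in the
   choice of e0 makes the comparison strict, as it does for [K4] in the other case. *)
have [W00|W00] := eqVneq W0 0; last first.
  pose K' := 4 * P * K + 2 * K ^+ 2 + 2 * C1 * (P + K) ^+ 2.
  have K'0 : 0 <= K'.
    have PK : 0 <= P + K by exact: addr_ge0.
    by rewrite /K' !addr_ge0// !mulr_ge0// exprn_ge0.
  have nW0 : 0 < `|W0| by rewrite normr_gt0.
  have K'1 : 0 < K' + 1 by rewrite ltr_wpDl.
  exists (Num.min 1 (`|W0| / 2 / (K' + 1))).
    by rewrite lt_min ltr01 !divr_gt0.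
  move=> e q u u' ut ut' e0; rewrite le_min => /andP[e1 ee] Hq ju jut.
  have [[h1 h2 h3 h4] [g1 g2 g3 g4]] := data e q u u' ut ut' e0 e1 Hq ju jut.
  have := @wronskian_first_order (w 0) (w' 0) (v 0) (v' 0) _ _ _ _ (J q 0) (J (fun x => q (- x)) 0)
    (u 0) (u' 0) (ut 0) (ut' 0) K C1 P e (ltW e0) e1 K0 C10 _ _ _ _ hw hw' hv hv' h2 g2 h3 g3 h1 g1.
  rewrite -/W0 -/K'; move=> H.
  have {}H : `|u 0 * ut' 0 + ut 0 * u' 0 - W0| <= K' * e by apply: H; ring.
  apply/eqP => Wz; rewrite Wz sub0r normrN in H.
  have : K' * e + 1 * e <= `|W0| / 2 by rewrite -mulrDl mulrC -ler_pdivlMr.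
  rewrite mul1r => h; have : `|W0| / 2 <= K' * e.
    by apply: le_trans H; rewrite ler_pdivrMr// ler_peMr// ler1n.
  by move=> /(le_trans h); rewrite gerDl leNgt e0.
have [k k0 vE] := jost_proportional b0 wq jw jv W00.
have [Mw ww3] := jost_wk b0 th0 HM wq jw jv k0 vE.
have [K3 K30 HK3] := oscillation_third_order b0 th0 HM ww3.
have [x1 x1n0 hx1] := exists_resonance b0 HM wq AB0 jw.
have ww1 : wk 1 0 Mw w := wk_leq (isT : (1 <= 3)%N) ww3.
have v3 : wk 3 0 (`|k| * Mw) v.
  have := wkZ k (wk_oppx ww3); congr wk; apply/funext => x.
  by have [-> _] := vE x.
have v1 : wk 1 0 (`|k| * Mw) v := wk_leq (isT : (1 <= 3)%N) v3.
have kp : 0 < `|k| by rewrite normr_gt0.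
have k2 : 0 < k ^+ 2 by rewrite exprn_even_gt0.
have cont A1 B1 M1 f M2 : wk 3 b M1 A1 -> wk 3 b M1 B1 -> wk 1 0 M2 f ->
    tail b (fun x => (A1 x ^+ 2 + B1 x ^+ 2) * f x ^+ 2) /\
    continuous (fun x => (A1 x ^+ 2 + B1 x ^+ 2) * f x ^+ 2).
  move=> hA hB hf.
  have AA := wk1_prod b0 (wk_leq (isT : (1 <= 3)%N) hA) (wk_leq (isT : (1 <= 3)%N) hA) hf.
  have BB := wk1_prod b0 (wk_leq (isT : (1 <= 3)%N) hB) (wk_leq (isT : (1 <= 3)%N) hB) hf.
  have := wkD AA BB; set MM := (X in wk _ _ X _).
  rewrite (_ : (fun x => A1 x * A1 x * f x ^+ 2 + B1 x * B1 x * f x ^+ 2) =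
    (fun x => (A1 x ^+ 2 + B1 x ^+ 2) * f x ^+ 2)); last by apply/funext => x; ring.
  move=> h; split; last by case: h => _ [h' /prim_continuous].
  by apply: (tail_dec b0 (wk_ge0 h)); [exact: wk_mlb h|move=> x; exact: wk_bound h].
have J2ge f q : 0 <= J (fun x => (J q x * f x) ^+ 2) 0.
  by apply: Rintegral_ge0 => x _; exact: sqr_ge0.
(* Both energies are nonnegative, so it is enough to bound the one on the half-line containing x1.
   On the left half-line v takes the place of w, which costs the factor k^2. *)
have [c c0 [e1 e10 Hc]] : exists2 c, 0 < c & exists2 e1, 0 < e1 & forall e q, 0 < e -> e <= e1 ->
    oscillation A_ B_ lam e q ->
    c * e ^+ 2 <= J (fun x => (J q x * w x) ^+ 2) 0 +
      J (fun x => (J (fun x => q (- x)) x * v x) ^+ 2) 0 / k ^+ 2.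
  have [x1p|x1m] := ltP 0 x1.
    have [tl ct] := cont _ _ _ _ _ (modes_A HM m) (modes_B HM m) ww1.
    have G0 := J_gt0 b0 tl ct (fun x => mulr_ge0 (addr_ge0 (sqr_ge0 _) (sqr_ge0 _)) (sqr_ge0 _)) x1p hx1.
    have [c c0 [e1 e10 Hc]] := oscillation_energy_lower b0 th0 HM ww1 G0.
    exists c => //; exists e1 => // e q e0 ee Hq; apply: (le_trans (Hc e q e0 ee Hq)).
    by rewrite lerDl divr_ge0// ltW.
  have x1p : 0 < - x1 by rewrite oppr_gt0 lt_neqAle x1n0.
  have [tl ct] := cont _ _ _ _ _ (modes_A HMo m) (modes_B HMo m) v1.
  have hx1' : 0 < (A_ m (- - x1) ^+ 2 + (- B_ m (- - x1)) ^+ 2) * v (- x1) ^+ 2.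
    have [-> _] := vE (- x1); rewrite !opprK sqrrN exprMn mulrCA.
    exact: mulr_gt0.
  have G0 := J_gt0 b0 tl ct (fun x => mulr_ge0 (addr_ge0 (sqr_ge0 _) (sqr_ge0 _)) (sqr_ge0 _)) x1p hx1'.
  have [c c0 [e1 e10 Hc]] := oscillation_energy_lower b0 th0 HMo v1 G0.
  exists (c / k ^+ 2); first exact: divr_gt0.
  exists e1 => // e q e0 ee Hq.
  have h := Hc e _ e0 ee (oscillation_oppx Hq).
  apply: (@le_trans _ _ (J (fun x => (J (fun x => q (- x)) x * v x) ^+ 2) 0 / k ^+ 2)).
    by rewrite mulrAC ler_wpM2r// invr_ge0 ltW.
  by rewrite lerDr.
pose K4 := `|k| * K3 + `|k| * K + `|k|^-1 * K + 2 * K ^+ 2 + 2 * C1 * (P * K + `|k| * P * K + K ^+ 2).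
have K40 : 0 <= K4.
  by rewrite /K4 !addr_ge0// ?mulr_ge0// ?invr_ge0// ?exprn_ge0// !addr_ge0// ?mulr_ge0// ?exprn_ge0.
have K41 : 0 < K4 + 1 by rewrite ltr_wpDl.
(* th is required by the third-order estimate, e1 by the energy bound, and the last term makes K4
   e^3 smaller than |k| c e^2. *)
exists (Num.min (Num.min 1 th) (Num.min e1 (`|k| * c / (K4 + 1)))).
  by rewrite !lt_min ltr01 th0 e10 divr_gt0// mulr_gt0.
move=> e q u u' ut ut' e0; rewrite !le_min => /andP[/andP[el1 eth] /andP[ee1 ee]] Hq ju jut.
have [[h1 h2 h3 h4] [g1 g2 g3 g4]] := data e q u u' ut ut' e0 el1 Hq ju jut.
have [v00 v'00] := vE 0; rewrite oppr0 in v00 v'00.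
have hJ := HK3 e q e0 eth Hq.
have JE : J (fun x => q (- x) * v x ^+ 2) 0 = k ^+ 2 * J (fun x => q (- x) * w (- x) ^+ 2) 0.
  have tl : tail b (fun x => q (- x) * w (- x) ^+ 2).
    have bo x := oscillation_le HM x Hq.
    have mo := mlb_oppx (oscillation_mlb b0 HM Hq).
    have ww2 := wkM (wk_succ ww1) (wk_succ ww1).
    have M20 : 0 <= 2 * Mt.
      by rewrite mulr_ge0//; apply: le_trans (modes_M HM 0); rewrite big_ord0.
    have bw2 x : `|w (- x) ^+ 2| <= 2 ^+ 0 * (Mw * Mw).
      by have := wk_bound (- x) ww2; rewrite mul0r oppr0 expR0 mulr1 -expr2.
    apply: (@tail_dec _ _ b0 (2 * Mt * (2 ^+ 0 * (Mw * Mw)))).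
    - by rewrite mulr_ge0//; exact: le_trans (bw2 0).
    - apply: mlbM => //; by have := mlb_oppx (wk_mlb ww2).
    - apply: dec_mul => //; first exact: le_trans (bw2 0).
      by move=> x; have := bo (- x); rewrite normrN.
  rewrite -(JZ _ 0 b0 tl); apply: eq_J => x _.
  by have [-> _] := vE x; ring.
rewrite /= JE in g4.
have := @wronskian_third_order (w 0) (w' 0) (v 0) (v' 0) _ _ _ _ (J q 0) (J (fun x => q (- x)) 0)
    (u 0) (u' 0) (ut 0) (ut' 0) K K3 C1 P e k _ _ _ _ (ltW e0) el1 K0 C10 k0 v00 v'00 _ _ _ _
    hw h2 g2 h3 g3 h1 g1 h4 g4 hJ.
rewrite -/K4 => H.
have {}Hc := Hc e q e0 ee1 Hq.
apply/eqP => Wz.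
have {}H : `|u 0 * ut' 0 + ut 0 * u' 0 - k * (J (fun x => (J q x * w x) ^+ 2) 0 +
      J (fun x => (J (fun x => q (- x)) x * v x) ^+ 2) 0 / k ^+ 2)| <= K4 * e ^+ 3 by apply: H; ring.
rewrite Wz sub0r normrN normrM in H.
have e2 : 0 < e ^+ 2 by exact: exprn_gt0.
have h5 : `|k| * (c * e ^+ 2) <= K4 * e ^+ 3.
  apply: le_trans H; rewrite ler_wpM2l//.
  by apply: (le_trans Hc); exact: ler_norm.
have h6 : `|k| * c <= K4 * e.
  by rewrite -(ler_pM2r e2) -!mulrA -exprS.
have h7 : K4 * e + 1 * e <= `|k| * c by rewrite -mulrDl mulrC -ler_pdivlMr.
by have := le_trans h7 h6; rewrite mul1r gerDl leNgt e0.
Qed.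

End NonzeroWronskian.

(** * Weak derivatives and the Hypotheses (V) *)

Section WeakDerivatives.
Context {R : realType}.
Implicit Types (a c x y : R) (f g h F G P : R -> R).

Local Notation mu := (@lebesgue_measure R).

Lemma mlb_locally_integrable f : mlb f -> locally_integrable setT f.
Proof.
move=> mf; split => //; [by case: mf|exact: openT|].
move=> K _ cK.
have mK : measurable K by exact: compact_measurable.
have [M [_ HM]] := compact_bounded cK.
have [L HL] := mf.2 (`|M| + 1).
have : mu.-integrable K (EFin \o f).
  apply: measurable_bounded_integrable => //.
  - exact: compact_finite_measure.
  - by apply: measurable_funTS; case: mf.
  - exists L; split; first exact: num_real.
    move=> z Lz x Kx; apply: le_trans (ltW Lz); apply: HL; apply: HM => //.
    by rewrite (le_lt_trans (ler_norm _))// ltrDl.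
by move=> /integrableP[].
Qed.

(** Lebesgue differentiation of the vanishing integral from - n, for every natural number n. *)
Lemma prim0_ae P : prim (fun=> 0) P -> {ae mu, forall x, P x = 0}.
Proof.
move=> [mP HP].
have lP := mlb_locally_integrable mP.
have H (n : nat) : {ae mu, forall x, - n%:R < x -> P x = 0}.
  have int (y : R) : mu.-integrable `[(- n%:R), y] (EFin \o P) by exact: mlb_integrable.
  have := FTC1 int lP; apply: aeS => x /= {}H nx.
  have [_ <-] := H nx.
  have E : \forall y \near x, \int[mu]_(t in `[(- n%:R), y]) P t = 0.
    near=> y; rewrite -HP ?subrr//; apply: ltW; near: y.
    exact: lt_nbhsr.
  have -> : derive1 (fun y => \int[mu]_(t in `[(- n%:R), y]) P t) x = derive1 (fun=> 0 : R) x.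
    by rewrite !derive1E; exact: near_eq_derive.
  by rewrite derive1_cst.
have /ae_foralln := H; apply: aeS => x Hx.
have [n nx] : exists n : nat, `|x| < n%:R.
  by exists (Num.truncn `|x|).+1; exact: truncnS_gt.
apply: (Hx n); rewrite ltrNl; apply: le_lt_trans nx.
by rewrite -normrN ler_norm.
Unshelve. all: by end_near. Qed.


(** The positive part of x - c. Its half square is C^1, which is the regularity asked of test
    functions. *)
Definition ramp c x : R := (x - c + `|x - c|) / 2.

Lemma rampE c x : c <= x -> ramp c x = x - c.
Proof. by move=> cx; rewrite /ramp ger0_norm ?subr_ge0//; field. Qed.

Lemma ramp0 c x : x <= c -> ramp c x = 0.
Proof. by move=> xc; rewrite /ramp ler0_norm ?subr_le0// subrr mul0r. Qed.

Lemma continuous_ramp c : continuous (ramp c).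
Proof.
move=> x; apply: cvgM; last exact: cvg_cst.
have h : (fun y => y - c) y @[y --> x] --> x - c by apply: cvgB; [exact: cvg_id|exact: cvg_cst].
by apply: cvgD => //; exact: cvg_norm.
Qed.

Lemma prim_ramp_sqr c : prim (fun x => ramp c x ^+ 2 / 2) (ramp c).
Proof.
have rc : continuous (ramp c) by exact: continuous_ramp.
split; first exact: mlb_continuous.
have p : prim (fun x => (x - c) ^+ 2 / 2) (fun x => x - c).
  have pi := primB (prim_id (R := R)) (prim_cst c).
  have := primZ 2^-1 (primM pi pi); congr prim; apply/funext => x; first by rewrite mulrC expr2.
  by rewrite subr0; field.
have H0 a b : a <= b -> b <= c -> ramp c b ^+ 2 / 2 - ramp c a ^+ 2 / 2 = \int[mu]_(x in `[a, b]) ramp c x.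
  move=> ab bc; rewrite !ramp0//; last exact: le_trans bc.
  have [_ /(_ a b ab)] := prim_cst (R := R) 0; rewrite expr0n /= mul0r => ->; apply: eq_Rintegral => x.
  by rewrite inE /= in_itv /= => /andP[_ xb]; rewrite ramp0// (le_trans xb).
have H1 a b : c <= a -> a <= b -> ramp c b ^+ 2 / 2 - ramp c a ^+ 2 / 2 = \int[mu]_(x in `[a, b]) ramp c x.
  move=> ca ab; rewrite !rampE//; last exact: le_trans ab.
  rewrite p.2//; apply: eq_Rintegral => x.
  by rewrite inE /= in_itv /= => /andP[ax _]; rewrite rampE// (le_trans ca).
move=> a b ab.
have [bc|/ltW cb] := leP b c; first exact: H0.
have [ca|/ltW ac] := leP c a; first exact: H1.
rewrite (Rint_split (mlb_continuous rc) ac cb) -(H0 a c)// -(H1 c b)//; ring.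
Qed.

Lemma tail_shiftM a c f : 0 < a -> tail a f -> tail (a / 2) (fun y => (y - c) * f y).
Proof.
move=> a0 tf; have [M M0 HM] := tail_bound 0 a0 tf.
have [t _] := J_linear_bound a0 (tail_mlb a0 tf) (lexx 0) M0 HM.
have := tailB t (tailZ c (tail_half a0 tf)).
by congr tail; apply/funext => y; ring.
Qed.

Lemma tail_J a f : 0 < a -> tail a f -> tail a (J f).
Proof.
move=> a0 tf; split; first by case: (prim_mlb (J_prim a0 tf)).
move=> x; have [M M0 HM] := tail_bound x a0 tf; exists (M / a) => y xy.
apply: J_bound => //; first by case: tf.
by move=> z yz; apply: HM; exact: le_trans yz.
Qed.

(** Taylor's formula based at +oo, proved by an explicit antiderivative instead of Fubini. The
    right-hand side is the pairing of g with [ramp c] and of h with its half square. *)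
Lemma J_taylor a g h c : 0 < a -> tail a g -> tail a h ->
  J (J (fun x => g x + J h x)) c =
  J (fun y => (y - c) * g y) c + J (fun y => (y - c) ^+ 2 / 2 * h y) c.
Proof.
move=> a0 tg th; have a2 : 0 < a / 2 by rewrite divr_gt0.
have a4 : 0 < a / 2 / 2 by rewrite divr_gt0.
pose K x := g x + J h x.
have tJh := tail_J a0 th.
have tK : tail a K := tailD tg tJh.
have tJK := tail_J a0 tK; have tJJK := tail_J a0 tJK.
have sqE f : (fun y => (y - c) ^+ 2 / 2 * f y) = (fun y => 2^-1 * ((y - c) * ((y - c) * f y))).
  by apply/funext => y; field.
have t1 f : tail a f -> tail (a / 2 / 2) (fun y => (y - c) * f y).
  by move=> tf; apply: tail_half => //; exact: tail_shiftM.
have t2 f : tail a f -> tail (a / 2 / 2) (fun y => (y - c) ^+ 2 / 2 * f y).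
  by move=> tf; rewrite sqE; apply: tailZ; apply: tail_shiftM => //; exact: tail_shiftM.
pose F y := (y - c) * J K y + J (J K) y + (y - c) ^+ 2 / 2 * J h y.
have tF : tail (a / 2 / 2) F.
  apply: tailD; last exact: t2.
  by apply: tailD; [exact: t1|do 2!apply: tail_half => //].
have pi := primB (prim_id (R := R)) (prim_cst c).
have p : prim F (fun y => - ((y - c) * g y + (y - c) ^+ 2 / 2 * h y)).
  have p1 := primM pi (J_prim a0 tK).
  have p2 := primM (primZ 2^-1 (primM pi pi)) (J_prim a0 th).
  have p3 := primD (primD p1 (J_prim a0 tJK)) p2.
  move: p3; rewrite (_ : (fun y => _) = F); last first.
    by apply/funext => y; rewrite /F; field.
  by apply: eq_prim => y; rewrite /K; field.
have [M _ HM] := tail_bound c a4 tF.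
have tgh := tailD (t1 _ tg) (t2 _ th).
have := prim_J a4 (tailN tgh) p HM.
rewrite (JN _ a4 tgh) opprK (JD _ a4 (t1 _ tg) (t2 _ th)) => <-.
by rewrite /F subrr expr0n /= !mul0r add0r addr0.
Qed.

(** With s = y - x the three shifted arguments are at least y, so their values vanish in the limit y
    -> +oo. *)
Lemma third_difference_eq0 a K F : 0 < a -> (forall x, 0 <= x -> `|F x| <= K * expR (- (a * x))) ->
  (forall x s, 0 < s -> F x = 3 * F (x + s) - 3 * F (x + 2 * s) + F (x + 3 * s)) ->
  forall x, F x = 0.
Proof.
move=> a0 HK HF x; apply/eqP; rewrite -normr_le0.
have cv : 7 * K * expR (- (a * y)) @[y --> +oo] --> 7 * K * 0.
  by apply: cvgM; [exact: cvg_cst|exact: expR_cvg0].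
rewrite mulr0 in cv.
apply: (ler_cvg_to (cvg_cst _) cv).
near=> y.
have y0 : 0 <= y by near: y; apply: nbhs_pinfty_ge; rewrite num_real.
have yx : x < y by near: y; apply: nbhs_pinfty_gt; rewrite num_real.
have K0 : 0 <= K.
  by have := HK 0 (lexx _); rewrite mulr0 oppr0 expR0 mulr1; exact: le_trans.
have b z : y <= z -> `|F z| <= K * expR (- (a * y)).
  move=> yz; apply: (le_trans (HK z (le_trans y0 yz))).
  by rewrite ler_wpM2l// ler_expR lerN2 ler_pM2l.
have s0 : 0 < y - x by rewrite subr_gt0.
rewrite (HF x _ s0).
have b1 := b (x + (y - x)) ltac:(lra).
have b2 := b (x + 2 * (y - x)) ltac:(lra).
have b3 := b (x + 3 * (y - x)) ltac:(lra).
apply: (le_trans (ler_normD _ _)); apply: (@le_trans _ _ (6 * (K * expR (- (a * y))) + K * expR (- (a * y)))); last first.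
  by rewrite le_eqVlt; apply/orP; left; apply/eqP; ring.
apply: lerD b3; apply: (le_trans (ler_normB _ _)); rewrite !normrM !(@ger0_norm _ 3)//.
by move: b1 b2; set u := `|_|; set v := `|_|; set w := K * _; clear; lra.
Unshelve. all: by end_near. Qed.


Lemma integral_supported a c f g : 0 < a -> tail a g -> (forall y, c <= y -> f y = g y) ->
  (forall y, y <= c -> f y = 0) ->
  mu.-integrable setT (EFin \o f) /\ \int[mu]_x f x = J g c.
Proof.
move=> a0 tg fg f0.
have E : f = g \_ `[c, +oo[.
  apply/funext => y; rewrite patchE; case: ifPn => [|/negP h].
    by rewrite inE /= in_itv /= andbT; exact: fg.
  by apply: f0; rewrite leNgt; apply/negP => /ltW cy; apply: h; rewrite inE /= in_itv /= andbT.
split; last by rewrite E -Rintegral_mkcond.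
have -> : EFin \o f = (EFin \o g) \_ `[c, +oo[.
  by apply/funext => y; rewrite E /= !patchE; case: ifP.
by rewrite -(@integrable_mkcond _ _ _ mu `[c, +oo[ (EFin \o g))//; exact: tail_integrable a0 tg.
Qed.

Lemma integral_third_difference (F : R -> R -> R) a s :
  (forall c, mu.-integrable setT (EFin \o F c)) ->
  \int[mu]_x (F a x - 3 * F (a + s) x + 3 * F (a + 2 * s) x - F (a + 3 * s) x) =
  \int[mu]_x F a x - 3 * \int[mu]_x F (a + s) x + 3 * \int[mu]_x F (a + 2 * s) x
  - \int[mu]_x F (a + 3 * s) x.
Proof.
move=> iF.
have i3 c : mu.-integrable setT (EFin \o (fun x => 3 * F c x)).
  rewrite (_ : EFin \o _ = (fun x => 3%:E * (F c x)%:E)%E); last by apply/funext.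
  exact: (integrableZl measurableT 3 (iF c)).
have iD f g : mu.-integrable setT (EFin \o f) -> mu.-integrable setT (EFin \o g) ->
    mu.-integrable setT (EFin \o (fun x => f x + g x)).
  move=> i j; rewrite (_ : EFin \o _ = ((EFin \o f) \+ (EFin \o g))%E); last by apply/funext => x; rewrite /= EFinD.
  exact: integrableD.
have iB f g : mu.-integrable setT (EFin \o f) -> mu.-integrable setT (EFin \o g) ->
    mu.-integrable setT (EFin \o (fun x => f x - g x)).
  move=> i j; rewrite (_ : EFin \o _ = ((EFin \o f) \- (EFin \o g))%E); last by apply/funext => x; rewrite /= EFinB.
  exact: integrableB.
rewrite RintegralB//; last exact/iD/i3/iB/i3.
rewrite RintegralD//; last exact/iB/i3.
rewrite RintegralB// !RintegralZl//.
Qed.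

(** Third differences annihilate quadratic polynomials, so the combination vanishes beyond a + 3 s
    as well as before a: it has compact support. *)
Lemma ramp_test_function a s : 0 < s ->
  let phi x := ramp a x ^+ 2 / 2 - 3 * (ramp (a + s) x ^+ 2 / 2) +
    3 * (ramp (a + 2 * s) x ^+ 2 / 2) - ramp (a + 3 * s) x ^+ 2 / 2 in
  test_function phi /\ derive1 phi =
    (fun x => ramp a x - 3 * ramp (a + s) x + 3 * ramp (a + 2 * s) x - ramp (a + 3 * s) x).
Proof.
move=> s0 phi.
set psi := (X in _ = X).
have p : prim phi psi.
  exact: primB (primD (primB (prim_ramp_sqr _) (primZ 3 (prim_ramp_sqr _)))
    (primZ 3 (prim_ramp_sqr _))) (prim_ramp_sqr _).
have cr c := @continuous_ramp c.
have cp : continuous psi.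
  by move=> x; apply: cvgB; last exact: cr; apply: cvgD; first (apply: cvgB; first exact: cr);
    apply: cvgM; [exact: cvg_cst|exact: cr|exact: cvg_cst|exact: cr].
have dE : derive1 phi = psi by apply/funext => x; case: (prim_derive p cp x).
split; last exact: dE.
split.
- by move=> x; case: (prim_derive p cp x).
- by rewrite dE.
- exists (`|a| + `|a + 3 * s|) => x hx; rewrite /phi.
  have [xa|ax] := leP x a; first by rewrite !ramp0 ?expr0n /=; [ring|lra..].
  have h1 := ler_norm (a + 3 * s); have h2 := ler_norm (- a); rewrite normrN in h2.
  have [bx|xb] := leP (a + 3 * s) x; first by rewrite !rampE; [field|lra..].
  exfalso; move: hx; apply/negP; rewrite -leNgt ler_norml; apply/andP; split.
    by have := normr_ge0 (a + 3 * s); move: h2; set u := `|a|; set v := `|_|; move: ax; clear; lra.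
  by have := normr_ge0 a; move: h1 xb; set u := `|a|; set v := `|_|; clear; lra.
Qed.

Definition weak_der g h : Prop := forall phi, test_function phi ->
  \int[mu]_x (g x * derive1 phi x) = - \int[mu]_x (h x * phi x).

(* Testing against third differences of [ramp c ^+ 2 / 2] in [c] shows that the
   second tail integral of [g + J h] has vanishing third differences; it decays,
   so it is zero. *)
Lemma du_bois_reymond a g h : 0 < a -> tail a g -> tail a h -> weak_der g h ->
  {ae mu, forall x, g x = - J h x}.
Proof.
move=> a0 tg th weak.
have a2 : 0 < a / 2 by rewrite divr_gt0.
have a4 : 0 < a / 2 / 2 by rewrite divr_gt0.
have tg1 c : tail (a / 2) (fun y => (y - c) * g y) := tail_shiftM c a0 tg.
have th2 c : tail (a / 2 / 2) (fun y => (y - c) ^+ 2 / 2 * h y).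
  rewrite (_ : (fun y => _) = (fun y => 2^-1 * ((y - c) * ((y - c) * h y)))).
    by apply: tailZ; apply: tail_shiftM => //; exact: tail_shiftM.
  by apply/funext => y; field.
have [Ig Eg] : (forall c, mu.-integrable setT (EFin \o (fun y => g y * ramp c y))) /\
    (forall c, \int[mu]_y (g y * ramp c y) = J (fun y => (y - c) * g y) c).
  have H c : mu.-integrable setT (EFin \o (fun y => g y * ramp c y)) /\
      \int[mu]_y (g y * ramp c y) = J (fun y => (y - c) * g y) c.
    apply: (integral_supported a2 (tg1 c)) => y cy; first by rewrite rampE// mulrC.
    by rewrite ramp0// mulr0.
  by split => c; case: (H c).
have [Ih Eh] : (forall c, mu.-integrable setT (EFin \o (fun y => h y * (ramp c y ^+ 2 / 2)))) /\
    (forall c, \int[mu]_y (h y * (ramp c y ^+ 2 / 2)) = J (fun y => (y - c) ^+ 2 / 2 * h y) c).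
  have H c : mu.-integrable setT (EFin \o (fun y => h y * (ramp c y ^+ 2 / 2))) /\
      \int[mu]_y (h y * (ramp c y ^+ 2 / 2)) = J (fun y => (y - c) ^+ 2 / 2 * h y) c.
    apply: (integral_supported a4 (th2 c)) => y cy; first by rewrite rampE// mulrC.
    by rewrite ramp0// expr0n /= mul0r mulr0.
  by split => c; case: (H c).
pose K x := g x + J h x.
have tK : tail a K := tailD tg (tail_J a0 th).
have tJK := tail_J a0 tK.
have T3 x s : 0 < s -> J (J K) x = 3 * J (J K) (x + s) - 3 * J (J K) (x + 2 * s) + J (J K) (x + 3 * s).
  move=> s0; have [tphi dphi] := ramp_test_function x s0.
  have eg := integral_third_difference x s Ig; rewrite !Eg in eg.
  have eh := integral_third_difference x s Ih; rewrite !Eh in eh.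
  have := weak _ tphi; rewrite dphi.
  under eq_Rintegral => y _ do rewrite mulrBr mulrDr mulrBr !(mulrCA (g y) 3).
  under [in RHS]eq_Rintegral => y _ do rewrite mulrBr mulrDr mulrBr !(mulrCA (h y) 3).
  rewrite eg eh !(J_taylor _ a0 tg th); clear.
  set x1 := J _ x; set x2 := J _ x; set x3 := J _ _; set x4 := J _ _.
  set x5 := J _ _; set x6 := J _ _; set x7 := J _ _; set x8 := J _ _.
  lra.
have [M M0 HM] := tail_bound 0 a0 (tail_J a0 tJK).
have JJ0 : J (J K) = fun=> 0 by apply/funext; apply: (third_difference_eq0 a0 HM T3).
have JK0 : J K = fun=> 0.
  apply/funext => x; have p := J_prim a0 tJK; rewrite JJ0 in p.
  have cJ : continuous (fun y => - J K y).
    by move=> y; apply: cvgN; exact: (prim_continuous (J_prim a0 tK)).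
  have [_] := prim_derive p cJ x.
  by rewrite derive1_cst => /esym/eqP; rewrite oppr_eq0 => /eqP.
have p := J_prim a0 tK; rewrite JK0 in p.
apply: aeS (prim0_ae p) => x /eqP; rewrite /K oppr_eq0 addr_eq0 => /eqP.
exact.
Qed.

End WeakDerivatives.

(** * Regular representatives of weakly differentiable functions *)

Section Representatives.
Context {R : realType}.
Implicit Types (b x y M : R) (f g h F G : R -> R) (d : nat -> R -> R).

Local Notation mu := (@lebesgue_measure R).

Lemma aeI (P Q : R -> Prop) : {ae mu, forall x, P x} -> {ae mu, forall x, Q x} ->
  {ae mu, forall x, P x /\ Q x}.
Proof. by apply: filterS2; first exact: (ae_filter_ringOfSetsType mu). Qed.

Lemma eq_ae_Rintegral (D : set R) f g : measurable D ->
  measurable_fun setT f -> measurable_fun setT g -> {ae mu, forall x, f x = g x} ->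
  \int[mu]_(x in D) f x = \int[mu]_(x in D) g x.
Proof.
move=> mD mf mg fg; congr fine; apply: ae_eq_integral => //.
- by apply/measurable_EFinP; exact: measurable_funTS.
- by apply/measurable_EFinP; exact: measurable_funTS.
- by apply: aeS fg => x -> _.
Qed.

Lemma ae_continuous_eq0 h : continuous h -> {ae mu, forall x, h x = 0} -> forall x, h x = 0.
Proof.
move=> ch h0 x.
have p : prim (fun=> 0) h.
  split=> [|a b _]; first exact: mlb_continuous.
  rewrite (@eq_ae_Rintegral _ h (fun=> 0))//.
  - by rewrite Rintegral_cst// mul0r subrr.
  - exact: continuous_measurable_fun.
by have [_ <-] := prim_derive p ch x; rewrite derive1_cst.
Qed.

Lemma ae_continuous_le F G : continuous F -> continuous G ->
  {ae mu, forall x, F x <= G x} -> forall x, F x <= G x.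
Proof.
move=> cF cG FG x.
pose h y := F y - G y + `|F y - G y|.
have ch : continuous h.
  move=> y; have c : (fun z => F z - G z) z @[z --> y] --> F y - G y.
    by apply: cvgB; [exact: cF|exact: cG].
  by apply: cvgD => //; exact: cvg_norm.
have : h x = 0.
  apply: (ae_continuous_eq0 ch); apply: aeS FG => y.
  by rewrite /h -subr_le0 => yy; rewrite ler0_norm// subrr.
rewrite /h => /eqP; rewrite addr_eq0 => /eqP E.
by rewrite -subr_le0 E oppr_le0.
Qed.

Lemma continuous_expR_decay b M : continuous (fun x => M * expR (- (b * `|x|))).
Proof.
move=> x; apply: cvgM; first exact: cvg_cst.
apply: continuous_cvg; first exact: continuous_expR.
apply: cvgN; apply: cvgM; first exact: cvg_cst.
by apply: cvg_norm; exact: cvg_id.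
Qed.

(** Truncating g between - B and B changes it on a null set only and makes the bound hold at every
    point. *)
Lemma ae_bounded_version b M g : 0 < b -> 0 <= M -> measurable_fun setT g ->
  {ae mu, forall x, `|g x| <= M * expR (- (b * `|x|))} ->
  exists2 G, wk 0 b M G & {ae mu, forall x, g x = G x}.
Proof.
move=> b0 M0 mg gM.
pose B x := M * expR (- (b * `|x|)).
have B0 x : 0 <= B x by rewrite mulr_ge0// expR_ge0.
have mB : measurable_fun setT B.
  by apply: continuous_measurable_fun; exact: continuous_expR_decay.
pose G x := Num.max (- B x) (Num.min (g x) (B x)).
have mG : measurable_fun setT G.
  apply: measurable_maxr; last exact: measurable_minr.
  exact: measurableT_comp (@oppr_measurable _ _) mB.
have bG x : `|G x| <= B x.
  rewrite ler_norml /G; apply/andP; split; first by rewrite le_max lexx.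
  by rewrite ge_max ge_min lexx orbT andbT (le_trans _ (B0 x))// oppr_le0.
exists G; first by split => //; exact: mlbU mG M0 b0 bG.
apply: aeS gM => x; rewrite -/(B x) ler_norml => /andP[h1 h2].
by rewrite /G (min_idPl h2) (max_idPr h1).
Qed.

(** Built downwards from the top derivative, which is merely truncated: each lower one is replaced
    by - J F' for the next one F', with which it agrees almost everywhere. Continuity then turns the
    almost everywhere bound into a bound everywhere. *)
Lemma wk_representative k b M d : 0 < b -> 0 <= M ->
  (forall l, (l <= k)%N -> measurable_fun setT (d l)) ->
  (forall l, (l <= k)%N -> {ae mu, forall x, `|d l x| <= M * expR (- (b * `|x|))}) ->
  (forall l, (l < k)%N -> weak_der (d l) (d l.+1)) ->
  exists2 F, wk k b M F & {ae mu, forall x, d 0%N x = F x}.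
Proof.
move=> b0 M0; elim: k d => [|k IH] d md dM dw.
  by apply: ae_bounded_version => //; [exact: md|exact: dM].
have [G wG dG] := ae_bounded_version b0 M0 (md 0%N isT) (dM 0%N isT).
have [F' wF' dF'] := IH (fun l => d l.+1) (fun l => md l.+1) (fun l => dM l.+1) (fun l => dw l.+1).
have tG : tail b G := tail_dec b0 M0 (wk_mlb wG) (fun x => wk_bound x wG).
have tF' : tail b F' := tail_dec b0 M0 (wk_mlb wF') (fun x => wk_bound x wF').
have weak : weak_der G F'.
  move=> phi tphi; have [dphi cphi _] := tphi.
  have m1 : measurable_fun setT (derive1 phi) by exact: continuous_measurable_fun.
  have m0 : measurable_fun setT phi.
    apply: continuous_measurable_fun => x; apply: differentiable_continuous.
    exact/derivable1_diffP.
  have e1 : \int[mu]_x (G x * derive1 phi x) = \int[mu]_x (d 0%N x * derive1 phi x).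
    apply: eq_ae_Rintegral => //.
    - by apply: measurable_funM => //; case: (wk_mlb wG).
    - by apply: measurable_funM => //; exact: md.
    - by apply: aeS dG => x ->.
  have e2 : \int[mu]_x (F' x * phi x) = \int[mu]_x (d 1%N x * phi x).
    apply: eq_ae_Rintegral => //.
    - by apply: measurable_funM => //; case: (wk_mlb wF').
    - by apply: measurable_funM => //; exact: md.
    - by apply: aeS dF' => x ->.
  by rewrite e1 e2; exact: dw.
have GJ := du_bois_reymond b0 tG tF' weak.
have p : prim (fun x => - J F' x) F'.
  by apply: eq_prim (primN (J_prim b0 tF')) => x; rewrite opprK.
have dJ : {ae mu, forall x, d 0%N x = - J F' x}.
  by apply: aeS (aeI dG GJ) => x [-> ->].
exists (fun x => - J F' x) => //; split; last by exists F'.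
apply: ae_continuous_le.
- have c := prim_continuous p.
  by move=> x; apply: cvg_norm; exact: c.
- exact: continuous_expR_decay.
- by apply: aeS (aeI dJ (dM 0%N isT)) => x [<-].
Qed.

End Representatives.

(** * Pointwise bounds from finite Sobolev norms *)

Section SobolevNorm.
Context {R : realType}.
Implicit Types (b x r : R) (g : R -> R[i]).

Local Notation mu := (@lebesgue_measure R).

Lemma norm_Re_le (z : R[i]) : `|complex.Re z| <= Normc.normc z.
Proof. by case: z => a c /=; rewrite -sqrtr_sqr ler_wsqrtr// lerDl sqr_ge0. Qed.

Lemma norm_Im_le (z : R[i]) : `|complex.Im z| <= Normc.normc z.
Proof. by case: z => a c /=; rewrite -sqrtr_sqr ler_wsqrtr// lerDr sqr_ge0. Qed.

Lemma lebesgue_measureT_gt0 : (0 < mu setT)%E.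
Proof.
apply: (@lt_le_trans _ _ (mu `[0, 1]%classic)).
  by rewrite lebesgue_measure_itv /= lte_fin ltr01 oppr0 adde0 lte_fin ltr01.
by apply: le_measure; rewrite ?inE.
Qed.

Lemma Linf_norm_ge0 b g : (0 <= Linf_norm b g)%E.
Proof.
apply: ess_sup_ger; first exact: lebesgue_measureT_gt0.
by move=> x; rewrite lee_fin mulr_ge0 ?expR_ge0//; apply: le_trans (norm_Re_le _).
Qed.

Lemma Linf_norm_ae b r g : (Linf_norm b g <= r%:E)%E ->
  {ae mu, forall x, Normc.normc (g x) <= r * expR (- (b * `|x|))}.
Proof.
move=> /ess_supP; apply: aeS => x; rewrite lee_fin => h.
by rewrite expRN ler_pdivlMr ?expR_gt0// mulrC.
Qed.

Lemma Sobolev_norm_ge0 n b g : (0 <= Sobolev_norm n b g)%E.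
Proof.
apply: le_ereal_inf_tmp => _ [d _ <-].
by apply: sume_ge0 => i _; exact: Linf_norm_ge0.
Qed.

(** As r exceeds the infimum strictly, some family of weak derivatives has its total norm below r;
    its real and imaginary parts are regularised separately. *)
Lemma Sobolev_representative n b r g : 0 < b -> (Sobolev_norm n b g < r%:E)%E ->
  [/\ measurable_fun setT (fun x => complex.Re (g x)),
      measurable_fun setT (fun x => complex.Im (g x)) &
      exists A B, [/\ wk n b r A, wk n b r B &
        {ae mu, forall x, complex.Re (g x) = A x /\ complex.Im (g x) = B x}]].
Proof.
move=> b0 Sr.
have r0 : 0 <= r.
  by rewrite -lee_fin; apply: le_trans (ltW Sr); exact: Sobolev_norm_ge0.
have [_ [d [d0 dl dw] <-] dr] := ereal_inf_lt Sr.
have dM l : (l <= n)%N -> {ae mu, forall x, Normc.normc (d l x) <= r * expR (- (b * `|x|))}.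
  move=> ln; apply: Linf_norm_ae; apply: le_trans (ltW dr).
  rewrite (bigD1 (Ordinal (ln : (l < n.+1)%N)))//= leeDl//.
  by apply: sume_ge0 => i _; exact: Linf_norm_ge0.
have mR l : (l <= n)%N -> measurable_fun setT (fun x => complex.Re (d l x)).
  by move=> /dl[[]].
have mI l : (l <= n)%N -> measurable_fun setT (fun x => complex.Im (d l x)).
  by move=> /dl[_ []].
have [A wA dA] : exists2 A, wk n b r A & {ae mu, forall x, complex.Re (d 0%N x) = A x}.
  apply: (wk_representative (d := fun l x => complex.Re (d l x))) => //.
    by move=> l /dM; apply: aeS => x; apply: le_trans; exact: norm_Re_le.
  move=> l ln phi tphi.
  have /(congr1 (@complex.Re R)) := dw l ln phi tphi.
  rewrite /cintegral /= => h.
  transitivity (\int[mu]_x complex.Re (d l x * (derive1 phi x)%:C%C)).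
    by apply: eq_Rintegral => x _; rewrite cReM /= mulr0 subr0.
  rewrite h; congr (- _).
  by apply: eq_Rintegral => x _; rewrite cReM /= mulr0 subr0.
have [B wB dB] : exists2 B, wk n b r B & {ae mu, forall x, complex.Im (d 0%N x) = B x}.
  apply: (wk_representative (d := fun l x => complex.Im (d l x))) => //.
    by move=> l /dM; apply: aeS => x; apply: le_trans; exact: norm_Im_le.
  move=> l ln phi tphi.
  have /(congr1 (@complex.Im R)) := dw l ln phi tphi.
  rewrite /cintegral /= => h.
  transitivity (\int[mu]_x complex.Im (d l x * (derive1 phi x)%:C%C)).
    by apply: eq_Rintegral => x _; rewrite cImM /= mulr0 add0r.
  rewrite h; congr (- _).
  by apply: eq_Rintegral => x _; rewrite cImM /= mulr0 add0r.
rewrite -d0; split; [exact: mR|exact: mI|].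
by exists A, B; split => //; exact: aeI.
Qed.

End SobolevNorm.

(** * Real modes extracted from Hypotheses (V) *)

Section HypothesesV.
Context {R : realType}.

Local Notation mu := (@lebesgue_measure R).

Lemma cvg_real_complex (u : nat -> R) (l : R) :
  (fun n => (u n)%:C%C : R[i]^o) @ \oo --> ((l%:C)%C : R[i]^o) -> u @ \oo --> l.
Proof.
move=> ul; apply/cvgrPdist_lt => e e0.
have e0' : 0 < (e%:C)%C by rewrite ltcR.
move/(@cvgrPdist_lt R[i] R[i]^o nat \oo _ (fun n => ((u n)%:C)%C) (l%:C)%C): ul => /(_ _ e0').
apply: filterS => n.
rewrite -rmorphB normc_def /= expr0n /= addr0 sqrtr_sqr.
by rewrite ltcR.
Qed.

(** The terms j and - j are complex conjugates, and z e^{it} plus its conjugate is 2 Re z cos t - 2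
    Im z sin t. *)
Lemma fourier_mode_conj (qc : int -> R -> R[i]) (lam : int -> R) (j : int) (x y : R) :
  (qc j x)^*%C = qc (- j) x -> lam (- j) = - lam j ->
  fourier_mode qc lam j x y + fourier_mode qc lam (- j) x y =
  ((2 * complex.Re (qc j x) * cos (2 * pi * lam j * y) +
    - (2 * complex.Im (qc j x)) * sin (2 * pi * lam j * y))%:C)%C.
Proof.
move=> qE lE; rewrite /fourier_mode -qE lE.
have -> : 2 * pi * - lam j * y = - (2 * pi * lam j * y) by ring.
set t := 2 * pi * lam j * y; rewrite /cexp.
case: (qc j x) => a b /=; rewrite !(mul0r, mul1r, mulr0, subr0, sub0r, oppr0, add0r, addr0, expR0, cosN, sinN).
by apply/eqP; rewrite eq_complex /=; apply/andP; split; apply/eqP; ring.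
Qed.

Lemma esum_partial (a : int -> \bar R) n : (forall j, 0 <= a j)%E ->
  (\sum_(i < n) a i.+1%:Z <= esum [set j : int | j != 0%R] a)%E.
Proof.
move=> a0; apply: esum_ge.
pose r := [seq i.+1%:Z | i <- iota 0 n].
exists [set` r].
  split; first exact: finite_seq.
  by move=> j /= /mapP[i _ ->].
have ur : uniq r by rewrite map_inj_uniq ?iota_uniq// => i j [].
by rewrite -fsbig_seq// big_map -(big_mkord xpredT (fun i => a i.+1%:Z)) /index_iota subn0.
Qed.

Lemma sum_half_le2 n : \sum_(i < n) 2^-1 ^+ i <= 2 :> R.
Proof.
suff -> : \sum_(i < n) 2^-1 ^+ i = 2 - 2 * 2^-1 ^+ n :> R.
  by rewrite gerBl mulr_ge0// exprn_ge0// invr_ge0.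
elim: n => [|n IH]; first by rewrite big_ord0 expr0; ring.
by rewrite big_ord_recr /= IH exprS; field.
Qed.

Context (theta beta : R) (qav : R -> R) (q : R -> R -> R).
Context (qc : int -> R -> R[i]) (lam : int -> R).
Context (HV : hypV theta beta qav q qc lam).

Let lamn (n : nat) : R := 2 * pi * lam n.+1%:Z.

Let b0 : 0 < beta := hypV_beta HV.

(** Amplitudes of the coefficients as given. Their regularity holds up to null sets only, so
    [hypV_modes] replaces them by representatives. *)
Let RA n x : R := 2 * complex.Re (qc n.+1%:Z x).
Let RB n x : R := - (2 * complex.Im (qc n.+1%:Z x)).

Lemma hypV_oscillation e : oscillation RA RB lamn e (fun x => q x (x / e)).
Proof.
move=> x; apply: cvg_real_complex; have := @hypV_series _ _ _ _ _ _ _ HV x (x / e).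
rewrite (_ : (fun N => _) = (fun n => ((qsum RA RB lamn e n x)%:C)%C)) //.
apply/funext => n; rewrite big_add1 /= big_mkord /qsum rmorph_sum.
apply: eq_bigr => i _; rewrite fourier_mode_conj ?(hypV_conj HV)// ?(hypV_odd HV)//.
rewrite /md /RA /RB /lamn (_ : 2 * pi * lam _ / e * x = 2 * pi * lam i.+1%:Z * (x / e)) //.
by ring.
Qed.

Lemma hypV_finite : (Sobolev_norm 1 beta (fun x => ((qav x)%:C)%C) < +oo)%E /\
  (esum [set j : int | j != 0%R] (fun j => Sobolev_norm 3 beta (qc j)) < +oo)%E.
Proof.
have h1 := @Sobolev_norm_ge0 R 1 beta (fun x => ((qav x)%:C)%C).
have h2 : (0 <= esum [set j : int | j != 0%R] (fun j => Sobolev_norm 3 beta (qc j)))%E.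
  by apply: esum_ge0 => j _; exact: Sobolev_norm_ge0.
by split; apply: le_lt_trans (hypV_norm HV); rewrite ?leeDl ?leeDr.
Qed.

(** Working with regular modes replaces q (x, x / e) by another sum [qe]. The countably many null
    sets where the amplitudes differ do not depend on e, and off their union the two sums
    coincide. *)
Lemma hypV_modes : (~ {ae mu, forall x, forall y, q x y = 0}) ->
  exists A_ B_ M_ Mt Mq qa,
  [/\ modes beta (2 * pi * theta) A_ B_ M_ Mt lamn, wk 1 beta Mq qa,
      exists m x, A_ m x ^+ 2 + B_ m x ^+ 2 != 0 &
      forall e qe, 0 < e -> oscillation A_ B_ lamn e qe ->
        measurable_fun setT (potential_eps qav q e) /\
        {ae mu, forall x, potential_eps qav q e x = qa x + qe x}].
Proof.
move=> q0; have [qavoo qoo] := hypV_finite.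
pose S n := Sobolev_norm 3 beta (qc n.+1%:Z).
pose T := esum [set j : int | j != 0%R] (fun j => Sobolev_norm 3 beta (qc j)).
have S0 n : (0 <= S n)%E by exact: Sobolev_norm_ge0.
have ST n : (\sum_(i < n) S i <= T)%E.
  by apply: (esum_partial (a := fun j => Sobolev_norm 3 beta (qc j))) => j; exact: Sobolev_norm_ge0.
have Tfin : T \is a fin_num.
  by rewrite ge0_fin_numE//; apply: le_trans (ST 0%N); rewrite big_ord0.
have Sfin n : S n \is a fin_num.
  rewrite ge0_fin_numE//; apply: le_lt_trans qoo; apply: le_trans (ST n.+1).
  by rewrite big_ord_recr /= leeDr// sume_ge0.
(* A strict upper bound of each norm is needed; the slack 2^-n adds at most 2 to the total. *)
pose r n := fine (S n) + 2^-1 ^+ n.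
have Sr n : (S n < (r n)%:E)%E.
  by rewrite -(fineK (Sfin n)) lte_fin ltrDl exprn_gt0// invr_gt0.
have rT n : \sum_(i < n) r i <= fine T + 2.
  rewrite big_split /=; apply: lerD (sum_half_le2 n).
  rewrite -lee_fin (fineK Tfin) -sumEFin (eq_bigr (fun i : 'I_n => S i)) => [|i _].
    exact: ST.
  by rewrite fineK.
have rep n : exists AB : (R -> R) * (R -> R), [/\ wk 3 beta (r n) AB.1, wk 3 beta (r n) AB.2 &
    {ae mu, forall x, complex.Re (qc n.+1%:Z x) = AB.1 x /\ complex.Im (qc n.+1%:Z x) = AB.2 x}].
  by have [_ _ [A [B [h1 h2 h3]]]] := Sobolev_representative b0 (Sr n); exists (A, B).
have [AB HAB] := choice rep.
have mRA n : measurable_fun setT (RA n) /\ measurable_fun setT (RB n).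
  have [m1 m2 _] := Sobolev_representative b0 (Sr n); split.
    by apply: measurable_funM => //; exact: measurable_cst.
  apply: measurableT_comp (@oppr_measurable _ _) _.
  by apply: measurable_funM => //; exact: measurable_cst.
have [rq Hrq] : exists rq : R, (Sobolev_norm 1 beta (fun x => ((qav x)%:C)%C) < rq%:E)%E.
  exists (fine (Sobolev_norm 1 beta (fun x => ((qav x)%:C)%C)) + 1).
  have f : Sobolev_norm 1 beta (fun x => ((qav x)%:C)%C) \is a fin_num.
    by rewrite ge0_fin_numE ?Sobolev_norm_ge0.
  by rewrite -{1}(fineK f) lte_fin ltrDl.
have [mqav _ [qa [qb [wqa _ qaE]]]] := Sobolev_representative b0 Hrq.
pose A_ n x : R := 2 * (AB n).1 x; pose B_ n x : R := - (2 * (AB n).2 x).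
have qnE : {ae mu, forall x, forall n, RA n x = A_ n x /\ RB n x = B_ n x}.
  apply/ae_foralln => n; have [_ _] := HAB n; apply: aeS => x [h1 h2].
  by rewrite /RA /RB /A_ /B_ h1 h2.
have pi0 : 0 < 2 * pi :> R by rewrite mulr_gt0// pi_gt0.
have gap (j k : int) : j != 0 -> k != 0 -> j != k -> 2 * pi * theta <= `|2 * pi * lam j - 2 * pi * lam k|.
  move=> j0 k0 jk; rewrite -mulrBr normrM (gtr0_norm pi0) ler_pM2l//.
  exact: (hypV_gap HV).
exists A_, B_, (fun n => 2 * r n), (2 * (fine T + 2)), rq, qa; split => //.
- split.
  + by move=> n; have [h _ _] := HAB n; have := wkZ 2 h; rewrite ger0_norm.
  + by move=> n; have [_ h _] := HAB n; have := wkN (wkZ 2 h); rewrite ger0_norm.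
  + by move=> n; rewrite -mulr_sumr ler_pM2l.
  + by move=> n; rewrite /lamn normrM (gtr0_norm pi0) ler_pM2l// (hypV_gap0 HV).
  + by move=> n m nm; apply: gap => //; apply: contra nm => /eqP[/eqP].
  (* lam n + lam m is the gap between the indices n + 1 and - (m + 1), which differ by their
     sign. *)
  + move=> n m; rewrite /lamn -[lam m.+1%:Z]opprK -(hypV_odd HV)// mulrN.
    by apply: gap.
(* If all regular amplitudes vanished identically, the series would sum to 0 for almost every x and
   every y. *)
- apply: contrapT => hn; apply: q0; apply: aeS qnE => x qx y.
  have [A0 B0] : (forall n, A_ n x = 0) /\ (forall n, B_ n x = 0).
    have H n : A_ n x ^+ 2 + B_ n x ^+ 2 = 0.
      by apply/eqP; apply: contrapT => /negP h; apply: hn; exists n, x.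
    split => n; move: (H n) => /eqP; rewrite paddr_eq0 ?sqr_ge0// !sqrf_eq0.
      by case/andP => /eqP.
    by case/andP => _ /eqP.
  have := @hypV_series _ _ _ _ _ _ _ HV x y.
  rewrite (_ : (fun N => _) = (fun n => ((0 : R)%:C)%C)); last first.
    apply/funext => n; rewrite big_add1 /= big_mkord big1// => i _.
    rewrite fourier_mode_conj ?(hypV_conj HV)// ?(hypV_odd HV)//.
    have [] := qx i; rewrite /RA /RB => -> ->.
    by rewrite A0 B0 !mul0r addr0.
  move=> /cvg_real_complex h; exact: (cvg_unique _ h (cvg_cst 0)).
move=> e qe e0 Hqe; have Hraw := @hypV_oscillation e; split.
  apply: measurable_funD.
    by rewrite (_ : qav = fun x => complex.Re ((qav x)%:C)%C).
  apply: (@measurable_fun_cvg _ _ _ _ (qsum RA RB lamn e)) => [n|x _]; last exact: Hraw.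
  rewrite /qsum; apply: measurable_sum => i; rewrite /md; have [m1 m2] := mRA i.
  apply: measurable_funD; apply: measurable_funM => //.
    by apply: measurableT_comp => //; apply: continuous_measurable_fun; exact: continuous_cos.
  by apply: measurableT_comp => //; apply: continuous_measurable_fun; exact: continuous_sin.
apply: aeS (aeI qaE qnE) => x [[h1 _] hx]; rewrite /potential_eps -h1; congr (_ + _).
apply: (cvg_unique _ (Hraw x)) => //.
rewrite (_ : (fun n => qsum RA RB lamn e n x) = (fun n => qsum A_ B_ lamn e n x)); first exact: Hqe.
apply/funext => n; apply: eq_bigr => i _; rewrite /md.
by have [-> ->] := hx i.
Qed.

End HypothesesV.

(** A change of the coefficients on a null set of x does not affect the Jost solutions, so q being
    nonzero is understood modulo such sets. *)
Theorem corollary3p4 (R : realType) (theta beta : R) (qav : R -> R)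
    (q : R -> R -> R) (qc : int -> R -> R[i]) (lam : int -> R)
    (HV : hypV theta beta qav q qc lam)
    (q_neq0 : ~ (\forall x \ae (@lebesgue_measure R), forall y, q x y = 0)) :
  exists eps0 : R, 0 < eps0 /\
    forall eps : R, 0 < eps -> eps < eps0 ->
      generic (potential_eps qav q eps).
Proof.
have b0 := hypV_beta HV.
have th0 : 0 < 2 * pi * theta.
  by rewrite !mulr_gt0 ?pi_gt0//; exact: hypV_theta HV.
have [A_ [B_ [M_ [Mt [Mq [qa [HM wq [m [x0 AB0]] Heps]]]]]]] := hypV_modes HV q_neq0.
have [e0 e00 He] := modes_wronskian b0 th0 HM wq AB0.
exists e0; split=> // e ep ee.
have [qe Hqe] := oscillation_exists b0 HM e.
have [mV VE] := Heps e qe ep Hqe.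
have wq0 := wk_succ wq; have wqo0 := wk_oppx wq0.
have HMo := modes_oppx HM.
have C0 := CC_ge0 b0 th0 HM wq0.
have pot := potential_oscillation b0 th0 HM wq0 Hqe.
have poto := potential_oscillation b0 th0 HMo wqo0 (oscillation_oppx Hqe).
have [u [u' ju]] := real_jost_exists C0 b0 pot.
have [ut [ut' jut]] := real_jost_exists C0 b0 poto.
have W0 := He e qe u u' ut ut' ep (ltW ee) Hqe ju jut.
apply: (generic_of_wronskian pot.1 C0 b0 pot.2 mV VE (rj_sol ju) (rj_sol jut)).
rewrite (rj_d ju) (rj_d jut) -!rmorphM -rmorphD /=.
by apply: contra W0 => /eqP[->].
Qed.
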